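(* Let $(M,g)$ be a complete simply connected Chern-flat Hermitian manifold of complex dimension $n$, let $\{E_i\}_{i=1}^n$ be a global parallel unitary holomorphic frame of $T^{1,0}M$, and let $V=\sum_{j=1}^n a_jE_j$ with constants $a_1,\ldots,a_n\in\mathbb{C}$. Fix $p\in M$. Then for any $f\in\mathcal{O}_d(M,g)$ we have $V(f)\in\mathcal{O}_{d-1}(M,g)$. Moreover, if a holomorphic function $f$ on $M$ satisfies $$\limsup_{x\to\infty}\frac{|f(x)|}{d_g(p,x)}=0,$$ then $f$ must be constant.
   Context: The Chern connection $D$ of a Hermitian manifold $(M,J,g)$ is the unique connection with $Dg=0$, $DJ=0$ whose $(0,1)$-part is $\bar\partial$. $(M,g)$ is Chern-flat if the curvature of its Chern connection vanishes identically. ''Complete'' means that $g$ is complete as a Riemannian metric; $d_g$ is the Riemannian distance. By a theorem of Boothby, a simply connected Chern-flat manifold admits a global parallel unitary holomorphic frame, i.e. global holomorphic sections $E_1,\ldots,E_n$ of $T^{1,0}M$ with $DE_i=0$ and $g(E_i,\overline{E_j})=\delta_{ij}$. For a fixed base point $p\in M$ and real $d\ge 0$, $\mathcal{O}_d(M,g)$ is the space of holomorphic functions $f$ on $M$ for which there is a constant $C$ with $|f(q)|\le C(1+d_g(q,p))^d$ for all $q\in M$; when $d<1$, $\mathcal{O}_{d-1}(M,g)$ is understood by the same formula with the negative exponent $d-1$. *)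

(* Defs.v *)
From HB Require Import structures.
From mathcomp Require Import all_boot all_order all_algebra.
From mathcomp Require Import all_classical all_reals all_analysis.
From mathcomp Require Import complex.

Set Implicit Arguments.
Unset Strict Implicit.
Unset Printing Implicit Defensive.

Import Order.TTheory GRing.Theory Num.Theory.
Import numFieldNormedType.Exports.

Local Open Scope classical_set_scope.
Local Open Scope ring_scope.
Local Open Scope complex_scope.

(* The topology and norm of [R[i]] as a module over itself. *)
HB.instance Definition _ (R : realType) := NormedModule.copy R[i] R[i]^o.

(** * Real calculus on [C^n]

    The library's derivative along a vector uses the scalars of the normed
    module, here the complex numbers.  It is used below for holomorphy only;
    real differentiation is reduced to the derivatives of real functions of a
    real variable. *)

(* Derivative of a curve in [C^n] with respect to its real parameter. *)
Definition curve_derivable (R : realType) (n : nat) (c : R -> 'rV[R[i]]_n)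
    (t : R) : Prop :=
  forall k, derivable (fun s => complex.Re (c s ord0 k)) t 1 /\
            derivable (fun s => complex.Im (c s ord0 k)) t 1.

Definition curve_derive (R : realType) (n : nat) (c : R -> 'rV[R[i]]_n)
    (t : R) : 'rV[R[i]]_n :=
  \row_k (derive1 (fun s => complex.Re (c s ord0 k)) t
          +i* derive1 (fun s => complex.Im (c s ord0 k)) t).

Definition curve_C1 (R : realType) (n : nat) (c : R -> 'rV[R[i]]_n) : Prop :=
  (forall t, curve_derivable c t) /\
  forall k, continuous (derive1 (fun s => complex.Re (c s ord0 k))) /\
            continuous (derive1 (fun s => complex.Im (c s ord0 k))).

(* Derivative of a real function, and of a [C^n]-valued function, at [x] in the
   real direction [u]. *)
Definition rderive (R : realType) (n : nat) (F : 'rV[R[i]]_n -> R)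
    (u x : 'rV[R[i]]_n) : R :=
  derive1 (fun t : R => F (x + t%:C *: u)) 0.

Definition vderive (R : realType) (n : nat) (Y : 'rV[R[i]]_n -> 'rV[R[i]]_n)
    (u x : 'rV[R[i]]_n) : 'rV[R[i]]_n :=
  curve_derive (fun t : R => Y (x + t%:C *: u)) 0.

Fixpoint class_C (R : realType) (n : nat) (k : nat) (U : set 'rV[R[i]]_n)
    (F : 'rV[R[i]]_n -> R) : Prop :=
  match k with
  | 0 => forall x, U x -> {for x, continuous F}
  | k'.+1 => forall u : 'rV[R[i]]_n,
      (forall x, U x -> derivable (fun t : R => F (x + t%:C *: u)) 0 1) /\
      class_C k' U (rderive F u)
  end.

Definition smooth (R : realType) (n : nat) (U : set 'rV[R[i]]_n)
    (F : 'rV[R[i]]_n -> R) : Prop :=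
  forall k, class_C k U F.

Definition vsmooth (R : realType) (n : nat) (U : set 'rV[R[i]]_n)
    (Y : 'rV[R[i]]_n -> 'rV[R[i]]_n) : Prop :=
  forall k, smooth U (fun x => complex.Re (Y x ord0 k)) /\
            smooth U (fun x => complex.Im (Y x ord0 k)).

(** * Complex manifolds *)

Record complexManifold (R : realType) (n : nat) := ComplexManifold {
  carrier :> topologicalType;
  hausdorffM : hausdorff_space carrier;
  second_countableM : @second_countable carrier;
  chart : Type;
  chart_at : carrier -> chart;
  cdom : chart -> set carrier;
  cimg : chart -> set 'rV[R[i]]_n;
  coord : chart -> carrier -> 'rV[R[i]]_n;
  param : chart -> 'rV[R[i]]_n -> carrier;
  cdom_open : forall i, open (cdom i);
  cimg_open : forall i, open (cimg i);
  chart_atP : forall q, cdom (chart_at q) q;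
  coord_img : forall i q, cdom i q -> cimg i (coord i q);
  param_dom : forall i x, cimg i x -> cdom i (param i x);
  coordK : forall i q, cdom i q -> param i (coord i q) = q;
  paramK : forall i x, cimg i x -> coord i (param i x) = x;
  coord_continuous : forall i, 
    forall q, cdom i q -> {for q, continuous (coord i)};
  param_continuous : forall i, 
    forall x, cimg i x -> {for x, continuous (param i)};
  transition_holomorphic : forall i j x, cimg i x -> cdom j (param i x) ->
    differentiable (fun y : 'rV[R[i]]_n => coord j (param i y)) x
}.

Arguments chart {R n} _.
Arguments chart_at {R n} _ _.
Arguments cdom {R n} _ _.
Arguments cimg {R n} _ _.
Arguments coord {R n} _ _ _.
Arguments param {R n} _ _ _.

Definition overlap (R : realType) (n : nat) (M : complexManifold R n)
    (i j : chart M) : set 'rV[R[i]]_n :=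
  [set x | cimg M i x /\ cdom M j (param M i x)].

Definition transition (R : realType) (n : nat) (M : complexManifold R n)
    (i j : chart M) (x : 'rV[R[i]]_n) : 'rV[R[i]]_n :=
  coord M j (param M i x).

Definition holomorphic (R : realType) (n : nat) (M : complexManifold R n)
    (f : M -> R[i]) : Prop :=
  forall i x, cimg M i x ->
    differentiable (fun y : 'rV[R[i]]_n => f (param M i y)) x.

(** * Tangent vectors

    In the chart [z] a real tangent vector [u] is represented by [dz(u)] in
    [C^n], on which [J] acts as multiplication by ['i].  A vector of type (1,0),
    [\sum_k a_k d/dz_k], is represented by [a]; this is the representative of
    the real vector [u] such that [(u - 'i J u) / 2] is the given vector. *)

Definition J (R : realType) (n : nat) (u : 'rV[R[i]]_n) : 'rV[R[i]]_n :=
  (0 +i* 1 : R[i]) *: u.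

Definition localField (R : realType) (n : nat) (M : complexManifold R n) :=
  chart M -> 'rV[R[i]]_n -> 'rV[R[i]]_n.

Definition vector_field (R : realType) (n : nat) (M : complexManifold R n)
    (X : localField M) : Prop :=
  forall i j x, overlap i j x ->
    X j (transition i j x) = 'd (transition (M := M) i j) x (X i x).

(* Holomorphic section of [T^{1,0}M]. *)
Definition holomorphic_vector_field (R : realType) (n : nat)
    (M : complexManifold R n) (X : localField M) : Prop :=
  vector_field X /\ forall i x, cimg M i x -> differentiable (X i) x.

(* [X f] for [X] of type (1,0) and [f] holomorphic. *)
Definition apply_field (R : realType) (n : nat) (M : complexManifold R n)
    (X : localField M) (f : M -> R[i]) (q : M) : R[i] :=
  let i := chart_at M q in
  'd (fun y : 'rV[R[i]]_n => f (param M i y)) (coord M i q)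
     (X i (coord M i q)).

(** * Hermitian metrics *)

Record hermitianMetric (R : realType) (n : nat) (M : complexManifold R n) :=
  HermitianMetric {
  metric :> chart M -> 'rV[R[i]]_n -> 'rV[R[i]]_n -> 'rV[R[i]]_n -> R;
  metric_linear : forall i x (t : R) u v w, cimg M i x ->
    metric i x (t%:C *: u + v) w = t * metric i x u w + metric i x v w;
  metric_sym : forall i x u v, cimg M i x -> metric i x u v = metric i x v u;
  metric_pos : forall i x u, cimg M i x -> u != 0 -> 0 < metric i x u u;
  metric_J : forall i x u v, cimg M i x ->
    metric i x (J u) (J v) = metric i x u v;
  metric_smooth : forall i u v,
    smooth (cimg M i) (fun x => metric i x u v);
  metric_transition : forall i j x u v, overlap i j x ->
    metric j (transition i j x) ('d (transition (M := M) i j) x u)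
                                ('d (transition (M := M) i j) x v)
    = metric i x u v
}.

(* [g(A, conj B)] for [A], [B] of type (1,0) and [g] extended complex
   bilinearly, obtained by expanding [g((a - 'i J a) / 2, (b + 'i J b) / 2)]. *)
Definition herm (R : realType) (n : nat) (M : complexManifold R n)
    (g : hermitianMetric M) (i : chart M) (x a b : 'rV[R[i]]_n) : R[i] :=
  (g i x a b / 2) +i* (g i x a (J b) / 2).

(** * Riemannian distance and completeness *)

Definition arc_length (R : realType) (n : nat) (M : complexManifold R n)
    (g : hermitianMetric M) (i : chart M) (c : R -> 'rV[R[i]]_n) : R :=
  \int[@lebesgue_measure R]_(t in `[0, 1])
    Num.sqrt (g i (c t) (curve_derive c t) (curve_derive c t)).

(* [joined g p q l]: some piecewise [C^1] curve from [p] to [q] has length [l].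
   The curve is subdivided into [C^1] arcs lying in single charts.  An arc is
   the restriction to [[0, 1]] of a [C^1] curve defined on the whole line, as
   every [C^1] curve on [[0, 1]] is; only the points of [[0, 1]] have to be
   mapped into the chart. *)
Inductive joined (R : realType) (n : nat) (M : complexManifold R n)
    (g : hermitianMetric M) : M -> M -> R -> Prop :=
  | joined_refl (p : M) : joined g p p 0
  | joined_arc (i : chart M) (c : R -> 'rV[R[i]]_n) (q : M) (l : R) :
      curve_C1 c ->
      (forall t : R, 0 <= t <= 1 -> cimg M i (c t)) ->
      joined g (param M i (c 1)) q l ->
      joined g (param M i (c 0)) q (arc_length g i c + l).

Definition dist (R : realType) (n : nat) (M : complexManifold R n)
    (g : hermitianMetric M) (p q : M) : R :=
  inf [set l | joined g p q l].

Definition complete_metric (R : realType) (n : nat) (M : complexManifold R n)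
    (g : hermitianMetric M) : Prop :=
  forall u : nat -> M,
    (forall e : R, 0 < e -> exists N : nat, forall k l : nat,
        (N <= k)%N -> (N <= l)%N -> dist g (u k) (u l) < e) ->
    exists q : M, forall e : R, 0 < e -> exists N : nat, forall k : nat,
        (N <= k)%N -> dist g (u k) q < e.

(** * Simple connectedness *)

Definition path_connected (R : realType) (T : topologicalType) : Prop :=
  forall p q : T, exists gamma : R -> T,
    [/\ {within `[0, 1], continuous gamma}, gamma 0 = p & gamma 1 = q].

Definition loops_contract (R : realType) (T : topologicalType) : Prop :=
  forall gamma : R -> T,
    {within `[0, 1], continuous gamma} -> gamma 0 = gamma 1 ->
    exists H : R * R -> T,
      [/\ {within `[0, 1] `*` `[0, 1], continuous H},
          forall t, 0 <= t <= 1 -> H (0, t) = gamma t,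
          forall t, 0 <= t <= 1 -> H (1, t) = gamma 0 &
          forall s, 0 <= s <= 1 -> H (s, 0) = gamma 0 /\ H (s, 1) = gamma 0].

Definition simply_connected (R : realType) (T : topologicalType) : Prop :=
  path_connected R T /\ loops_contract R T.

(** * The Chern connection *)

(* A (real) connection on the tangent bundle, given by its Christoffel maps
   [Gamma i x u v], the value at [x] of [D_u v] for [v] a field which is constant
   in the chart [i].  The law [christoffel_transition] expresses that [cov] below
   maps vector fields to vector fields. *)
Record connection (R : realType) (n : nat) (M : complexManifold R n) :=
  Connection {
  christoffel :> chart M -> 'rV[R[i]]_n -> 'rV[R[i]]_n -> 'rV[R[i]]_n ->
                 'rV[R[i]]_n;
  christoffel_linear_l : forall i x (t : R) u v w, cimg M i x ->
    christoffel i x (t%:C *: u + v) w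
    = t%:C *: christoffel i x u w + christoffel i x v w;
  christoffel_linear_r : forall i x (t : R) u v w, cimg M i x ->
    christoffel i x w (t%:C *: u + v)
    = t%:C *: christoffel i x w u + christoffel i x w v;
  christoffel_smooth : forall i u v,
    vsmooth (cimg M i) (fun x => christoffel i x u v);
  christoffel_transition : forall i j x u v, overlap i j x ->
    'D_u (fun y : 'rV[R[i]]_n => 'd (transition (M := M) i j) y v) x
    + christoffel j (transition i j x) ('d (transition (M := M) i j) x u)
                                       ('d (transition (M := M) i j) x v)
    = 'd (transition (M := M) i j) x (christoffel i x u v)
}.

(* The covariant derivative [D_u Y] at [x], in the chart [i]. *)
Definition cov (R : realType) (n : nat) (M : complexManifold R n)
    (D : connection M) (i : chart M) (Y : 'rV[R[i]]_n -> 'rV[R[i]]_n)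
    (u x : 'rV[R[i]]_n) : 'rV[R[i]]_n :=
  vderive Y u x + D i x u (Y x).

Definition preserves_metric (R : realType) (n : nat) (M : complexManifold R n)
    (g : hermitianMetric M) (D : connection M) : Prop :=
  forall i (Y Z : 'rV[R[i]]_n -> 'rV[R[i]]_n) u x,
    vsmooth (cimg M i) Y -> vsmooth (cimg M i) Z -> cimg M i x ->
    rderive (fun y => g i y (Y y) (Z y)) u x
    = g i x (cov D i Y u x) (Z x) + g i x (Y x) (cov D i Z u x).

Definition preserves_J (R : realType) (n : nat) (M : complexManifold R n)
    (D : connection M) : Prop :=
  forall i (Y : 'rV[R[i]]_n -> 'rV[R[i]]_n) u x,
    vsmooth (cimg M i) Y -> cimg M i x ->
    cov D i (fun y => J (Y y)) u x = J (cov D i Y u x).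

(* [D^{0,1} = dbar], where the (0,1)-part of an operator [T_u] that is real
   linear in [u] is [(T_u + J T_{J u}) / 2]. *)
Definition zero_one_part (R : realType) (n : nat)
    (T : 'rV[R[i]]_n -> 'rV[R[i]]_n) (u : 'rV[R[i]]_n) : 'rV[R[i]]_n :=
  (2^-1 : R[i]) *: (T u + J (T (J u))).

Definition zero_one_part_dbar (R : realType) (n : nat)
    (M : complexManifold R n) (D : connection M) : Prop :=
  forall i (Y : 'rV[R[i]]_n -> 'rV[R[i]]_n) u x,
    vsmooth (cimg M i) Y -> cimg M i x ->
    zero_one_part (fun v => cov D i Y v x) u
    = zero_one_part (fun v => vderive Y v x) u.

Definition chern_connection (R : realType) (n : nat) (M : complexManifold R n)
    (g : hermitianMetric M) (D : connection M) : Prop :=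
  [/\ preserves_metric g D, preserves_J D & zero_one_part_dbar D].

(* [R(u, v) w = D_u D_v w - D_v D_u w], with [u], [v], [w] extended as constant
   fields in the chart, so that [[u, v] = 0]. *)
Definition curvature (R : realType) (n : nat) (M : complexManifold R n)
    (D : connection M) (i : chart M) (x u v w : 'rV[R[i]]_n) : 'rV[R[i]]_n :=
  cov D i (fun y => cov D i (cst w) v y) u x
  - cov D i (fun y => cov D i (cst w) u y) v x.

Definition flat (R : realType) (n : nat) (M : complexManifold R n)
    (D : connection M) : Prop :=
  forall i x u v w, cimg M i x -> curvature D i x u v w = 0.

Definition parallel (R : realType) (n : nat) (M : complexManifold R n)
    (D : connection M) (X : localField M) : Prop :=
  forall i u x, cimg M i x -> cov D i (X i) u x = 0.

Definition parallel_unitary_holomorphic_frame (R : realType) (n : nat)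
    (M : complexManifold R n) (g : hermitianMetric M) (D : connection M)
    (E : 'I_n -> localField M) : Prop :=
  [/\ forall k, holomorphic_vector_field (E k),
      forall k, parallel D (E k) &
      forall k l i x, cimg M i x ->
        herm g i x (E k i x) (E l i x) = (k == l)%:R].

(** * Growth of holomorphic functions *)

(* The space [O_d(M, g)]; the exponent [d] is an arbitrary real number. *)
Definition growth_space (R : realType) (n : nat) (M : complexManifold R n)
    (g : hermitianMetric M) (p : M) (d : R) : set (M -> R[i]) :=
  [set f | holomorphic f /\
    exists C : R, forall q,
      Normc.normc (f q) <= C * (1 + dist g q p) `^ d].

(* The filter of the complements of compact sets, i.e. [x --> oo] in [T]. *)
Definition at_infinity (T : topologicalType) : set_system T :=
  filter_from [set K : set T | compact K] (fun K => ~` K).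

Arguments at_infinity T : clear implicits.

(* Main.v *)
Require Import Defs.
From HB Require Import structures.
From mathcomp Require Import all_boot all_order all_algebra.
From mathcomp Require Import all_classical all_reals all_analysis.
From mathcomp Require Import complex.
From mathcomp Require Import ring lra.

(** Functions on [M] are studied along integral curves in complex time.  A
    combination [X = \sum_k a_k E_k] of the frame with constant coefficients is
    a holomorphic vector field of constant length, so an integral curve [Phi] of
    [X] in complex time is Lipschitz for the distance ([flow_joined]).
    Completeness then keeps integral curves from running out of [M]: through
    every point [q] there is an entire one, [Phi : C -> M] with [Phi 0 = q] and
    [dist (Phi z) q <= v |z|] ([global_flow]).  For [f] holomorphic on [M],
    [f \o Phi] is an entire function of one variable whose derivative at [0] is
    [X f] at [q], and Cauchy's estimate on the disc of radius [r] bounds [X f]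
    at [q] by [32 / r] times the supremum of [|f|] over the points at distance
    at most [v r] from [q] ([field_estimate]).

    Both claims follow by a choice of [r].  If [f] grows like
    [(1 + dist q p) ^ d], the radius [r = 1 + dist q p] makes that supremum a
    constant multiple of [r ^ d], and the division by [r] lowers the exponent by
    one ([growth_space_field]).  If [f] is sublinear, letting [r] tend to
    infinity gives [X f = 0] for all constant coefficients [a_k]
    ([sublinear_field0]); the frame spans the tangent space at each point, so
    the differential of [f] vanishes and [f] is constant, [M] being connected
    ([sublinear_constant]).

    The analysis on which this rests is developed from the definition of the
    complex derivative: Goursat's theorem for rectangles ([goursat]), Cauchy's
    estimate ([cauchy_estimate]) and its consequences in several variables, the
    holomorphy of derivatives ([differentiable_diff]), and the solution of
    holomorphic differential equations by Picard iteration ([picard]).  On the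
    metric side the essential fact is that points close to [q] for the distance
    are close to [q] in [M] ([dist_near]); the lower bound of the metric in a
    chart that it requires comes from the unitary frame ([metric_lower]). *)

Set Implicit Arguments.
Unset Strict Implicit.
Unset Printing Implicit Defensive.

Import Order.TTheory GRing.Theory Num.Theory.
Import numFieldNormedType.Exports.

Local Open Scope classical_set_scope.
Local Open Scope ring_scope.
Local Open Scope complex_scope.

(** * Real norms and the mean value inequality *)

Section RealNorm.
Context {R : realType}.
Implicit Types V W : normedModType R[i].

(** The norm of an [R[i]]-module has complex values; estimates are done with its
    real part. *)
Definition rnorm {V} (x : V) : R := complex.Re `|x|.

Lemma rnormE V (x : V) : `|x| = (rnorm x)%:C.
Proof.
have := normr_ge0 x; rewrite /rnorm; case: `|x| => a b.
by rewrite lecE /= => /andP[/eqP -> _].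
Qed.

Lemma rnorm_ge0 V (x : V) : 0 <= rnorm x.
Proof. by have := normr_ge0 x; rewrite rnormE ler0c. Qed.

Lemma rnorm0 V : rnorm (0 : V) = 0.
Proof. by rewrite /rnorm normr0. Qed.

Lemma rnorm0_eq0 V (x : V) : rnorm x = 0 -> x = 0.
Proof. by move=> x0; apply/normr0_eq0; rewrite rnormE x0. Qed.

Lemma rnormN V (x : V) : rnorm (- x) = rnorm x.
Proof. by rewrite /rnorm normrN. Qed.

Lemma rnormB V (x y : V) : rnorm (x - y) = rnorm (y - x).
Proof. by rewrite /rnorm distrC. Qed.

Lemma ler_rnormD V (x y : V) : rnorm (x + y) <= rnorm x + rnorm y.
Proof. by have := ler_normD x y; rewrite !rnormE -rmorphD lecR. Qed.

Lemma ler_rnormB V (x y : V) : rnorm (x - y) <= rnorm x + rnorm y.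
Proof. by rewrite -[rnorm y]rnormN ler_rnormD. Qed.

Lemma ler_rdistD V (z x y : V) : rnorm (x - y) <= rnorm (x - z) + rnorm (z - y).
Proof. by apply: le_trans (ler_rnormD _ _); rewrite addrA subrK. Qed.

Lemma ler_rnorm_dist V (x y : V) : rnorm x <= rnorm y + rnorm (x - y).
Proof. by apply: le_trans (ler_rnormD _ _); rewrite addrC subrK. Qed.

Lemma rnormZ V (a : R[i]) (x : V) : rnorm (a *: x) = rnorm a * rnorm x.
Proof. by have := normrZ a x; rewrite !rnormE -rmorphM => /complexI. Qed.

Lemma rnormM (a b : R[i]) : rnorm (a * b) = rnorm a * rnorm b.
Proof. exact: (rnormZ a b). Qed.

Lemma rnormV (a : R[i]) : rnorm a^-1 = (rnorm a)^-1.
Proof.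
by apply: (@complexI R); rewrite -rnormE normfV rnormE fmorphV.
Qed.

Lemma rnorm_normc (a : R[i]) : Normc.normc a = rnorm a.
Proof. by apply: (@complexI R); rewrite -rnormE. Qed.

Lemma rnorm_real (t : R) : rnorm (t%:C : R[i]) = `|t|.
Proof. by rewrite -rnorm_normc /= expr0n addr0 sqrtr_sqr. Qed.

Lemma ler_Re_rnorm (a : R[i]) : `|complex.Re a| <= rnorm a.
Proof.
rewrite -rnorm_normc -sqrtr_sqr; case: a => a b /=.
by rewrite ler_wsqrtr // lerDl sqr_ge0.
Qed.

Lemma ler_Im_rnorm (a : R[i]) : `|complex.Im a| <= rnorm a.
Proof.
rewrite -rnorm_normc -sqrtr_sqr; case: a => a b /=.
by rewrite ler_wsqrtr // lerDr sqr_ge0.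
Qed.

Lemma ler_rnorm_ReIm (a : R[i]) :
  rnorm a <= `|complex.Re a| + `|complex.Im a|.
Proof.
rewrite [in leLHS](complexE a); apply: (le_trans (ler_rnormD _ _)).
rewrite rnormM !rnorm_real -(rnorm_normc 'i) /= expr0n expr1n add0r sqrtr1.
by rewrite mul1r.
Qed.

Lemma rnorm_coord n (v : 'rV[R[i]]_n) k : rnorm (v ord0 k) <= rnorm v.
Proof.
rewrite -lecR -!rnormE [leRHS]/Num.norm/= mx_normE.
rewrite -[leLHS]nngE num_le.
exact: (le_bigmax _ (fun i : 'I_1 * 'I_n => `|v i.1 i.2|%:nng) (ord0, k)).
Qed.

Lemma rnorm_rV_le n (v : 'rV[R[i]]_n) B :
  0 <= B -> (forall k, rnorm (v ord0 k) <= B) -> rnorm v <= B.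
Proof.
move=> B0 vB; rewrite -lecR -rnormE [leLHS]/Num.norm/=.
have [->|/mx_norm_neq0[[i j] /= ->]] := eqVneq (mx_norm v) 0.
  by rewrite ler0c.
by rewrite (ord1 i) rnormE lecR.
Qed.

Lemma nbhs_rnormP V (x : V) (A : set V) :
  nbhs x A <-> exists2 d : R, 0 < d & forall y, rnorm (y - x) < d -> A y.
Proof.
split=> [/nbhs_ballP[e /= e0]|[d d0 dA]].
  rewrite -ball_normE => eA.
  have eE : e = (complex.Re e)%:C.
    by move: e0; case: (e) => a b; rewrite ltcE /= => /andP[/eqP -> _].
  exists (complex.Re e); first by rewrite -(ltcR 0) -eE.
  by move=> y xy; apply: eA => /=; rewrite distrC rnormE eE ltcR.
apply/nbhs_ballP; exists d%:C; first by rewrite /= (ltcR 0).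
rewrite -ball_normE => y; rewrite /= distrC rnormE ltcR.
by move=> /dA.
Qed.

Lemma continuous_rnormP V W (f : V -> W) (x : V) :
  {for x, continuous f} <->
  forall e : R, 0 < e -> exists2 d : R, 0 < d &
    forall y, rnorm (y - x) < d -> rnorm (f y - f x) < e.
Proof.
split=> [fx e e0|H A].
  have /fx /nbhs_rnormP[d d0 dP] : nbhs (f x) [set y | rnorm (y - f x) < e].
    by apply/nbhs_rnormP; exists e.
  by exists d.
move=> /nbhs_rnormP[e e0 eA]; have [d d0 dP] := H _ e0.
by apply/nbhs_rnormP; exists d => // y /dP /eA.
Qed.

Definition rcont V W (f : V -> W) (x : V) : Prop :=
  forall e : R, 0 < e -> exists2 d : R, 0 < d &
    forall y, rnorm (y - x) < d -> rnorm (f y - f x) < e.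

Lemma subrACA (U : zmodType) (a b c d : U) : a - b - (c - d) = a - c - (b - d).
Proof. by rewrite !opprB [d - c]addrC addrACA [- b + d]addrC. Qed.

Lemma rcontB V W (f g : V -> W) x : rcont f x -> rcont g x ->
  rcont (fun y => f y - g y) x.
Proof.
move=> fc gc e e0; have e2 : 0 < e / 2 by lra.
have [d1 d10 H1] := fc _ e2; have [d2 d20 H2] := gc _ e2.
exists (Num.min d1 d2); first by rewrite lt_min d10.
move=> s; rewrite lt_min => /andP[/H1 s1 /H2 s2].
by rewrite subrACA (le_lt_trans (ler_rnormB _ _)) // [e]splitr ltrD.
Qed.

(** The radii are real, and [L] is a bare function, so that maps such as
    [fun h => h *: D] can be used without the structure of a linear map. *)
Definition frechet V W (f : V -> W) (x : V) (L : V -> W) : Prop :=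
  forall e : R, 0 < e -> exists2 d : R, 0 < d &
    forall h, rnorm h < d -> rnorm (f (x + h) - f x - L h) <= e * rnorm h.

Lemma differentiable_frechet V W (f : V -> W) x :
  differentiable f x -> frechet f x ('d f x).
Proof.
move=> /diff_locallyP[_ H] e e0.
have /eqaddoP := H => /(_ e%:C); rewrite (ltcR 0) => /(_ e0).
move=> /nbhs_rnormP[d d0 dP]; exists d => // h hd.
have := dP h; rewrite subr0 => /(_ hd) /=.
rewrite !rnormE -rmorphM lecR; congr (rnorm _ <= _).
by rewrite /= !fctE /= opprD addrA [h + x]addrC.
Qed.

Lemma frechet_differentiable V W (f : V -> W) x (L : {linear V -> W}) :
  continuous L -> frechet f x L ->
  differentiable f x /\ 'd f x = L :> (V -> W).
Proof.
move=> cL H.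
have E : f \o shift x = cst (f x) + L +o_ (0 : V) id.
  apply/eqaddoP => e e0.
  have eE : e = (complex.Re e)%:C.
    by move: e0; case: (e) => a b; rewrite ltcE /= => /andP[/eqP -> _].
  have /H[d d0 dP] : 0 < complex.Re e by rewrite -(ltcR 0) -eE.
  apply/nbhs_rnormP; exists d => // h; rewrite subr0 => /dP.
  rewrite eE !rnormE -rmorphM lecR; congr (rnorm _ <= _).
  by rewrite /= !fctE /= opprD addrA [h + x]addrC.
have dE := diff_unique cL E; split=> //.
by apply/diff_locallyP; rewrite dE.
Qed.

Lemma continuous_linear_rnorm V W (L : {linear V -> W}) : continuous L ->
  exists2 K : R, 0 < K & forall h, rnorm (L h) <= K * rnorm h.
Proof.
move=> /linear_lipschitz[k k0 kP].
have kE : k = (complex.Re k)%:C.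
  by move: k0; case: (k) => a b; rewrite ltcE /= => /andP[/eqP -> _].
exists (complex.Re k); first by rewrite -(ltcR 0) -kE.
by move=> h; have := kP h; rewrite kE !rnormE -rmorphM lecR.
Qed.

Lemma differentiable_rcont V W (f : V -> W) x : differentiable f x -> rcont f x.
Proof. by move=> /differentiable_continuous /continuous_rnormP. Qed.

Lemma diff_scale W (f : R[i] -> W) z h : 'd f z h = h *: 'd f z 1.
Proof.
by rewrite -linearZ /= -[h *: 1]/(h * 1) mulr1.
Qed.

Lemma diff_rnorm V W (f : V -> W) x : differentiable f x ->
  exists2 K : R, 0 < K & forall h, rnorm ('d f x h) <= K * rnorm h.
Proof. by move=> df; apply: continuous_linear_rnorm; exact: diff_continuous. Qed.

Lemma bounded_linear_continuous V W (L : {linear V -> W}) (K : R) :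
  (forall h, rnorm (L h) <= K * rnorm h) -> continuous L.
Proof.
move=> LK x; apply/continuous_rnormP => e e0.
have K1 : 0 < `|K| + 1 by rewrite ltr_wpDl.
exists (e / (`|K| + 1)); first by rewrite divr_gt0.
move=> y; rewrite ltr_pdivlMr // -linearB => yx.
apply: le_lt_trans (LK _) (le_lt_trans _ yx).
rewrite mulrC ler_wpM2l ?rnorm_ge0 //.
by rewrite (le_trans (ler_norm K)) // lerDl.
Qed.

(** The parameter is real while the scalars of [W] are complex, so this is not
    an instance of the differential of a normed module. *)
Definition rderiv W (y : R -> W) (t : R) (D : W) : Prop :=
  forall e : R, 0 < e -> exists2 d : R, 0 < d &
    forall s, `|s| < d -> rnorm (y (t + s) - y t - s%:C *: D) <= e * `|s|.

Lemma rderiv_frechet V W (f : V -> W) (y : R -> V) t D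
    (L : {linear V -> W}) (K : R) :
  (forall h, rnorm (L h) <= K * rnorm h) ->
  rderiv y t D -> frechet f (y t) L -> rderiv (f \o y) t (L D).
Proof.
move=> LK yD fL e e0.
pose K' : R := `|K| + 1; pose B := rnorm D + 1.
have e2 : 0 < e / 2 by lra.
have K'0 : 0 < K' by rewrite ltr_wpDl.
have B0 : 0 < B by rewrite ltr_wpDl ?rnorm_ge0.
have LK' h : rnorm (L h) <= K' * rnorm h.
  apply: le_trans (LK h) _; rewrite ler_wpM2r ?rnorm_ge0 //.
  by rewrite (le_trans (ler_norm K)) // lerDl.
have [d1 d10 H1] := fL (e / 2 / B) (divr_gt0 e2 B0).
have [|d2 d20 H2] := yD (Num.min 1 (e / 2 / K')).
  by rewrite lt_min ltr01 divr_gt0.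
exists (Num.min d2 (d1 / B)); first by rewrite lt_min d20 divr_gt0.
move=> s; rewrite lt_min => /andP[sd2]; rewrite ltr_pdivlMr // => sd1.
have {H2} := H2 _ sd2; set r := y (t + s) - y t - _ => rs.
have hE : y (t + s) - y t = s%:C *: D + r by rewrite /r [RHS]addrC subrK.
have hB : rnorm (s%:C *: D + r) <= B * `|s|.
  rewrite (le_trans (ler_rnormD _ _)) // rnormZ rnorm_real /B mulrDl.
  rewrite [_ * `|s|]mulrC lerD // mul1r (le_trans rs) //.
  by rewrite ler_piMl // ge_min lexx.
have hd : rnorm (s%:C *: D + r) < d1 by rewrite (le_lt_trans hB) // mulrC.
have := H1 _ hd.
rewrite -hE [y t + _]addrC subrK hE linearD linearZ /= => H.
have -> : f (y (t + s)) - f (y t) - s%:C *: L D =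
  (f (y (t + s)) - f (y t) - (s%:C *: L D + L r)) + L r.
  by rewrite opprD addrA subrK.
rewrite (le_trans (ler_rnormD _ _)) // [e]splitr mulrDl lerD //.
  rewrite (le_trans H) // -mulrA ler_wpM2l ?(ltW e2) //.
  by rewrite mulrC ler_pdivrMr // mulrC.
rewrite (le_trans (LK' _)) // mulrC -ler_pdivlMr //.
rewrite (le_trans rs) // [leRHS]mulrAC ler_wpM2r //.
by rewrite ge_min lexx orbT.
Qed.

Lemma rderiv_continuous W (y : R -> W) t D : rderiv y t D ->
  forall e : R, 0 < e -> exists2 d : R, 0 < d &
    forall s, `|s - t| < d -> rnorm (y s - y t) < e.
Proof.
move=> yD e e0; pose B := rnorm D + 1.
have B0 : 0 < B by rewrite ltr_wpDl ?rnorm_ge0.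
have [d d0 H] := yD 1 ltr01.
exists (Num.min d (e / B)); first by rewrite lt_min d0 divr_gt0.
move=> s; rewrite lt_min => /andP[/H]; rewrite mul1r [t + _]addrC subrK => ys.
rewrite ltr_pdivlMr // => se; apply: le_lt_trans se.
rewrite (le_trans (ler_rnorm_dist _ ((s - t)%:C *: D))) // rnormZ rnorm_real.
by rewrite /B mulrDr mulr1 lerD.
Qed.

(** The supremum of the endpoints reached from [a] is reached and cannot lie
    before [b].  All passages from local to global below, along segments, arcs
    and paths, are made with this form of compactness. *)
Lemma cousin (Q : R -> R -> Prop) (a b : R) : a <= b ->
  (forall x y z, a <= x -> x <= y -> y <= z -> z <= b ->
     Q x y -> Q y z -> Q x z) ->
  (forall t, a <= t <= b -> exists2 d : R, 0 < d & forall x y,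
     a <= x -> x <= t -> t <= y -> y <= b -> t - d < x -> y < t + d -> Q x y) ->
  Q a b.
Proof.
move=> ab Qtrans Qloc.
pose S := [set s | [/\ a <= s, s <= b & Q a s]].
have Sa : S a.
  split=> //; have [|d d0] := Qloc a; first by rewrite lexx.
  by apply=> //; rewrite ?ltrBlDr ltrDl.
have Sub : has_sup S by split; [exists a|exists b => x []].
have T1 : a <= sup S by apply: ub_le_sup => //; case: Sub.
have T2 : sup S <= b by apply: ge_sup; [exists a|move=> x []].
have [|d d0 dQ] := Qloc (sup S); first by rewrite T1.
have [s [as' sb Qs] sd] : exists2 s, S s & sup S - d < s.
  by apply: sup_adherent.
have sT : s <= sup S by apply: ub_le_sup => //; case: Sub.
have [bT|Tb] := leP b (sup S + d / 2).
  by apply: (Qtrans _ s) => //; apply: dQ => //; lra.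
have : S (sup S + d / 2).
  split; [lra|lra|]; apply: (Qtrans _ s) => //; try lra.
  by apply: dQ => //; lra.
by move=> /(ub_le_sup (proj2 Sub)); lra.
Qed.

(** The increments are added up with [cousin], with a slack [e] spread over
    the interval that tends to zero at the end. *)
Lemma mean_value W (u : R -> W) (a b B : R) : a <= b ->
  (forall t, a <= t <= b -> forall e : R, 0 < e -> exists2 d : R, 0 < d &
     forall s, a <= s <= b -> `|s - t| < d ->
     rnorm (u s - u t) <= (B + e) * `|s - t|) ->
  rnorm (u b - u a) <= B * (b - a).
Proof.
move=> ab H; apply/ler_addgt0Pl => e e0.
have e'0 : 0 < e / (b - a + 1) by rewrite divr_gt0 // ltr_wpDl // subr_ge0.
apply: (@le_trans _ _ ((B + e / (b - a + 1)) * (b - a))).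
  pose Q x y := rnorm (u y - u x) <= (B + e / (b - a + 1)) * (y - x).
  apply: (@cousin Q) => // [x y z _ _ _ _ Qxy Qyz|t tab].
    rewrite /Q (le_trans (ler_rdistD (u y) _ _)) //.
    have -> : z - x = (z - y) + (y - x) by rewrite addrA subrK.
    by rewrite mulrDr lerD.
  have [d d0 dP] := H t tab _ e'0; exists d => // x y ax xt ty yb dx dy.
  rewrite /Q (le_trans (ler_rdistD (u t) _ _)) //.
  have -> : y - x = (y - t) + (t - x) by rewrite addrA subrK.
  rewrite mulrDr lerD //.
    rewrite -(@ger0_norm _ (y - t)) ?subr_ge0 //; apply: dP; first by lra.
    by rewrite ger0_norm; lra.
  rewrite rnormB -(@ger0_norm _ (t - x)) ?subr_ge0 // distrC; apply: dP; first lra.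
  by rewrite ler0_norm; lra.
rewrite mulrDl addrC lerD2r mulrAC ler_pdivrMr; last by rewrite ltr_wpDl // subr_ge0.
by rewrite ler_wpM2l ?(ltW e0) // lerDl.
Qed.

Lemma rderiv_local W (u : R -> W) t D B e : rderiv u t D -> rnorm D <= B ->
  0 < e -> exists2 d : R, 0 < d &
     forall s, `|s - t| < d -> rnorm (u s - u t) <= (B + e) * `|s - t|.
Proof.
move=> uD DB e0; have [d d0 dP] := uD _ e0; exists d => // s /dP.
rewrite [t + _]addrC subrK => ys.
rewrite (le_trans (ler_rnorm_dist _ ((s - t)%:C *: D))) // rnormZ rnorm_real.
by rewrite mulrDl mulrC lerD // ler_wpM2r.
Qed.

Lemma mean_value_rderiv W (u : R -> W) (D : R -> W) (a b B : R) : a <= b ->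
  (forall t, a <= t <= b -> rderiv u t (D t) /\ rnorm (D t) <= B) ->
  rnorm (u b - u a) <= B * (b - a).
Proof.
move=> ab H; apply: mean_value => // t /H[uD DB] e e0.
by have [d d0 dP] := rderiv_local uD DB e0; exists d => // s _; exact: dP.
Qed.

Lemma rderiv_line V (x v : V) t : rderiv (fun s : R => x + s%:C *: v) t v.
Proof.
move=> e e0; exists 1 => // s _; rewrite rmorphD scalerDl.
by rewrite -addrA -opprD !addrA subrr rnorm0 mulr_ge0 // ltW.
Qed.

(** The segment used for mean value arguments in a vector space and, later, for
    the rays in the complex time plane. *)
Definition seg V (x0 x1 : V) (t : R) : V := x0 + t%:C *: (x1 - x0).

Lemma seg0 V (x0 x1 : V) : seg x0 x1 0 = x0.
Proof. by rewrite /seg scale0r addr0. Qed.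

Lemma seg1 V (x0 x1 : V) : seg x0 x1 1 = x1.
Proof. by rewrite /seg scale1r addrC subrK. Qed.

Lemma mean_value_diff V W (f : V -> W) (x0 x1 : V) (B : R) :
  (forall t, 0 <= t <= 1 -> differentiable f (seg x0 x1 t) /\
     rnorm ('d f (seg x0 x1 t) (x1 - x0)) <= B) ->
  rnorm (f x1 - f x0) <= B.
Proof.
move=> H; rewrite -{1}(seg1 x0 x1) -{2}(seg0 x0 x1).
have := @mean_value_rderiv _ (f \o seg x0 x1)
  (fun t => 'd f (seg x0 x1 t) (x1 - x0)) 0 1 B ler01.
rewrite subr0 mulr1; apply=> t /H[df dB]; split=> //.
have [K _ LK] := diff_rnorm df.
apply: rderiv_frechet LK _ (differentiable_frechet df).
exact: rderiv_line.
Qed.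

Lemma rnorm_seg V (c x0 x1 : V) (r t : R) : 0 <= t <= 1 ->
  rnorm (x0 - c) < r -> rnorm (x1 - c) < r -> rnorm (seg x0 x1 t - c) < r.
Proof.
move=> /andP[t0 t1] h0 h1.
have -> : seg x0 x1 t - c = (1 - t)%:C *: (x0 - c) + t%:C *: (x1 - c).
  rewrite /seg rmorphB scalerBl scale1r !scalerBr.
  rewrite opprB -[RHS]addrA [X in _ = _ + X]addrC [X in _ = _ + X]addrA.
  by rewrite subrK addrAC.
rewrite (le_lt_trans (ler_rnormD _ _)) // !rnormZ !rnorm_real !ger0_norm ?subr_ge0 //.
by case: (ltP 0 t) => ?; nra.
Qed.

End RealNorm.

(** * Integrals of continuous functions of a real variable *)

Section Integral.
Context {R : realType}.
Local Notation mu := (@lebesgue_measure R).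

Definition continuous_on (f : R -> R) (a b : R) : Prop :=
  forall t, a <= t <= b -> forall e : R, 0 < e -> exists2 d : R, 0 < d &
    forall s, a <= s <= b -> `|s - t| < d -> `|f s - f t| < e.

Definition rint (f : R -> R) (a b : R) : R := \int[mu]_(t in `[a, b]) f t.

Lemma continuous_on_integrable f a b : continuous_on f a b ->
  mu.-integrable `[a, b] (EFin \o f).
Proof.
move=> fc; apply: continuous_compact_integrable; first exact: segment_compact.
apply/subspace_continuousP => t /= tab.
apply/cvgrPdist_lt => e e0; have [d d0 dP] := fc t tab e e0.
apply/nbhs_ballP; exists d => // s; rewrite /ball /= distrC => sd sab.
by rewrite distrC; exact: dP.
Qed.

Lemma lebesgue_itv (a b : R) : a <= b -> fine (mu `[a, b]%classic) = b - a.
Proof.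
move=> ab; rewrite lebesgue_measure_itv /= lte_fin.
by move: ab; rewrite le_eqVlt => /orP[/eqP ->|->//]; rewrite ltxx subrr.
Qed.

Lemma rint_cst c a b : a <= b -> rint (fun=> c) a b = c * (b - a).
Proof. by move=> ab; rewrite /rint Rintegral_cst // lebesgue_itv. Qed.

Lemma ler_rint f g a b : continuous_on f a b -> continuous_on g a b ->
  (forall t, a <= t <= b -> f t <= g t) -> rint f a b <= rint g a b.
Proof.
move=> fc gc fg; apply: le_Rintegral => //; try exact: continuous_on_integrable.
all: by move=> t /=; rewrite in_itv /= => /fg.
Qed.

Lemma continuous_on_cst c a b : continuous_on (fun=> c) a b.
Proof. by move=> t _ e e0; exists 1 => // s _ _; rewrite subrr normr0. Qed.

Lemma rint_ge f a b m : a <= b -> continuous_on f a b ->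
  (forall t, a <= t <= b -> m <= f t) -> m * (b - a) <= rint f a b.
Proof.
move=> ab fc mf; rewrite -rint_cst //; apply: ler_rint => //.
exact: continuous_on_cst.
Qed.

Lemma rint_le f a b m : a <= b -> continuous_on f a b ->
  (forall t, a <= t <= b -> f t <= m) -> rint f a b <= m * (b - a).
Proof.
move=> ab fc mf; rewrite -rint_cst //; apply: ler_rint => //.
exact: continuous_on_cst.
Qed.

Lemma rint_bound f a b B : a <= b -> continuous_on f a b ->
  (forall t, a <= t <= b -> `|f t| <= B) -> `|rint f a b| <= B * (b - a).
Proof.
move=> ab fc fB; rewrite ler_norml -mulNr rint_le ?rint_ge //.
- by move=> t /fB; rewrite ler_norml => /andP[].
- by move=> t /fB; rewrite ler_norml => /andP[].
Qed.

Lemma rintB f g a b : continuous_on f a b -> continuous_on g a b ->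
  rint (fun t => f t - g t) a b = rint f a b - rint g a b.
Proof.
by move=> fc gc; rewrite /rint RintegralB //; exact: continuous_on_integrable.
Qed.

Lemma rintD f g a b : continuous_on f a b -> continuous_on g a b ->
  rint (fun t => f t + g t) a b = rint f a b + rint g a b.
Proof.
by move=> fc gc; rewrite /rint RintegralD //; exact: continuous_on_integrable.
Qed.

Lemma rintZ f c a b : continuous_on f a b ->
  rint (fun t => c * f t) a b = c * rint f a b.
Proof.
by move=> fc; rewrite /rint RintegralZl //; exact: continuous_on_integrable.
Qed.

Lemma eq_rint f g a b : (forall t, a <= t <= b -> f t = g t) ->
  rint f a b = rint g a b.
Proof.
by move=> fg; apply: eq_Rintegral => t; rewrite inE /= in_itv /= => /fg.
Qed.

Lemma rint_split f a b c : a <= b -> b <= c -> continuous_on f a c ->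
  rint f a c = rint f a b + rint f b c.
Proof.
move=> ab bc fc; have ac := le_trans ab bc.
rewrite /rint (@itv_bndbnd_setU _ _ (BLeft a) (BRight b) (BRight c)) ?bnd_simp //.
rewrite Rintegral_setU //=.
- congr (_ + _); rewrite Rintegral_itv_obnd_cbnd //.
  apply: (@integrableS _ _ _ mu `[b, c]) => //.
    by apply: subset_itvr; rewrite bnd_simp.
  apply: continuous_on_integrable => t tbc e e0.
  have [|d d0 dP] := fc t _ e e0; first by lra.
  by exists d => // s sbc; apply: dP; lra.
- rewrite -itv_bndbnd_setU ?bnd_simp //; exact: continuous_on_integrable.
- apply/disj_setPS => t /= []; rewrite !in_itv /= => /andP[_ tb] /andP[bt _].
  by move: (lt_le_trans bt tb); rewrite ltxx.
Qed.

End Integral.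

Section ComplexIntegral.
Context {R : realType}.
Implicit Types W : normedModType R[i].

Definition vcontinuous_on W (h : R -> W) (a b : R) : Prop :=
  forall t, a <= t <= b -> forall e : R, 0 < e -> exists2 d : R, 0 < d &
    forall s, a <= s <= b -> `|s - t| < d -> rnorm (h s - h t) < e.

Definition cint (h : R -> R[i]) (a b : R) : R[i] :=
  rint (fun t => complex.Re (h t)) a b +i* rint (fun t => complex.Im (h t)) a b.

Lemma ReB (z w : R[i]) : complex.Re (z - w) = complex.Re z - complex.Re w.
Proof. by case: z w => a b []. Qed.

Lemma ImB (z w : R[i]) : complex.Im (z - w) = complex.Im z - complex.Im w.
Proof. by case: z w => a b []. Qed.

Lemma vcontinuous_Re h a b : vcontinuous_on h a b ->
  continuous_on (fun t => complex.Re (h t) : R) a b.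
Proof.
move=> hc t /hc H e /H[d d0 dP]; exists d => // s ? /dP; rewrite -ReB => sd.
by apply: le_lt_trans (ler_Re_rnorm _) (sd _).
Qed.

Lemma vcontinuous_Im h a b : vcontinuous_on h a b ->
  continuous_on (fun t => complex.Im (h t) : R) a b.
Proof.
move=> hc t /hc H e /H[d d0 dP]; exists d => // s ? /dP; rewrite -ImB => sd.
by apply: le_lt_trans (ler_Im_rnorm _) (sd _).
Qed.

Lemma vcontinuous_sub W (h : R -> W) a b a' b' : a <= a' -> b' <= b ->
  vcontinuous_on h a b -> vcontinuous_on h a' b'.
Proof.
move=> aa bb hc t tab e e0; have [|d d0 dP] := hc t _ e e0; first by lra.
by exists d => // s sab; apply: dP; lra.
Qed.

Lemma vcontinuousB W (h g : R -> W) a b : vcontinuous_on h a b ->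
  vcontinuous_on g a b -> vcontinuous_on (fun t => h t - g t) a b.
Proof.
move=> hc gc t tab e e0; have e2 : 0 < e / 2 by lra.
have [d1 d10 H1] := hc t tab _ e2; have [d2 d20 H2] := gc t tab _ e2.
exists (Num.min d1 d2); first by rewrite lt_min d10.
move=> s sab; rewrite lt_min => /andP[/(H1 _ sab) s1 /(H2 _ sab) s2].
rewrite subrACA.
by rewrite (le_lt_trans (ler_rnormB _ _)) // [e]splitr ltrD.
Qed.

Lemma vcontinuousZ W (h : R -> W) (c : R[i]) a b : vcontinuous_on h a b ->
  vcontinuous_on (fun t => c *: h t) a b.
Proof.
move=> hc t tab e e0; have c0 : 0 < rnorm c + 1 by rewrite ltr_wpDl ?rnorm_ge0.
have [d d0 dP] := hc t tab _ (divr_gt0 e0 c0); exists d => // s sab /(dP _ sab).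
rewrite -scalerBr rnormZ ltr_pdivlMr // mulrC; apply: le_lt_trans.
by rewrite ler_wpM2r ?rnorm_ge0 // lerDl.
Qed.

Lemma vcontinuous_cst W (c : W) a b : vcontinuous_on (fun=> c) a b.
Proof. by move=> t _ e e0; exists 1 => // s _ _; rewrite subrr rnorm0. Qed.

Lemma cint_cst c a b : a <= b -> cint (fun=> c) a b = (b - a)%:C * c.
Proof.
move=> ab; rewrite /cint !rint_cst //; case: c => x y; simpc => /=.
by rewrite ![_ * (b - a)]mulrC.
Qed.

Lemma cintB h g a b : vcontinuous_on h a b -> vcontinuous_on g a b ->
  cint (fun t => h t - g t) a b = cint h a b - cint g a b.
Proof.
move=> hc gc; rewrite /cint; simpc.
rewrite -!rintB; try exact: vcontinuous_Re; try exact: vcontinuous_Im.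
by congr (_ +i* _); apply: eq_rint => t _; rewrite ?ReB ?ImB.
Qed.

Lemma continuous_onZ (f : R -> R) c a b : continuous_on f a b ->
  continuous_on (fun t => c * f t) a b.
Proof.
move=> fc t tab e e0; have c0 : 0 < `|c| + 1 by rewrite ltr_wpDl.
have [d d0 dP] := fc t tab _ (divr_gt0 e0 c0); exists d => // s sab /(dP _ sab).
rewrite -mulrBr normrM ltr_pdivlMr // mulrC; apply: le_lt_trans.
by rewrite ler_wpM2r // lerDl.
Qed.

Lemma cintZ (h : R -> R[i]) c a b : vcontinuous_on h a b ->
  cint (fun t => c * h t) a b = c * cint h a b.
Proof.
move=> hc; have hr := vcontinuous_Re hc; have hi := vcontinuous_Im hc.
case: c => p q; rewrite /cint; simpc.
rewrite -!rintZ // -rintB -?rintD //; try exact: continuous_onZ.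
by congr (_ +i* _); apply: eq_rint => t _; case: (h t) => u v; simpc.
Qed.

(** The factor [2], lost by treating the real and imaginary parts separately, is
    harmless for all later uses. *)
Lemma cint_bound h a b B : a <= b -> vcontinuous_on h a b ->
  (forall t, a <= t <= b -> rnorm (h t) <= B) ->
  rnorm (cint h a b) <= 2 * B * (b - a).
Proof.
move=> ab hc hB; rewrite (le_trans (ler_rnorm_ReIm _)) //=.
have -> : 2 * B * (b - a) = B * (b - a) + B * (b - a) by ring.
rewrite lerD // rint_bound //; try exact: vcontinuous_Re; try exact: vcontinuous_Im.
- by move=> t /hB; apply: le_trans; exact: ler_Re_rnorm.
- by move=> t /hB; apply: le_trans; exact: ler_Im_rnorm.
Qed.

Lemma cint_split h a b c : a <= b -> b <= c -> vcontinuous_on h a c ->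
  cint h a c = cint h a b + cint h b c.
Proof.
move=> ab bc hc; rewrite /cint; simpc.
rewrite (@rint_split _ _ a b c) //; last exact: vcontinuous_Re.
by rewrite (@rint_split _ (fun t => complex.Im (h t)) a b c) //;
   exact: vcontinuous_Im.
Qed.

(** The difference of the two sides is additive, and on a short interval around
    [t] it is at most [3 e] times the length, by continuity of [h] at [t] and
    differentiability of [H] at [t]; [cousin] carries this to [[a, b]]. *)
Lemma cint_ftc (h H : R -> R[i]) a b : a <= b -> vcontinuous_on h a b ->
  (forall t, a <= t <= b -> rderiv H t (h t)) -> cint h a b = H b - H a.
Proof.
move=> ab hc HD; apply/eqP; rewrite -subr_eq0; apply/eqP/rnorm0_eq0.
apply/eqP; rewrite eq_le rnorm_ge0 andbT; apply/ler_addgt0Pl => /= e' e'0.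
rewrite addr0; pose e : R := e' / (b - a + 1) / 3.
have ba1 : 0 < b - a + 1 by lra.
have e0 : 0 < e by rewrite !divr_gt0.
pose Q x y := rnorm (cint h x y - (H y - H x)) <= 3 * e * (y - x).
suff : Q a b.
  have e'E : 3 * e * (b - a + 1) = e' by rewrite /e; field; lra.
  by move=> /le_trans; apply; nra.
apply: (@cousin _ Q) => //.
  move=> x y z ax xy yz zb Qxy Qyz; rewrite /Q (@cint_split _ x y z) //; last first.
    exact: vcontinuous_sub hc.
  have -> : cint h x y + cint h y z - (H z - H x) =
    (cint h x y - (H y - H x)) + (cint h y z - (H z - H y)) by ring.
  rewrite (le_trans (ler_rnormD _ _)) //.
  have -> : z - x = (y - x) + (z - y) by ring.
  by rewrite mulrDr lerD.
move=> t tab; have [d1 d10 H1] := hc t tab e e0; have [d2 d20 H2] := HD t tab e e0.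
exists (Num.min d1 d2); first by rewrite lt_min d10.
move=> x y ax xt ty yb; rewrite ltrBlDr -ltrBlDl -ltrBlDl !lt_min.
move=> /andP[x1 x2] /andP[y1 y2]; rewrite /Q.
have xy : x <= y by lra.
have hxy : vcontinuous_on h x y by exact: vcontinuous_sub hc.
have -> : cint h x y - (H y - H x) = cint (fun s => h s - h t) x y
    - (H y - H t - (y - t)%:C * h t) + (H x - H t - (x - t)%:C * h t).
  rewrite cintB //; last exact: vcontinuous_cst.
  by rewrite cint_cst // !rmorphB; ring.
rewrite (le_trans (ler_rnormD _ _)) //.
have -> : 3 * e * (y - x) = 2 * e * (y - x) + e * (y - t) + e * (t - x) by ring.
rewrite lerD //; first rewrite (le_trans (ler_rnormB _ _)) // lerD //.
- apply: cint_bound => //; first by apply: vcontinuousB => //; exact: vcontinuous_cst.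
  move=> s sxy; apply/ltW/H1; first by lra.
  by rewrite ltr_norml; lra.
- have := H2 (y - t); rewrite [t + _]addrC subrK ger0_norm; last by lra.
  by apply.
- have := H2 (x - t); rewrite [t + _]addrC subrK ler0_norm; last by lra.
  by rewrite opprB; apply.
Qed.

End ComplexIntegral.

(** * Goursat's theorem *)

Section Goursat.
Context {R : realType}.

Lemma expr2n_small (w d : R) : 0 < d -> exists n, w / 2 ^+ n < d.
Proof.
move=> d0; have [N Nw] : exists N : nat, `|w| / d < N%:R.
  by exists (Num.bound (`|w| / d)); apply: archi_boundP; rewrite divr_ge0 // ltW.
exists N; rewrite ltr_pdivrMr ?exprn_gt0 //.
apply: le_lt_trans (ler_norm w) _; move: Nw; rewrite ltr_pdivrMr // mulrC.
move=> /lt_le_trans; apply; rewrite ler_wpM2l ?(ltW d0) //; apply: ltW.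
by rewrite -natrX ltr_nat; apply/ltn_expl.
Qed.

(** Two-dimensional analogue of [cousin], by bisection.  Rectangles are given by
    their lower left corner and their side lengths, and halving both sides keeps
    the shape, so that a nested sequence of counterexamples shrinks to a
    point. *)
Lemma cousin_rectangle (Q : R -> R -> R -> R -> Prop) (x0 y0 w0 v0 : R) :
  0 <= w0 -> 0 <= v0 ->
  (forall x y w v, x0 <= x -> x + w <= x0 + w0 -> y0 <= y -> y + v <= y0 + v0 ->
     0 <= w -> 0 <= v ->
     Q x y (w / 2) (v / 2) -> Q (x + w / 2) y (w / 2) (v / 2) ->
     Q x (y + v / 2) (w / 2) (v / 2) ->
     Q (x + w / 2) (y + v / 2) (w / 2) (v / 2) -> Q x y w v) ->
  (forall p q, x0 <= p <= x0 + w0 -> y0 <= q <= y0 + v0 ->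
     exists2 d : R, 0 < d & forall x y w v,
       x0 <= x -> x + w <= x0 + w0 -> y0 <= y -> y + v <= y0 + v0 ->
       0 <= w -> 0 <= v -> w < d -> v < d ->
       x <= p <= x + w -> y <= q <= y + v -> Q x y w v) ->
  Q x0 y0 w0 v0.
Proof.
move=> w00 v00 Qsub Qloc; apply: contrapT => nQ.
pose inside (s : R * R * R * R) := let: (x, y, w, v) := s in
  [/\ x0 <= x, x + w <= x0 + w0, y0 <= y & y + v <= y0 + v0] /\
  [/\ 0 <= w, 0 <= v & ~ Q x y w v].
pose child (s t : R * R * R * R) := let: (x, y, w, v) := s in
  let: (x', y', w', v') := t in
  [/\ w' = w / 2, v' = v / 2, x <= x' <= x + w / 2 & y <= y' <= y + v / 2].
have step s : exists t, inside s -> inside t /\ child s t.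
  case: s => [[[x y] w] v].
  have [[ix iQ]|ni] := pselect (inside (x, y, w, v)); last by exists (x, y, w, v).
  case: ix iQ => xa xb ya yb [w0' v0' nQs].
  have [q1|q1] := pselect (Q x y (w / 2) (v / 2)); last first.
    by exists (x, y, w / 2, v / 2) => _; do !split=> //; lra.
  have [q2|q2] := pselect (Q (x + w / 2) y (w / 2) (v / 2)); last first.
    by exists (x + w / 2, y, w / 2, v / 2) => _; do !split=> //; lra.
  have [q3|q3] := pselect (Q x (y + v / 2) (w / 2) (v / 2)); last first.
    by exists (x, y + v / 2, w / 2, v / 2) => _; do !split=> //; lra.
  have [q4|q4] := pselect (Q (x + w / 2) (y + v / 2) (w / 2) (v / 2)); last first.
    by exists (x + w / 2, y + v / 2, w / 2, v / 2) => _; do !split=> //; lra.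
  by case: nQs; apply: Qsub.
have [f fP] := choice step.
pose r n := iter n f (x0, y0, w0, v0).
have rin n : inside (r n).
  by elim: n => [|n IHn]; [do !split=> // | exact: (fP _ IHn).1].
have rch n : child (r n) (r n.+1) by exact: (fP _ (rin n)).2.
pose X n := (r n).1.1.1; pose Y n := (r n).1.1.2.
pose A n := (r n).1.2; pose B n := (r n).2.
have inP n : [/\ x0 <= X n, X n + A n <= x0 + w0, y0 <= Y n & Y n + B n <= y0 + v0]
    /\ [/\ 0 <= A n, 0 <= B n & ~ Q (X n) (Y n) (A n) (B n)].
  by have := rin n; rewrite /X /Y /A /B; case: (r n) => [[[]]].
have chP n : [/\ A n.+1 = A n / 2, B n.+1 = B n / 2,
    X n <= X n.+1 <= X n + A n / 2 & Y n <= Y n.+1 <= Y n + B n / 2].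
  have := rch n; rewrite /X /Y /A /B.
  by case: (r n) => [[[? ?] ?] ?]; case: (r n.+1) => [[[? ?] ?] ?].
have An n : A n = w0 / 2 ^+ n.
  elim: n => [|n IHn]; first by rewrite expr0 divr1.
  by have [-> _ _ _] := chP n; rewrite IHn exprSr invfM mulrA.
have Bn n : B n = v0 / 2 ^+ n.
  elim: n => [|n IHn]; first by rewrite expr0 divr1.
  by have [_ -> _ _] := chP n; rewrite IHn exprSr invfM mulrA.
have mono n k : [/\ X n <= X (k + n)%N, X (k + n)%N + A (k + n)%N <= X n + A n,
    Y n <= Y (k + n)%N & Y (k + n)%N + B (k + n)%N <= Y n + B n].
  elim: k => [|k [h1 h2 h3 h4]] //; rewrite addSn.
  by have [-> -> h5 h6] := chP (k + n)%N; split; lra.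
have Xle m n : X m <= X n + A n.
  have [h1 _ _ _] := mono m n; have [_ h2 _ _] := mono n m.
  have [_ [h3 _ _]] := inP (n + m)%N; move: h2; rewrite [(m + n)%N]addnC; lra.
have Yle m n : Y m <= Y n + B n.
  have [_ _ h1 _] := mono m n; have [_ _ _ h2] := mono n m.
  have [_ [_ h3 _]] := inP (n + m)%N; move: h2; rewrite [(m + n)%N]addnC; lra.
have supX : has_sup (range X).
  by split; [exists (X 0%N), 0%N | exists (X 0%N + A 0%N) => _ [n _ <-]].
have supY : has_sup (range Y).
  by split; [exists (Y 0%N), 0%N | exists (Y 0%N + B 0%N) => _ [n _ <-]].
have pX n : X n <= sup (range X) <= X n + A n.
  rewrite ub_le_sup /=; [|by case: supX|by exists n].
  by apply: ge_sup; [case: supX|move=> _ [m _ <-]].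
have pY n : Y n <= sup (range Y) <= Y n + B n.
  rewrite ub_le_sup /=; [|by case: supY|by exists n].
  by apply: ge_sup; [case: supY|move=> _ [m _ <-]].
have [d d0 dQ] := Qloc _ _ (pX 0%N) (pY 0%N).
have [n1 hn1] := expr2n_small w0 d0; have [n2 hn2] := expr2n_small v0 d0.
have dec (w : R) n m : 0 <= w -> (n <= m)%N -> w / 2 ^+ m <= w / 2 ^+ n.
  move=> w0' nm; rewrite ler_wpM2l // lef_pV2 ?posrE ?exprn_gt0 //.
  by rewrite ler_weXn2l // ler1n.
have [[i1 i2 i3 i4] [i5 i6]] := inP (maxn n1 n2); apply.
apply: dQ => //.
- by rewrite An (le_lt_trans _ hn1) // dec // leq_maxl.
- by rewrite Bn (le_lt_trans _ hn2) // dec // leq_maxr.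
Qed.

(** The contour integral of [F] along the positively oriented boundary of
    [[a, b] x [c, d]]. *)
Definition bdint (F : R[i] -> R[i]) (a b c d : R) : R[i] :=
  cint (fun x => F (x +i* c)) a b - cint (fun x => F (x +i* d)) a b
  + 'i * (cint (fun y => F (b +i* y)) c d - cint (fun y => F (a +i* y)) c d).

Definition rectangle (a b c d : R) (z : R[i]) : Prop :=
  a <= complex.Re z <= b /\ c <= complex.Im z <= d.

Definition boundary (a b c d : R) (z : R[i]) : Prop :=
  rectangle a b c d z /\ [\/ complex.Re z = a, complex.Re z = b,
                             complex.Im z = c | complex.Im z = d].

Lemma rnorm_hline (s t y : R) : rnorm ((s +i* y) - (t +i* y) : R[i]) = `|s - t|.
Proof. by rewrite -rnorm_real; simpc. Qed.

Lemma rnorm_vline (s t x : R) : rnorm ((x +i* s) - (x +i* t) : R[i]) = `|s - t|.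
Proof.
have -> : (x +i* s) - (x +i* t) = 'i * (s - t)%:C :> R[i] by simpc.
rewrite rnormM rnorm_real -(rnorm_normc 'i) /= expr0n expr1n add0r sqrtr1.
by rewrite mul1r.
Qed.

Lemma vcontinuous_hline (F : R[i] -> R[i]) y a b :
  (forall x, a <= x <= b -> rcont F (x +i* y)) ->
  vcontinuous_on (fun x => F (x +i* y)) a b.
Proof.
move=> Fc t /Fc H e /H[d d0 dP]; exists d => // s _ sd.
by apply: dP; rewrite rnorm_hline.
Qed.

Lemma vcontinuous_vline (F : R[i] -> R[i]) x a b :
  (forall y, a <= y <= b -> rcont F (x +i* y)) ->
  vcontinuous_on (fun y => F (x +i* y)) a b.
Proof.
move=> Fc t /Fc H e /H[d d0 dP]; exists d => // s _ sd.
by apply: dP; rewrite rnorm_vline.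
Qed.

Section Boundary.
Variables (a b c d : R).
Hypotheses (ab : a <= b) (cd : c <= d).

Lemma boundary_sides (P : R[i] -> Prop) : (forall z, boundary a b c d z -> P z) ->
  [/\ forall x, a <= x <= b -> P (x +i* c), forall x, a <= x <= b -> P (x +i* d),
      forall y, c <= y <= d -> P (b +i* y) & forall y, c <= y <= d -> P (a +i* y)].
Proof.
move=> H; split=> [x xab|x xab|y ycd|y ycd]; apply: H.
- by split; [split=> //=; rewrite lexx|constructor 3].
- by split; [split=> //=; rewrite lexx andbT|constructor 4].
- by split; [split=> //=; rewrite lexx andbT|constructor 2].
- by split; [split=> //=; rewrite lexx|constructor 1].
Qed.

Lemma boundary_continuous (F : R[i] -> R[i]) :
  (forall z, boundary a b c d z -> rcont F z) ->
  [/\ vcontinuous_on (fun x => F (x +i* c)) a b,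
      vcontinuous_on (fun x => F (x +i* d)) a b,
      vcontinuous_on (fun y => F (b +i* y)) c d &
      vcontinuous_on (fun y => F (a +i* y)) c d].
Proof.
move=> /boundary_sides[h1 h2 h3 h4].
split; [exact: (vcontinuous_hline h1)|exact: (vcontinuous_hline h2)|
        exact: (vcontinuous_vline h3)|exact: (vcontinuous_vline h4)].
Qed.

Lemma bdintB (F G : R[i] -> R[i]) : (forall z, boundary a b c d z -> rcont F z) ->
  (forall z, boundary a b c d z -> rcont G z) ->
  bdint (fun z => F z - G z) a b c d = bdint F a b c d - bdint G a b c d.
Proof.
move=> /boundary_continuous[? ? ? ?] /boundary_continuous[? ? ? ?].
by rewrite /bdint !cintB //; ring.
Qed.

Lemma bdintZ (F : R[i] -> R[i]) k : (forall z, boundary a b c d z -> rcont F z) ->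
  bdint (fun z => k * F z) a b c d = k * bdint F a b c d.
Proof.
by move=> /boundary_continuous[? ? ? ?]; rewrite /bdint !cintZ //; ring.
Qed.

Lemma bdint_bound (F : R[i] -> R[i]) B :
  (forall z, boundary a b c d z -> rcont F z) ->
  (forall z, boundary a b c d z -> rnorm (F z) <= B) ->
  rnorm (bdint F a b c d) <= 4 * B * ((b - a) + (d - c)).
Proof.
move=> /boundary_continuous[c1 c2 c3 c4] /boundary_sides[b1 b2 b3 b4].
rewrite /bdint (le_trans (ler_rnormD _ _)) // rnormM.
rewrite -(rnorm_normc 'i) /= expr0n expr1n add0r sqrtr1 mul1r.
have -> : 4 * B * ((b - a) + (d - c)) =
  (2 * B * (b - a) + 2 * B * (b - a)) + (2 * B * (d - c) + 2 * B * (d - c)) by ring.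
by rewrite lerD // (le_trans (ler_rnormB _ _)) // lerD // cint_bound.
Qed.

(** Along each side, the integral is the difference of the values of the
    primitive at the corners. *)
Lemma bdint_primitive (F G : R[i] -> R[i]) :
  (forall z, boundary a b c d z -> rcont F z) ->
  (forall z, boundary a b c d z -> frechet G z (fun h => h * F z)) ->
  bdint F a b c d = 0.
Proof.
move=> Fc GF; have [c1 c2 c3 c4] := boundary_continuous Fc.
have [d1 d2 d3 d4] := boundary_sides GF.
have hl y t : frechet G (t +i* y) (fun h => h * F (t +i* y)) ->
    rderiv (fun x => G (x +i* y)) t (F (t +i* y)).
  move=> H e /H[r r0 rP]; exists r => // s sr.
  have := rP s%:C; rewrite rnorm_real => /(_ sr).
  by have -> : (t +i* y) + s%:C = (t + s) +i* y by simpc.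
have vl x t : frechet G (x +i* t) (fun h => h * F (x +i* t)) ->
    rderiv (fun y => G (x +i* y)) t ('i * F (x +i* t)).
  move=> H e /H[r r0 rP]; exists r => // s sr.
  have := rP ('i * s%:C); rewrite rnormM rnorm_real.
  rewrite -(rnorm_normc 'i) /= expr0n expr1n add0r sqrtr1 mul1r => /(_ sr).
  have -> : (x +i* t) + 'i * s%:C = x +i* (t + s) by simpc.
  by rewrite [_ *: _]mulrA [s%:C * _]mulrC.
have c3' := vcontinuousZ 'i c3; have c4' := vcontinuousZ 'i c4.
rewrite /bdint mulrBr -!cintZ //.
rewrite (cint_ftc ab c1 (fun t tab => hl c t (d1 t tab))).
rewrite (cint_ftc ab c2 (fun t tab => hl d t (d2 t tab))).
rewrite (cint_ftc cd c3' (fun t tcd => vl b t (d3 t tcd))).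
by rewrite (cint_ftc cd c4' (fun t tcd => vl a t (d4 t tcd))); ring.
Qed.

End Boundary.

Lemma bdint_split_re (F : R[i] -> R[i]) a m b c d : a <= m -> m <= b -> c <= d ->
  (forall z, boundary a b c d z -> rcont F z) ->
  bdint F a b c d = bdint F a m c d + bdint F m b c d.
Proof.
move=> am mb cd /boundary_continuous[]; try exact: le_trans mb; try by [].
move=> c1 c2 _ _; rewrite /bdint (cint_split am mb c1) (cint_split am mb c2).
by ring.
Qed.

Lemma bdint_split_im (F : R[i] -> R[i]) a b c m d : a <= b -> c <= m -> m <= d ->
  (forall z, boundary a b c d z -> rcont F z) ->
  bdint F a b c d = bdint F a b c m + bdint F a b m d.
Proof.
move=> ab cm md /boundary_continuous[]; try exact: le_trans md; try by [].
move=> _ _ c1 c2; rewrite /bdint (cint_split cm md c1) (cint_split cm md c2).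
by ring.
Qed.

Lemma sub_rectangle a b c d a' b' c' d' z : a <= a' -> b' <= b -> c <= c' ->
  d' <= d -> rectangle a' b' c' d' z -> rectangle a b c d z.
Proof.
move=> aa bb cc dd [/andP[z1 z2] /andP[z3 z4]].
by split; apply/andP; split;
  [exact: le_trans z1|exact: le_trans z2 _|exact: le_trans z3|exact: le_trans z4 _].
Qed.

Lemma bdint_quarters (F : R[i] -> R[i]) a m b c n d :
  a <= m -> m <= b -> c <= n -> n <= d ->
  (forall z, rectangle a b c d z -> rcont F z) ->
  bdint F a b c d = (bdint F a m c n + bdint F m b c n)
                    + (bdint F a m n d + bdint F m b n d).
Proof.
move=> am mb cn nd Fc; have cd := le_trans cn nd.
rewrite (bdint_split_re am mb cd); last by move=> z [/Fc].
rewrite (bdint_split_im am cn nd); last first.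
  by move=> z [/(sub_rectangle (lexx a) mb (lexx c) (lexx d)) /Fc].
rewrite (bdint_split_im mb cn nd) 1?addrACA //.
by move=> z [/(sub_rectangle am (lexx b) (lexx c) (lexx d)) /Fc].
Qed.

Lemma rcont_affine (z0 u v z : R[i]) :
  rcont (fun w : R[i] => u + (w - z0) * v) z.
Proof.
move=> e e0.
have v0 : 0 < rnorm v + 1 by rewrite ltr_wpDl ?rnorm_ge0.
exists (e / (rnorm v + 1)); first by rewrite divr_gt0.
move=> y; rewrite ltr_pdivlMr // => ye.
have -> : u + (y - z0) * v - (u + (z - z0) * v) = (y - z) * v by ring.
rewrite rnormM; apply: le_lt_trans ye.
by rewrite ler_wpM2l ?rnorm_ge0 // lerDl.
Qed.

Lemma bdint_affine (z0 u v : R[i]) a b c d : a <= b -> c <= d ->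
  bdint (fun z => u + (z - z0) * v) a b c d = 0.
Proof.
move=> ab cd.
apply: (@bdint_primitive _ _ _ _ ab cd _ (fun z => z * u + (z - z0) ^+ 2 * v / 2)).
  by move=> z _; exact: rcont_affine.
move=> z _ e e0; have v0 : 0 < rnorm v + 1 by rewrite ltr_wpDl ?rnorm_ge0.
exists (e / (rnorm v + 1)); first by rewrite divr_gt0.
move=> h; rewrite ltr_pdivlMr // => he.
have -> : (z + h) * u + (z + h - z0) ^+ 2 * v / 2
    - (z * u + (z - z0) ^+ 2 * v / 2) - h * (u + (z - z0) * v)
    = h * h * (v / 2) by field.
rewrite !rnormM mulrAC ler_wpM2r ?rnorm_ge0 // rnormV.
have -> : rnorm (2 : R[i]) = 2.
  by rewrite -(rmorph_nat (real_complex R) 2) rnorm_real ger0_norm.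
apply: le_trans (ltW he); rewrite ler_wpM2l ?rnorm_ge0 //.
by have := rnorm_ge0 v; lra.
Qed.

Lemma bdint_sub_affine (F : R[i] -> R[i]) z0 u v a b c d : a <= b -> c <= d ->
  (forall z, boundary a b c d z -> rcont F z) ->
  bdint (fun z => F z - (u + (z - z0) * v)) a b c d = bdint F a b c d.
Proof.
move=> ab cd Fc.
have := bdintB ab cd Fc (fun z _ => @rcont_affine z0 u v z).
by rewrite (bdint_affine z0 u v ab cd) subr0.
Qed.

(** The boundary integral is additive under bisection and, on a small rectangle
    around a point, unchanged by subtracting the affine approximation of [F],
    hence small compared with the square of the diameter. *)
Lemma goursat (F : R[i] -> R[i]) a b c d : a <= b -> c <= d ->
  (forall z, rectangle a b c d z -> differentiable F z) -> bdint F a b c d = 0.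
Proof.
move=> ab cd Fd; apply/rnorm0_eq0/eqP; rewrite eq_le rnorm_ge0 andbT.
have Fc z : rectangle a b c d z -> rcont F z.
  by move=> /Fd /differentiable_rcont.
apply/ler_addgt0Pl => /= e' e'0; rewrite addr0.
pose S := b - a + (d - c); have S0 : 0 <= S by rewrite /S; lra.
pose e : R := e' / (S ^+ 2 + 1).
have S1 : 0 < S ^+ 2 + 1 by nra.
have e0 : 0 < e by rewrite divr_gt0.
pose Q x y w v := rnorm (bdint F x (x + w) y (y + v)) <= e * (w + v) ^+ 2.
have [wE vE] : a + (b - a) = b /\ c + (d - c) = d by split; ring.
suff : Q a c (b - a) (d - c).
  rewrite /Q wE vE -/S => /le_trans; apply.
  have : e * (S ^+ 2 + 1) = e' by rewrite /e divfK ?gt_eqF.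
  by clear - e0 S0; nra.
apply: (@cousin_rectangle Q); rewrite ?wE ?vE; try lra.
  move=> x y w v xa xb ya yb w0 v0; rewrite /Q.
  have x2 : x + w / 2 + w / 2 = x + w by field.
  have y2 : y + v / 2 + v / 2 = y + v by field.
  rewrite x2 y2 => h1 h2 h3 h4.
  have w2 : 0 <= w / 2 by rewrite divr_ge0.
  have v2 : 0 <= v / 2 by rewrite divr_ge0.
  rewrite (@bdint_quarters F x (x + w / 2) (x + w) y (y + v / 2) (y + v)).
  - rewrite (le_trans (ler_rnormD _ _)) //.
    have -> : e * (w + v) ^+ 2 =
        (e * (w / 2 + v / 2) ^+ 2 + e * (w / 2 + v / 2) ^+ 2)
        + (e * (w / 2 + v / 2) ^+ 2 + e * (w / 2 + v / 2) ^+ 2) by field.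
    by rewrite lerD // (le_trans (ler_rnormD _ _)) // lerD.
  - by rewrite lerDl.
  - by rewrite -x2 lerDl.
  - by rewrite lerDl.
  - by rewrite -y2 lerDl.
  - by move=> z /(sub_rectangle xa xb ya yb) /Fc.
move=> p q pab qcd; pose z0 := p +i* q.
have Fz0 : differentiable F z0 by apply: Fd; split.
have e8 : 0 < e / 4 by lra.
have [r r0 rP] := differentiable_frechet Fz0 e8.
exists (r / 2); first by rewrite divr_gt0.
move=> x y w v xa xb ya yb w0 v0 wr vr px qy; rewrite /Q.
pose A (z : R[i]) : R[i] := F z0 + (z - z0) * 'd F z0 1.
have Ac z : rcont A z by exact: rcont_affine.
have xw : x <= x + w by rewrite lerDl.
have yv : y <= y + v by rewrite lerDl.
have Fc' z : boundary x (x + w) y (y + v) z -> rcont F z.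
  by move=> [/(sub_rectangle xa xb ya yb) /Fc].
have -> : bdint F x (x + w) y (y + v) = bdint (fun z => F z - A z) x (x + w) y (y + v).
  by rewrite /A (bdint_sub_affine z0 _ _ xw yv Fc').
have B z : boundary x (x + w) y (y + v) z -> rnorm (z - z0) <= w + v.
  move=> [[zx zy] _]; rewrite (le_trans (ler_rnorm_ReIm _)) // ReB ImB /=.
  case/andP: zx => zx1 zx2; case/andP: zy => zy1 zy2.
  case/andP: px => px1 px2; case/andP: qy => qy1 qy2.
  by clear - zx1 zx2 zy1 zy2 px1 px2 qy1 qy2; rewrite lerD // ler_norml; lra.
have -> : e * (w + v) ^+ 2 = 4 * (e / 4 * (w + v)) * (x + w - x + (y + v - y)).
  by field.
apply: bdint_bound => // z zb; first exact: (rcontB (Fc' _ zb) (Ac z)).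
have {zb} zB := B z zb; have := rP (z - z0); rewrite [z0 + _]addrC subrK => H.
rewrite /A opprD addrA.
have -> : (z - z0) * 'd F z0 1 = 'd F z0 (z - z0).
  exact: esym (diff_scale F z0 (z - z0)).
apply: le_trans (H _) _; last by rewrite ler_wpM2l // ltW.
by apply: le_lt_trans zB _; rewrite [r]splitr ltrD.
Qed.

End Goursat.

(** * Cauchy's estimate *)

Section CauchyEstimate.
Context {R : realType}.

Lemma rnorm_gt0 (V : normedModType R[i]) (x : V) : x != 0 -> 0 < rnorm x.
Proof.
move=> x0; rewrite lt_neqAle rnorm_ge0 andbT eq_sym.
by apply: contraNneq x0 => /rnorm0_eq0 ->.
Qed.

Lemma rnorm_nat n : rnorm (n%:R : R[i]) = n%:R.
Proof. by rewrite -(rmorph_nat (real_complex R) n) rnorm_real ger0_norm. Qed.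

Lemma boundary_neq0 (a b c d : R) z : a < 0 -> 0 < b -> c < 0 -> 0 < d ->
  boundary a b c d z -> z != 0.
Proof.
move=> a0 b0 c0 d0 [_ zb]; apply/eqP => z0; move: zb; rewrite z0 /=.
by case=> E; move: a0 b0 c0 d0; rewrite ?E -?E ltxx.
Qed.

Lemma boundary_square_ge (e : R) z : 0 < e -> boundary (- e) e (- e) e z ->
  e <= rnorm z /\ rnorm z <= 2 * e.
Proof.
move=> e0 [[/andP[z1 z2] /andP[z3 z4]] zb]; split.
  have [zr|zi] : `|complex.Re z| = e \/ `|complex.Im z| = e.
    have ee : `|e| = e by rewrite gtr0_norm.
    by case: zb => ->; rewrite ?normrN ee; [left|left|right|right].
  - by rewrite -zr ler_Re_rnorm.
  - by rewrite -zi ler_Im_rnorm.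
rewrite (le_trans (ler_rnorm_ReIm _)) //.
by rewrite mulrDl mul1r lerD // ler_norml ?z1 ?z3.
Qed.

(** The region between the two squares is cut into four rectangles that avoid
    the origin. *)
Lemma bdint_squares (F : R[i] -> R[i]) (e s : R) : 0 < e -> e <= s ->
  (forall z, rectangle (- s) s (- s) s z -> z != 0 -> differentiable F z) ->
  bdint F (- s) s (- s) s = bdint F (- e) e (- e) e.
Proof.
move=> e0 es Fd; have s0 := lt_le_trans e0 es.
have se : - s <= - e by rewrite lerN2.
have ne : - e <= e by lra.
have nes : - e <= s by lra.
have nss : - s <= s by lra.
have ns : - s <= e by lra.
have Ns0 : - s < 0 by lra.
have Ne0 : - e < 0 by lra.
have Fb a b c d z : - s <= a -> a < 0 -> 0 < b -> b <= s -> - s <= c -> c < 0 ->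
    0 < d -> d <= s -> boundary a b c d z -> rcont F z.
  move=> sa a0 b0 bs sc c0 d0 ds zb; apply: differentiable_rcont; apply: Fd.
    by case: zb => zr _; exact: sub_rectangle zr.
  exact: boundary_neq0 zb.
have Fr a b c d : - s <= a -> a <= b -> b <= s -> - s <= c -> c <= d -> d <= s ->
    (forall z, rectangle a b c d z -> z != 0) -> bdint F a b c d = 0.
  move=> sa ab bs sc cd ds z0; apply: goursat => // z zr.
  by apply: Fd; [exact: sub_rectangle zr|exact: z0].
rewrite (bdint_split_re se nes nss); last by move=> z; apply: Fb.
rewrite Fr ?add0r //; last first.
  move=> z [/andP[_ z1] _]; apply/eqP => z0; move: z1; rewrite z0 /=.
  by rewrite leNgt Ne0.
rewrite (bdint_split_re ne es nss); last by move=> z; apply: Fb.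
rewrite [X in _ + X]Fr ?addr0 //; last first.
  move=> z [/andP[z1 _] _]; apply/eqP => z0; move: z1; rewrite z0 /=.
  by rewrite leNgt e0.
rewrite (bdint_split_im ne se nes); last by move=> z; apply: Fb.
rewrite Fr ?add0r //; last first.
  move=> z [_ /andP[_ z1]]; apply/eqP => z0; move: z1; rewrite z0 /=.
  by rewrite leNgt Ne0.
rewrite (bdint_split_im ne ne es); last by move=> z; apply: Fb.
rewrite [X in _ + X]Fr ?addr0 //.
move=> z [_ /andP[z1 _]]; apply/eqP => z0; move: z1; rewrite z0 /=.
by rewrite leNgt e0.
Qed.

Lemma rcont_inv (z : R[i]) : z != 0 -> rcont (fun w : R[i] => w^-1) z.
Proof.
move=> z0; apply: differentiable_rcont.
exact: differentiableV.
Qed.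

(** The exact value is [2 * pi * 'i].  A lower bound is enough, and follows from
    the fact that each of the four sides contributes at least [1] to the
    imaginary part. *)
Lemma bdint_inv_ge (e : R) : 0 < e ->
  4 <= rnorm (bdint (fun z => z^-1) (- e) e (- e) e).
Proof.
move=> e0; have ne : - e <= e by lra.
have Ne0 : - e < 0 by lra.
have [c1 c2 c3 c4] : [/\
    vcontinuous_on (fun x : R => (x +i* - e : R[i])^-1) (- e) e,
    vcontinuous_on (fun x : R => (x +i* e : R[i])^-1) (- e) e,
    vcontinuous_on (fun y : R => (e +i* y : R[i])^-1) (- e) e &
    vcontinuous_on (fun y : R => (- e +i* y : R[i])^-1) (- e) e].
  apply: (boundary_continuous ne ne (F := fun z => z^-1)) => z zb.
  exact/rcont_inv/(boundary_neq0 _ _ _ _ zb).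
apply: le_trans (le_trans (ler_norm _) (ler_Im_rnorm _)).
have i4 (u v w x : R[i]) : complex.Im (u - v + 'i * (w - x)) =
  complex.Im u - complex.Im v + (complex.Re w - complex.Re x).
  by case: u v w x => [? ?] [? ?] [? ?] [? ?] /=; simpc.
rewrite i4 {i4}.
(* Up to sign, the integrand on each of the four sides. *)
have q (t : R) : - e <= t <= e -> (2 * e)^-1 <= e / (t ^+ 2 + e ^+ 2).
  move=> /andP[t1 t2]; have te : t ^+ 2 <= e ^+ 2 by nra.
  have e2 : 0 < e ^+ 2 by rewrite exprn_gt0.
  rewrite ler_pdivlMr; last by rewrite ltr_wpDl ?sqr_ge0.
  by rewrite mulrC ler_pdivrMr ?mulr_gt0 //; nra.
have E : (2 * e)^-1 * (e - - e) = 1 by field; rewrite gt_eqF.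
have E' : - (2 * e)^-1 * (e - - e) = - 1 by rewrite mulNr E.
have h1 : 1 <= rint (fun t : R => complex.Im (t +i* - e : R[i])^-1) (- e) e.
  rewrite -E; apply: rint_ge => //; first exact: vcontinuous_Im.
  by move=> t /q /=; rewrite mulNr opprK sqrrN.
have h2 : rint (fun t : R => complex.Im (t +i* e : R[i])^-1) (- e) e <= - 1.
  rewrite -E'; apply: rint_le => //; first exact: vcontinuous_Im.
  by move=> t /q /=; rewrite lerN2.
have h3 : 1 <= rint (fun t : R => complex.Re (e +i* t : R[i])^-1) (- e) e.
  rewrite -E; apply: rint_ge => //; first exact: vcontinuous_Re.
  by move=> t /q /=; rewrite addrC.
have h4 : rint (fun t : R => complex.Re (- e +i* t : R[i])^-1) (- e) e <= - 1.
  rewrite -E'; apply: rint_le => //; first exact: vcontinuous_Re.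
  by move=> t /q /=; rewrite sqrrN mulNr lerN2 addrC.
have -> : 4 = 1 - -1 + (1 - -1) :> R by ring.
exact: lerD (lerB h1 h2) (lerB h3 h4).
Qed.

Lemma differentiable_quotient (k : R[i] -> R[i]) (c z : R[i]) : z != 0 ->
  differentiable k z -> differentiable (fun w => (k w - c) * (w^-1 * w^-1)) z.
Proof.
move=> z0 kd; apply: differentiableM; first exact: differentiableB.
by apply: differentiableM; exact: differentiableV.
Qed.

(** With [F z = (k z - k 0) / z ^ 2], the boundary integral of [F] over a small
    square is close to the derivative of [k] at [0] times that of [1 / z], while
    over a square of size comparable to [rho] it is at most a multiple of
    [K / rho]; the two are equal by [bdint_squares]. *)
Lemma cauchy_estimate (k : R[i] -> R[i]) (rho K : R) : 0 < rho ->
  (forall z, rnorm z < rho -> differentiable k z /\ rnorm (k z) <= K) ->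
  rnorm ('d k 0 1) <= 32 * K / rho.
Proof.
move=> rho0 kP; set D := 'd k 0 1.
pose F z := (k z - k 0) * (z^-1 * z^-1).
have n0 : rnorm (0 : R[i]) < rho by rewrite rnorm0.
have K0 : 0 <= K by apply: le_trans (rnorm_ge0 _) (kP 0 n0).2.
(* The square of half side [rho / 4] lies in the disc of radius [rho]. *)
pose s := rho / 4; have s0 : 0 < s by rewrite divr_gt0.
have rs : rho = 4 * s by rewrite /s mulrC divfK.
have Fd z : rectangle (- s) s (- s) s z -> z != 0 -> differentiable F z.
  move=> [/andP[z1 z2] /andP[z3 z4]] z0; apply: differentiable_quotient => //.
  apply: (kP z _).1; apply: le_lt_trans (ler_rnorm_ReIm _) _.
  have h1 : `|complex.Re z| <= s by rewrite ler_norml z1.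
  have h2 : `|complex.Im z| <= s by rewrite ler_norml z3.
  by clear - rs s0 h1 h2; lra.
have ns (t : R) : 0 < t -> - t <= t by move=> ?; lra.
have Fc e z : 0 < e -> e <= s -> boundary (- e) e (- e) e z -> rcont F z.
  move=> e0 es zb; have Ne0 : - e < 0 by rewrite oppr_lt0.
  apply: differentiable_rcont; apply: Fd.
    by case: zb => zr _; apply: sub_rectangle zr; rewrite ?lerN2.
  exact: (boundary_neq0 Ne0 e0 Ne0 e0 zb).
have big : rnorm (bdint F (- s) s (- s) s) <= 32 * K / s.
  have -> : 32 * K / s = 4 * (2 * K / s ^+ 2) * (s - - s + (s - - s)).
    by field; rewrite gt_eqF.
  apply: bdint_bound; [exact: ns|exact: ns|by move=> z; apply: Fc|].
  move=> z /(boundary_square_ge s0)[sz zs]; rewrite /F !rnormM rnormV -invfM -expr2.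
  have z0 : 0 < rnorm z by apply: lt_le_trans sz.
  apply: ler_pM; rewrite ?rnorm_ge0 ?invr_ge0 ?exprn_ge0 ?rnorm_ge0 //.
    rewrite (le_trans (ler_rnormB _ _)) // mulrDl mul1r lerD ?(kP 0 n0).2 //.
    apply: (kP z _).2; apply: le_lt_trans zs _.
    by clear - rs s0; lra.
  by rewrite lef_pV2 ?posrE ?exprn_gt0 // ler_pXn2r ?nnegrE ?rnorm_ge0 ?(ltW s0).
(* The error [eta] of the affine approximation of [k] on a small square. *)
suff small eta : 0 < eta -> 4 * rnorm D <= 32 * K / s + 16 * eta.
  have -> : 32 * K / rho = 32 * K / s / 4 by rewrite rs; field; rewrite gt_eqF.
  rewrite ler_pdivlMr // mulrC; apply/ler_addgt0Pl => /= eta eta0.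
  have e16 : 0 < eta / 16 by rewrite divr_gt0.
  by have := small _ e16; rewrite [16 * _]mulrC divfK // addrC.
move=> eta0; have [r r0 rP] := differentiable_frechet (kP 0 n0).1 eta0.
pose e := Num.min s (r / 4).
have e0 : 0 < e by rewrite lt_min s0 divr_gt0.
have es : e <= s by rewrite ge_min lexx.
have er : 4 * e <= r by rewrite mulrC -ler_pdivlMr // ge_min lexx orbT.
have Ne0 : - e < 0 by rewrite oppr_lt0.
have nee := ns _ e0.
pose G (z : R[i]) := D * z^-1.
have Ic z : boundary (- e) e (- e) e z -> rcont (fun w : R[i] => w^-1) z.
  by move=> /(boundary_neq0 Ne0 e0 Ne0 e0) /rcont_inv.
have Gc z : boundary (- e) e (- e) e z -> rcont G z.
  move=> /(boundary_neq0 Ne0 e0 Ne0 e0) z0; apply: differentiable_rcont.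
  apply: differentiableM; first exact: differentiable_cst.
  exact: differentiableV.
have Fce z : boundary (- e) e (- e) e z -> rcont F z by apply: Fc.
have diff_small : rnorm (bdint F (- e) e (- e) e - bdint G (- e) e (- e) e) <= 16 * eta.
  rewrite -bdintB //.
  have -> : 16 * eta = 4 * (eta / e) * (e - - e + (e - - e)).
    by field; rewrite gt_eqF.
  apply: bdint_bound => //; first by move=> z zb; apply: rcontB; [exact: Fce|exact: Gc].
  move=> z zb; have z0 := boundary_neq0 Ne0 e0 Ne0 e0 zb.
  have [ez ze] := boundary_square_ge e0 zb; have nz := rnorm_gt0 z0.
  have -> : F z - G z = (k z - k 0 - z * D) * (z^-1 * z^-1).
    by rewrite /F /G; field.
  have zr : rnorm z < r by apply: le_lt_trans ze _; clear - er e0; lra.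
  have := rP z zr; rewrite add0r (diff_scale k 0 z) => H.
  rewrite !rnormM rnormV -[_ *: _]/(z * D) in H *.
  apply: (@le_trans _ _ (eta * rnorm z * ((rnorm z)^-1 * (rnorm z)^-1))).
    by rewrite ler_wpM2r // mulr_ge0 // invr_ge0 ltW.
  rewrite mulrA mulfK ?gt_eqF // ler_wpM2l ?(ltW eta0) //.
  by rewrite lef_pV2.
have GE : bdint G (- e) e (- e) e = D * bdint (fun z => z^-1) (- e) e (- e) e.
  exact: bdintZ.
have h1 : 4 * rnorm D <= rnorm (bdint G (- e) e (- e) e).
  by rewrite GE rnormM mulrC ler_wpM2l ?rnorm_ge0 // bdint_inv_ge.
apply: le_trans h1 _; apply: le_trans (ler_rnorm_dist _ (bdint F (- e) e (- e) e)) _.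
rewrite rnormB; apply: lerD diff_small.
by rewrite -(bdint_squares e0 es Fd).
Qed.

End CauchyEstimate.

(** * Holomorphic functions on normed spaces *)

Section SeveralVariables.
Context {R : realType}.
Implicit Types V W : normedModType R[i].

(** Transports a bound along an equation between values of differentials, where
    rewriting inside the differential is awkward. *)
Lemma rnorm_eq_le V (x y : V) (B : R) : x = y -> rnorm x <= B -> rnorm y <= B.
Proof. by move=> ->. Qed.

Definition cline V (x v : V) (z : R[i]) : V := x + z *: v.

Lemma frechet_cline V (x v : V) z : frechet (cline x v) z (fun h => h *: v).
Proof.
move=> e e0; exists 1 => // h _.
by rewrite /cline scalerDl -addrA -opprD !addrA subrr rnorm0 mulr_ge0 ?rnorm_ge0 ?(ltW e0).
Qed.

(** Named so as to carry the structure of a linear map: it is the differential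
    of a function of one complex variable with derivative [v]. *)
Definition rscale V (v : V) (z : R[i]) : V := z *: v.

Lemma rscale_linear V (v : V) : linear (rscale v).
Proof. by move=> a y z; rewrite /rscale scalerDl -[a *: y]/(a * y) scalerA. Qed.

HB.instance Definition _ V (v : V) :=
  GRing.isLinear.Build R[i] R[i] V *:%R (rscale v) (rscale_linear v).

Lemma rscale_continuous V (v : V) : continuous (rscale v).
Proof.
by apply: (@bounded_linear_continuous _ _ _ _ (rnorm v)) => h; rewrite rnormZ mulrC.
Qed.

(** Derivatives of functions of one complex variable are handled below as
    vectors [D]; this is the bridge to the differential. *)
Lemma frechet_diff1 V (k : R[i] -> V) z (D : V) :
  frechet k z (fun h => h *: D) -> differentiable k z /\ 'd k z 1 = D.
Proof.
move=> kD; have [dk dE] := frechet_differentiable (@rscale_continuous _ D) kD.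
by split=> //; rewrite dE /= /rscale scale1r.
Qed.

Lemma diff_cline V W (f : V -> W) (x v : V) z : differentiable f (cline x v z) ->
  differentiable (f \o cline x v) z /\
  'd (f \o cline x v) z 1 = 'd f (cline x v z) v.
Proof.
move=> df; have [dl lE] := frechet_diff1 (@frechet_cline _ x v z).
split; first exact: differentiable_comp.
by rewrite diff_comp //= lE.
Qed.

(** Cauchy's estimate on the complex line through [x] in the direction [v]. *)
Lemma cauchy_estimate_ball V (f : V -> R[i]) (x : V) (rho K : R) : 0 < rho ->
  (forall y, rnorm (y - x) < rho -> differentiable f y /\ rnorm (f y) <= K) ->
  forall v, rnorm ('d f x v) <= 32 * K / rho * rnorm v.
Proof.
move=> rho0 fP v; have [->|v0] := eqVneq v 0.
  by rewrite linear0 !rnorm0 mulr0.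
have nv := rnorm_gt0 v0.
have x0 : cline x v 0 = x by rewrite /cline scale0r addr0.
have H z : rnorm z < rho / rnorm v -> rnorm (cline x v z - x) < rho.
  by rewrite /cline addrC addKr rnormZ ltr_pdivlMr.
have [fx _] : differentiable f (cline x v 0) /\ rnorm (f x) <= K.
  by rewrite x0; apply: fP; rewrite subrr rnorm0.
have [_ E] := diff_cline fx; rewrite x0 in E; rewrite -E.
have -> : 32 * K / rho * rnorm v = 32 * K / (rho / rnorm v).
  by field; rewrite !gt_eqF.
apply: cauchy_estimate; first by rewrite divr_gt0.
by move=> z /H /fP[dfz fK]; split=> //; exact: (diff_cline dfz).1.
Qed.

Definition bounded_holo V (f : V -> R[i]) (x : V) (rho K : R) : Prop :=
  forall y, rnorm (y - x) < rho -> differentiable f y /\ rnorm (f y) <= K.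

Lemma bounded_holo_sub V (f : V -> R[i]) x y rho rho' K :
  rnorm (y - x) + rho' <= rho -> bounded_holo f x rho K -> bounded_holo f y rho' K.
Proof.
move=> h H z zy; apply: H; apply: le_lt_trans (ler_rdistD y _ _) _.
by apply: lt_le_trans h; rewrite addrC ltrD2l.
Qed.

(** The mean value inequality, with the derivative bounded by Cauchy's estimate on
    the balls of radius [rho / 2] around the points of the segment. *)
Lemma holo_lipschitz V (f : V -> R[i]) x rho K y y' : 0 < rho ->
  bounded_holo f x rho K -> rnorm (y - x) < rho / 2 -> rnorm (y' - x) < rho / 2 ->
  rnorm (f y' - f y) <= 64 * K / rho * rnorm (y' - y).
Proof.
move=> rho0 fP yx y'x; apply: mean_value_diff => t t01.
have sx := rnorm_seg t01 yx y'x.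
have sP : bounded_holo f (seg y y' t) (rho / 2) K.
  by apply: bounded_holo_sub fP; rewrite [leRHS]splitr lerD2r ltW.
have r2 : 0 < rho / 2 by rewrite divr_gt0.
split; first by apply: (sP _ _).1; rewrite subrr rnorm0.
have := cauchy_estimate_ball r2 sP (y' - y).
by have -> : 32 * K / (rho / 2) = 64 * K / rho by field; rewrite gt_eqF.
Qed.

Lemma diff_translate V W (f : V -> W) (c x v : V) : differentiable f (x + c) ->
  differentiable (fun w => f (w + c)) x /\
  'd (fun w => f (w + c)) x v = 'd f (x + c) v.
Proof.
move=> df; have H : frechet (fun w => f (w + c)) x ('d f (x + c)).
  move=> e /(differentiable_frechet df)[d d0 dP]; exists d => // h /dP.
  by rewrite [x + h + c]addrAC.
by have [? ->] := frechet_differentiable (diff_continuous df) H.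
Qed.

Lemma diffB_at V (f g : V -> R[i]) (x v : V) :
  differentiable f x -> differentiable g x ->
  differentiable (fun w => f w - g w) x /\
  'd (fun w => f w - g w) x v = 'd f x v - 'd g x v.
Proof.
move=> df dg; split; first exact: differentiableB.
by have /(congr1 (fun h : V -> R[i] => h v)) := diffB df dg.
Qed.

(** Cauchy's estimate applied to the difference of [f] and its translate by
    [y - y'], which is bounded by [holo_lipschitz]. *)
Lemma diff_lipschitz V (f : V -> R[i]) x rho K y y' v : 0 < rho ->
  bounded_holo f x rho K -> rnorm (y - x) < rho / 4 -> rnorm (y' - x) < rho / 4 ->
  rnorm ('d f y' v - 'd f y v) <= 8192 * K / rho ^+ 2 * rnorm (y' - y) * rnorm v.
Proof.
move=> rho0 fP yx y'x; pose c := y - y'.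
have r4 : 0 < rho / 4 by rewrite divr_gt0.
have r24 : rho / 4 + rho / 4 = rho / 2 by field.
have B1 w : rnorm (w - y') < rho / 4 -> rnorm (w - x) < rho / 2.
  by move=> wy; rewrite (le_lt_trans (ler_rdistD y' _ _)) // -r24 ltrD.
have B2 w : rnorm (w - y') < rho / 4 -> rnorm (w + c - x) < rho / 2.
  move=> wy; rewrite (le_lt_trans (ler_rdistD y _ _)) // -r24 ltrD //.
  by have -> : w + c - y = w - y' by rewrite /c addrA addrAC addrK.
have r2r : rho / 2 < rho by rewrite ltr_pdivrMr // mulr_natr mulr2n ltrDl.
have gP : bounded_holo (fun w => f w - f (w + c)) y' (rho / 4)
    (64 * K / rho * rnorm (y' - y)).
  move=> w wy; have w1 := B1 _ wy; have w2 := B2 _ wy; split.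
    apply: differentiableB; first exact: (fP _ (lt_trans w1 r2r)).1.
    by apply: (diff_translate 0 _).1; exact: (fP _ (lt_trans w2 r2r)).1.
  rewrite rnormB; apply: le_trans (holo_lipschitz rho0 fP w1 w2) _.
  by rewrite addrC addKr /c (rnormB y).
have n0 : rnorm (y' - y') < rho / 4 by rewrite subrr rnorm0.
have d1 := (fP _ (lt_trans (B1 _ n0) r2r)).1.
have d2' := (fP _ (lt_trans (B2 _ n0) r2r)).1.
have [d2 E] := diff_translate v d2'.
have yE : y' + c = y by rewrite /c addrC subrK.
rewrite yE in E; have [_ E2] := diffB_at v d1 d2.
have E3 := etrans E2 (congr1 (fun t => 'd f y' v - t) E).
have -> : 8192 * K / rho ^+ 2 * rnorm (y' - y) * rnorm v =
    32 * (64 * K / rho * rnorm (y' - y)) / (rho / 4) * rnorm v.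
  by field; rewrite gt_eqF.
exact: rnorm_eq_le E3 (cauchy_estimate_ball r4 gP v).
Qed.

(** The mean value inequality for [f] minus its differential at [y], whose
    derivative is small by [diff_lipschitz]. *)
Lemma holo_taylor2 V (f : V -> R[i]) x rho K y h : 0 < rho ->
  bounded_holo f x rho K -> rnorm (y - x) < rho / 8 -> rnorm h < rho / 8 ->
  rnorm (f (y + h) - f y - 'd f y h) <= 8192 * K / rho ^+ 2 * rnorm h ^+ 2.
Proof.
move=> rho0 fP yx hr.
have r8 : rho / 8 + rho / 8 = rho / 4 by field.
have r4 : rho / 4 < rho by rewrite ltr_pdivrMr // ltr_pMr // ltr1n.
have n0 := rnorm_ge0 h.
have K0 : 0 <= K.
  by apply: le_trans (rnorm_ge0 _) (fP x _).2; rewrite subrr rnorm0.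
have C0 : 0 <= 8192 * K / rho ^+ 2 by apply: divr_ge0; [apply: mulr_ge0; [exact: ler0n|exact: K0]|exact/exprn_ge0/ltW].
have y4 : rnorm (y - x) < rho / 4 by rewrite -r8 ltr_wpDr // ltW // divr_gt0.
have dy := (fP _ (lt_trans y4 r4)).1.
have -> : f (y + h) - f y - 'd f y h =
   (f (y + h) - 'd f y (y + h)) - (f y - 'd f y y).
  by rewrite linearD /=; ring.
apply: (@mean_value_diff _ _ _ (fun w => f w - 'd f y w) y (y + h)) => t t01.
have /andP[t0 t1] := t01.
have sE : seg y (y + h) t = y + t%:C *: h by rewrite /seg [y + h]addrC addrK.
have hE : y + h - y = h by rewrite [y + h]addrC addrK.
have sy : rnorm (seg y (y + h) t - y) <= rnorm h.
  by rewrite sE addrAC subrr add0r rnormZ rnorm_real ger0_norm // ler_piMl.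
have s4 : rnorm (seg y (y + h) t - x) < rho / 4.
  rewrite (le_lt_trans (ler_rdistD y _ _)) // -r8 ltr_leD //.
    exact: le_lt_trans sy hr.
  exact: ltW.
have ds := (fP _ (lt_trans s4 r4)).1.
have dl : differentiable ('d f y : V -> R[i]) (seg y (y + h) t).
  by apply: linear_differentiable; exact: diff_continuous.
split; first exact: differentiableB.
rewrite hE; have [_ E2] := diffB_at h ds dl.
have E3 : 'd ('d f y : V -> R[i]) (seg y (y + h) t) h = 'd f y h.
  by rewrite diff_lin //; exact: diff_continuous.
apply: rnorm_eq_le (esym (etrans E2 (congr1 (fun s => _ - s) E3))) _.
apply: le_trans (diff_lipschitz h rho0 fP y4 s4) _.
by rewrite expr2 mulrA ler_wpM2r // ler_wpM2l.
Qed.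

End SeveralVariables.

(** * Limits of sequences with a given rate *)

Section Completeness.
Context {R : realType}.

(** Keeping an explicit rate [c] makes the convergence of the sequences below
    uniform without further argument. *)
Lemma real_limit (u : nat -> R) (c : nat -> R) :
  (forall n m, (n <= m)%N -> `|u m - u n| <= c n) ->
  exists l, forall n, `|u n - l| <= c n.
Proof.
move=> uc.
have c0 n : 0 <= c n by apply: le_trans (uc n n (leqnn n)).
have key n m : u n - c n <= u m + c m.
  have [nm|mn] := leqP n m.
    by have := uc _ _ nm; have := c0 m; rewrite ler_norml => ? /andP[? ?]; lra.
  have := uc _ _ (ltnW mn); have := c0 n; rewrite ler_norml => ? /andP[? ?]; lra.
have supS : has_sup [set u n - c n | n in [set: nat]].
  by split; [exists (u 0%N - c 0%N), 0%N|exists (u 0%N + c 0%N) => _ [n _ <-]].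
exists (sup [set u n - c n | n in [set: nat]]) => n; rewrite ler_norml.
have h1 : u n - c n <= sup [set u n - c n | n in [set: nat]].
  by apply: ub_le_sup; [case: supS|exists n].
have h2 : sup [set u n - c n | n in [set: nat]] <= u n + c n.
  by apply: ge_sup; [case: supS|move=> _ [m _ <-]].
by apply/andP; split; lra.
Qed.

Lemma complex_limit (u : nat -> R[i]) (c : nat -> R) :
  (forall n m, (n <= m)%N -> rnorm (u m - u n) <= c n) ->
  exists l, forall n, rnorm (u n - l) <= 2 * c n.
Proof.
move=> uc.
have [n m nm|a aP] := @real_limit (fun n => complex.Re (u n)) c.
  by rewrite -ReB (le_trans (ler_Re_rnorm _)) ?uc.
have [n m nm|b bP] := @real_limit (fun n => complex.Im (u n)) c.
  by rewrite -ImB (le_trans (ler_Im_rnorm _)) ?uc.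
exists (a +i* b) => n; rewrite (le_trans (ler_rnorm_ReIm _)) // ReB ImB /=.
by rewrite mulrDl mul1r lerD.
Qed.

Lemma rV_limit m (u : nat -> 'rV[R[i]]_m) (c : nat -> R) :
  (forall n k, (n <= k)%N -> rnorm (u k - u n) <= c n) ->
  exists l, forall n, rnorm (u n - l) <= 2 * c n.
Proof.
move=> uc.
have c0 n : 0 <= c n by apply: le_trans (rnorm_ge0 _) (uc n n (leqnn n)).
have H j : exists l, forall n, rnorm (u n ord0 j - l) <= 2 * c n.
  apply: complex_limit => n k nk; apply: le_trans (uc _ _ nk).
  by have := rnorm_coord (u k - u n) j; rewrite !mxE.
have [l lP] := choice H; exists (\row_j l j) => n.
by apply: rnorm_rV_le => [|j]; rewrite ?mulr_ge0 // !mxE.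
Qed.

Lemma ler_expr2n (a b B : R) : (forall n, a <= b + B / 2 ^+ n) -> a <= b.
Proof.
move=> H; apply/ler_addgt0Pl => /= e e0; have [n nP] := expr2n_small B e0.
by apply: le_trans (H n) _; rewrite addrC lerD2r ltW.
Qed.

End Completeness.

(** * Holomorphy of derivatives *)

Section DirectionalDerivative.
Context {R : realType} {m : nat}.
Implicit Types (f : 'rV[R[i]]_m -> R[i]) (x v h : 'rV[R[i]]_m).

(** A linear form on row vectors given by its coefficients; limits of linear
    forms are taken coefficientwise. *)
Definition lincomb (l : 'I_m -> R[i]) (h : 'rV[R[i]]_m) : R[i] :=
  \sum_k h ord0 k * l k.

Lemma lincomb_linear l : linear (lincomb l).
Proof.
move=> a h h'; rewrite /lincomb scaler_sumr -big_split; apply: eq_bigr => k _.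
by rewrite mxE [(a *: h) _ _]mxE mulrDl -mulrA.
Qed.

HB.instance Definition _ l :=
  GRing.isLinear.Build R[i] 'rV[R[i]]_m R[i] *:%R (lincomb l) (lincomb_linear l).

Lemma rnorm_sum (I : finType) (V : normedModType R[i]) (F : I -> V) :
  rnorm (\sum_i F i) <= \sum_i rnorm (F i).
Proof.
elim/big_ind2 : _ => [|a b c d ab cd|//]; first by rewrite rnorm0.
by rewrite (le_trans (ler_rnormD _ _)) // lerD.
Qed.

Lemma lincomb_bound l B h : (forall k, rnorm (l k) <= B) ->
  rnorm (lincomb l h) <= m%:R * B * rnorm h.
Proof.
move=> lB; rewrite /lincomb (le_trans (rnorm_sum _)) //.
have -> : m%:R * B * rnorm h = \sum_(k < m) rnorm h * B.
  by rewrite sumr_const card_ord -[RHS]mulr_natl; ring.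
apply: ler_sum => k _; rewrite rnormM ler_pM ?rnorm_ge0 //.
exact: rnorm_coord.
Qed.

Lemma lincomb_continuous l : continuous (lincomb l).
Proof.
apply: (@bounded_linear_continuous _ _ _ _ (m%:R * \sum_k rnorm (l k))) => h.
apply: lincomb_bound => k; rewrite (bigD1 k) //= lerDl sumr_ge0 // => i _.
exact: rnorm_ge0.
Qed.

Lemma rV_basis h : h = \sum_k h ord0 k *: delta_mx ord0 k.
Proof. exact: row_sum_delta. Qed.

Lemma linear_lincomb (L : {linear 'rV[R[i]]_m -> R[i]}) h :
  L h = lincomb (fun k => L (delta_mx ord0 k)) h.
Proof.
rewrite [in LHS](rV_basis h) linear_sum; apply: eq_bigr => k _.
by rewrite linearZ.
Qed.

Lemma holo_bounded (V : normedModType R[i]) (F : V -> R[i]) (x : V) (r : R) : 0 < r ->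
  (forall y, rnorm (y - x) < r -> differentiable F y) ->
  exists rho K : R, [/\ 0 < rho, 0 < K & bounded_holo F x rho K].
Proof.
move=> r0 dF; have [|d d0 dP] := differentiable_rcont (dF x _) ltr01.
  by rewrite subrr rnorm0.
exists (Num.min r d), (rnorm (F x) + 1); split.
- by rewrite lt_min r0.
- by rewrite ltr_wpDl ?rnorm_ge0.
move=> y; rewrite lt_min => /andP[/dF ? /dP yd]; split=> //.
by rewrite (le_trans (ler_rnorm_dist _ (F x))) // lerD2l ltW.
Qed.

(** The difference quotients of [f] in the direction [v] converge uniformly near
    [x], so their differentials converge by Cauchy's estimate, and their second
    order Taylor remainders are bounded uniformly by [holo_taylor2]; the limit
    inherits a differential at [x]. *)
Lemma differentiable_diff f x v (r : R) : 0 < r ->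
  (forall y, rnorm (y - x) < r -> differentiable f y) ->
  differentiable (fun y => 'd f y v : R[i]) x.
Proof.
move=> r0 /(holo_bounded r0)[rho [K [rho0 K0 fP]]].
pose G y : R[i] := 'd f y v; pose N := rnorm v + 1.
have N0 : 0 < N by rewrite ltr_wpDl ?rnorm_ge0.
pose s0 := rho / 16 / N; have s00 : 0 < s0 by rewrite !divr_gt0.
pose s n : R := s0 / 2 ^+ n.
have sn n : 0 < s n by rewrite divr_gt0 ?exprn_gt0.
have sle n k : (n <= k)%N -> s k <= s n.
  move=> nk; rewrite ler_wpM2l ?(ltW s00) // lef_pV2 ?posrE ?exprn_gt0 //.
  by rewrite ler_weXn2l // ler1n.
have svr n : rnorm ((s n)%:C *: v) < rho / 16.
  rewrite rnormZ rnorm_real gtr0_norm //.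
  have -> : rho / 16 = s0 * N by rewrite /s0 divfK ?gt_eqF.
  apply: (@le_lt_trans _ _ (s0 * rnorm v)); last by rewrite ltr_pM2l // ltrDl.
  rewrite ler_wpM2r ?rnorm_ge0 //.
  by have := sle 0%N n isT; rewrite {2}/s expr0 divr1.
(* The difference quotients, with steps [s n] tending to zero. *)
pose k n y : R[i] := (s n)^-1%:C * (f (y + (s n)%:C *: v) - f y).
pose C := 8192 * K / rho ^+ 2.
have h8 : rho / 8 + rho / 16 < rho / 2 by lra.
have h82 : rho / 8 < rho / 2 by lra.
have h2 : rho / 2 < rho by lra.
have h16 : rho / 16 < rho / 8 by lra.
have nin n y : rnorm (y - x) < rho / 8 -> rnorm (y + (s n)%:C *: v - x) < rho / 2.
  move=> yx; rewrite addrAC (le_lt_trans (ler_rnormD _ _)) //.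
  by apply: lt_trans h8; rewrite ltrD.
have kG n y : rnorm (y - x) < rho / 8 -> rnorm (k n y - G y) <= C * N ^+ 2 * s n.
  move=> yx; have := holo_taylor2 rho0 fP yx (lt_trans (svr n) h16).
  rewrite linearZ /= -/C => H.
  have -> : k n y - G y = (s n)^-1%:C *
      (f (y + (s n)%:C *: v) - f y - (s n)%:C * G y).
    have S0 : (s n)%:C != 0 :> R[i] by rewrite (fmorph_eq0 (real_complex R)) gt_eqF.
    by rewrite /k fmorphV /=; field.
  rewrite rnormM rnorm_real gtr0_norm ?invr_gt0 // mulrC ler_pdivrMr //.
  apply: le_trans H _; rewrite rnormZ rnorm_real gtr0_norm // exprMn mulrCA.
  rewrite [leRHS](_ : _ = s n ^+ 2 * (C * N ^+ 2)); last by ring.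
  rewrite ler_wpM2l ?sqr_ge0 // ler_wpM2l //.
    by apply: divr_ge0; [apply: mulr_ge0; [exact: ler0n|exact: ltW]|exact: sqr_ge0].
  by rewrite ler_pXn2r ?nnegrE ?rnorm_ge0 ?(ltW N0) // lerDl.
have dk n y : rnorm (y - x) < rho / 8 -> differentiable (k n) y.
  move=> yx; apply: differentiableM; first exact: differentiable_cst.
  apply: differentiableB.
    by apply: (diff_translate 0 _).1; exact: (fP _ (lt_trans (nin n _ yx) h2)).1.
  exact: (fP _ (lt_trans (lt_trans yx h82) h2)).1.
have kB n : bounded_holo (k n) x (rho / 8) (64 * K / rho * N).
  move=> y yx; split; first exact: dk.
  rewrite /k rnormM rnorm_real gtr0_norm ?invr_gt0 // mulrC ler_pdivrMr //.
  apply: le_trans (holo_lipschitz rho0 fP (lt_trans yx h82) (nin n _ yx)) _.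
  rewrite [y + _]addrC addrK rnormZ rnorm_real gtr0_norm //.
  have -> : 64 * K / rho * N * s n = 64 * K / rho * (s n * N) by ring.
  rewrite ler_wpM2l //.
    by apply: divr_ge0; [apply: mulr_ge0; [exact: ler0n|exact: ltW]|exact: ltW].
  by rewrite ler_wpM2l ?(ltW (sn n)) // lerDl.
have r8 : 0 < rho / 8 by rewrite divr_gt0.
have x0 : rnorm (x - x) < rho / 8 by rewrite subrr rnorm0.
pose C2 : R := 32 * (C * N ^+ 2) / (rho / 8).
have kkB n n' h : (n <= n')%N ->
    rnorm ('d (k n') x h - 'd (k n) x h) <= 2 * C2 * s n * rnorm h.
  move=> nn; have B : bounded_holo (fun y => k n' y - k n y) x (rho / 8)
      (C * N ^+ 2 * (2 * s n)).
    move=> y yx; split; first by apply: differentiableB; exact: dk.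
    have -> : k n' y - k n y = (k n' y - G y) - (k n y - G y).
      by rewrite opprB addrA subrK.
    rewrite (le_trans (ler_rnormB _ _)) // mulrDl mul1r mulrDr lerD ?kG //.
    apply: le_trans (kG n' _ yx) _; rewrite ler_wpM2l ?sle //.
    apply: mulr_ge0; last exact: sqr_ge0.
    by apply: divr_ge0; [apply: mulr_ge0; [exact: ler0n|exact: ltW]|exact: sqr_ge0].
  have [_ E] := diffB_at h (dk n' _ x0) (dk n _ x0).
  apply: rnorm_eq_le E _; apply: le_trans (cauchy_estimate_ball r8 B h) _.
  by rewrite [leRHS](_ : _ = 32 * (C * N ^+ 2 * (2 * s n)) / (rho / 8) * rnorm h) // /C2;
     ring.
have lim j : exists l : R[i], forall n, rnorm ('d (k n) x (delta_mx ord0 j) - l) <=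
    2 * (2 * C2 * s n * rnorm (delta_mx ord0 j : 'rV[R[i]]_m)).
  by apply: complex_limit => n n' nn; exact: kkB.
have [l lP] := choice lim.
have C20 : 0 <= C2.
  apply: divr_ge0; last exact: ltW.
  apply: mulr_ge0; first exact: ler0n.
  apply: mulr_ge0; last exact: sqr_ge0.
  by apply: divr_ge0; [apply: mulr_ge0; [exact: ler0n|exact: ltW]|exact: sqr_ge0].
have d1 j : rnorm (delta_mx ord0 j : 'rV[R[i]]_m) <= 1.
  apply: rnorm_rV_le => // i; rewrite mxE /=.
  by case: (i == j); rewrite ?rnorm0 // rnorm_nat.
have lP' n h : rnorm ('d (k n) x h - lincomb l h) <= m%:R * (4 * C2 * s n) * rnorm h.
  have E : 'd (k n) x h - lincomb l h =
      lincomb (fun j => 'd (k n) x (delta_mx ord0 j) - l j) h.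
    rewrite linear_lincomb /lincomb -sumrB; apply: eq_bigr => j _.
    by rewrite -mulrBr.
  apply: rnorm_eq_le (esym E) _; apply: lincomb_bound => j.
  apply: le_trans (lP j n) _.
  have -> : 4 * C2 * s n = 2 * (2 * C2 * s n * 1) by ring.
  rewrite ler_wpM2l // ler_wpM2l //.
  by apply: mulr_ge0; [exact: mulr_ge0|exact: ltW].
pose C1 : R := 8192 * (64 * K / rho * N) / (rho / 8) ^+ 2.
have C10 : 0 < C1 + 1.
  apply: ltr_wpDl => //; apply: divr_ge0; last exact: sqr_ge0.
  apply: mulr_ge0; first exact: ler0n.
  apply: mulr_ge0; last exact: ltW.
  by apply: divr_ge0; [apply: mulr_ge0; [exact: ler0n|exact: ltW]|exact: ltW].
(* The differential of [G] is the limit [lincomb l] of those of [k n]. *)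
suff dG : frechet G x (lincomb l).
  exact: (frechet_differentiable (@lincomb_continuous l) dG).1.
move=> e e0; exists (Num.min (rho / 8 / 8) (e / (C1 + 1))).
  by rewrite lt_min !divr_gt0.
move=> h; rewrite lt_min => /andP[hr]; rewrite ltr_pdivlMr // => he.
apply: (@le_trans _ _ (C1 * rnorm h ^+ 2)); last first.
  rewrite expr2 mulrA ler_wpM2r ?rnorm_ge0 //; apply: le_trans (ltW he).
  by rewrite mulrC ler_wpM2l ?rnorm_ge0 // lerDl.
have r88 : 0 < rho / 8 / 8 by rewrite divr_gt0.
have x08 : rnorm (x - x) < rho / 8 / 8 by rewrite subrr rnorm0.
have hx : rnorm (x + h - x) < rho / 8.
  rewrite addrAC subrr add0r; apply: lt_trans hr _.
  by rewrite ltr_pdivrMr // ltr_pMr // ltr1n.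
apply: (@ler_expr2n _ _ _ ((2 * (C * N ^+ 2) + m%:R * (4 * C2) * rnorm h) * s0)) => n.
have T := holo_taylor2 r8 (kB n) x08 hr.
have -> : C1 * rnorm h ^+ 2 +
    (2 * (C * N ^+ 2) + m%:R * (4 * C2) * rnorm h) * s0 / 2 ^+ n =
    (C * N ^+ 2 * s n + C * N ^+ 2 * s n) +
    (C1 * rnorm h ^+ 2 + m%:R * (4 * C2 * s n) * rnorm h) by rewrite /s; ring.
have split6 (a b c d p q : R[i]) :
    (d - b - (c - a)) + ((c - d - p) + (p - q)) = a - b - q by ring.
apply: rnorm_eq_le (split6 _ _ (k n (x + h)) (k n x) ('d (k n) x h) _) _.
apply: le_trans (ler_rnormD _ _) _; apply: lerD.
  by apply: le_trans (ler_rnormB _ _) _; apply: lerD; exact: kG.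
by apply: le_trans (ler_rnormD _ _) _; apply: lerD; [exact: T|exact: lP'].
Qed.

Lemma differentiable_diff_field f (W : 'rV[R[i]]_m -> 'rV[R[i]]_m) x (r : R) :
  0 < r -> (forall y, rnorm (y - x) < r -> differentiable f y) ->
  (forall k, differentiable (fun y => W y ord0 k : R[i]) x) ->
  differentiable (fun y => 'd f y (W y) : R[i]) x.
Proof.
move=> r0 df dW.
have -> : (fun y => 'd f y (W y) : R[i]) =
   \sum_(k < m) (fun y => (W y ord0 k : R[i]) * 'd f y (delta_mx ord0 k)).
  by apply/funext => y; rewrite fct_sumE linear_lincomb.
apply: differentiable_sum => k; apply: differentiableM; first exact: dW.
exact: differentiable_diff df.
Qed.

End DirectionalDerivative.

(** * Primitives on a disc *)

Section Primitive.
Context {R : realType}.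

(** The integral of [g] along the ray from [0] to [z]. *)
Definition primitive (g : R[i] -> R[i]) (z : R[i]) : R[i] :=
  z * cint (fun t => g (t%:C * z)) 0 1.

Lemma primitive0 g : primitive g 0 = 0.
Proof. by rewrite /primitive mul0r. Qed.

Lemma frechet_rderiv_ray (g : R[i] -> R[i]) (z : R[i]) (t : R) :
  differentiable g (t%:C * z) ->
  rderiv (fun s : R => g (s%:C * z)) t (z * 'd g (t%:C * z) 1).
Proof.
move=> dg; have dgz : 'd g (t%:C * z) z = z * 'd g (t%:C * z) 1.
  exact: diff_scale.
rewrite -dgz; have [K _ LK] := diff_rnorm dg.
apply: (rderiv_frechet (y := fun s : R => s%:C * z) LK _ (differentiable_frechet dg)).
move=> e e0; exists 1 => // s _.
have -> : (t + s)%:C * z - t%:C * z - s%:C *: z = 0.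
  by rewrite -[s%:C *: z]/(s%:C * z) rmorphD; ring.
by rewrite rnorm0 mulr_ge0 // ltW.
Qed.

Lemma vcontinuous_rderiv W (h : R -> W : normedModType R[i]) D a b :
  (forall t, a <= t <= b -> rderiv h t (D t)) -> vcontinuous_on h a b.
Proof.
move=> hD t /hD /rderiv_continuous H e /H[d d0 dP].
by exists d => // s _; exact: dP.
Qed.

Lemma vcontinuousM (h g : R -> R[i]) a b : vcontinuous_on h a b ->
  vcontinuous_on g a b -> vcontinuous_on (fun t => h t * g t) a b.
Proof.
move=> hc gc t tab e e0.
have n0 : 0 < rnorm (h t) + rnorm (g t) + 1.
  by rewrite ltr_wpDl // addr_ge0 ?rnorm_ge0.
pose e1 := Num.min 1 (e / (rnorm (h t) + rnorm (g t) + 1)).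
have e10 : 0 < e1 by rewrite lt_min ltr01 divr_gt0.
have e11 : e1 <= 1 by rewrite ge_min lexx.
have e1e : e1 * (rnorm (h t) + rnorm (g t) + 1) <= e.
  by rewrite -ler_pdivlMr // ge_min lexx orbT.
have [d1 d10 H1] := hc t tab _ e10; have [d2 d20 H2] := gc t tab _ e10.
exists (Num.min d1 d2); first by rewrite lt_min d10.
move=> s sab; rewrite lt_min => /andP[/(H1 _ sab) s1 /(H2 _ sab) s2].
have -> : h s * g s - h t * g t =
  (h s - h t) * (g s - g t) + ((h s - h t) * g t + h t * (g s - g t)) by ring.
have nh := rnorm_ge0 (h t); have ng := rnorm_ge0 (g t).
have ns1 := rnorm_ge0 (h s - h t); have ns2 := rnorm_ge0 (g s - g t).
apply: le_lt_trans (ler_rnormD _ _) _.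
apply: (@le_lt_trans _ _ (rnorm (h s - h t) * rnorm (g s - g t) +
   (rnorm (h s - h t) * rnorm (g t) + rnorm (h t) * rnorm (g s - g t)))).
  by rewrite rnormM lerD2l -!rnormM ler_rnormD.
apply: lt_le_trans e1e.
have h1 : rnorm (h s - h t) * rnorm (g s - g t) < e1.
  apply: le_lt_trans s1; rewrite ler_piMr //.
  exact: le_trans (ltW s2) e11.
have h2 : rnorm (h s - h t) * rnorm (g t) <= e1 * rnorm (g t).
  by rewrite ler_wpM2r // ltW.
have h3 : rnorm (h t) * rnorm (g s - g t) <= e1 * rnorm (h t).
  by rewrite mulrC ler_wpM2r // ltW.
by clear - h1 h2 h3; lra.
Qed.

Lemma vcontinuousD (h g : R -> R[i]) a b : vcontinuous_on h a b ->
  vcontinuous_on g a b -> vcontinuous_on (fun t => h t + g t) a b.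
Proof.
move=> hc gc t tab e e0; have e2 : 0 < e / 2 by lra.
have [d1 d10 H1] := hc t tab _ e2; have [d2 d20 H2] := gc t tab _ e2.
exists (Num.min d1 d2); first by rewrite lt_min d10.
move=> s sab; rewrite lt_min => /andP[/(H1 _ sab) s1 /(H2 _ sab) s2].
rewrite opprD addrACA.
by rewrite (le_lt_trans (ler_rnormD _ _)) // [e]splitr ltrD.
Qed.

Lemma vcontinuous_real (a b : R) : vcontinuous_on (fun t : R => t%:C : R[i]) a b.
Proof.
by move=> t _ e e0; exists e => // s _; rewrite -rmorphB rnorm_real.
Qed.

Definition primitive_const (tau K rho : R) : R :=
  2 * (tau * (8192 * K / rho ^+ 2) + 32 * K / rho).

(** Differentiation under the integral sign.  The derivative of the integrand
    [z * g (t z)] with respect to [z] is [q t], the derivative of [t * g (t z)]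
    with respect to [t], whose integral is [g z]; the remainder is controlled
    uniformly on the ray by [holo_taylor2]. *)
Lemma primitive_taylor (g : R[i] -> R[i]) (tau K : R) z h :
  bounded_holo g 0 tau K -> rnorm z < tau -> rnorm h < (tau - rnorm z) / 8 ->
  rnorm (primitive g (z + h) - primitive g z - h * g z) <=
    primitive_const tau K (tau - rnorm z) * rnorm h ^+ 2.
Proof.
move=> gB zt hr; pose rho := tau - rnorm z.
have rho0 : 0 < rho by rewrite subr_gt0.
have K0 : 0 <= K.
  apply: le_trans (rnorm_ge0 _) (gB 0 _).2; rewrite subr0 rnorm0.
  exact: le_lt_trans (rnorm_ge0 z) zt.
have h8 : rho / 8 < rho by rewrite ltr_pdivrMr // ltr_pMr // ltr1n.
have tau0 : 0 <= tau by apply: le_trans (rnorm_ge0 z) (ltW zt).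
have dg w : rnorm w < tau -> differentiable g w.
  by move=> wt; apply: (gB w _).1; rewrite subr0.
have ray (t : R) w : 0 <= t <= 1 -> rnorm (t%:C * w) <= rnorm w.
  by move=> /andP[t0 t1]; rewrite rnormM rnorm_real ger0_norm // ler_piMl // rnorm_ge0.
have zh : rnorm (z + h) < tau.
  rewrite (le_lt_trans (ler_rnormD _ _)) // addrC -ltrBrDr.
  exact: lt_trans hr h8.
have rayz t : 0 <= t <= 1 -> rnorm (t%:C * z) < tau.
  by move=> /(ray _ z) /le_lt_trans; apply.
have rayzh t : 0 <= t <= 1 -> rnorm (t%:C * (z + h)) < tau.
  by move=> /(ray _ (z + h)) /le_lt_trans; apply.
have gBt t : 0 <= t <= 1 -> bounded_holo g (t%:C * z) rho K.
  move=> t01; apply: bounded_holo_sub gB; rewrite subr0 /rho addrCA gerDl subr_le0.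
  exact: ray.
pose a (t : R) := g (t%:C * (z + h)); pose b (t : R) := g (t%:C * z).
pose p (t : R) : R[i] := 'd g (t%:C * z) 1.
have ac : vcontinuous_on a 0 1.
  by apply: vcontinuous_rderiv => t t01; apply: frechet_rderiv_ray; exact/dg/rayzh.
have bD t : 0 <= t <= 1 -> rderiv b t (z * p t).
  by move=> t01; apply: frechet_rderiv_ray; exact/dg/rayz.
have bc := vcontinuous_rderiv bD.
have [C8 C8E] : exists c, c = 8192 * K / rho ^+ 2 by exists (8192 * K / rho ^+ 2).
have C0 : 0 <= C8.
  by rewrite C8E; apply: divr_ge0; [apply: mulr_ge0; [exact: ler0n|]|exact/exprn_ge0/ltW].
have pc : vcontinuous_on p 0 1.
  move=> t t01 e e0; pose B := C8 * rnorm z + 1.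
  have B0 : 0 < B by apply: ltr_wpDl => //; apply: mulr_ge0 => //; exact: rnorm_ge0.
  exists (Num.min (e / B) (rho / 4 / (rnorm z + 1))).
    by rewrite lt_min !divr_gt0 // ltr_wpDl ?rnorm_ge0.
  move=> s s01; rewrite lt_min => /andP[se sr].
  have E : s%:C * z - t%:C * z = (s - t)%:C * z :> R[i] by rewrite rmorphB mulrBl.
  have x0 : rnorm (t%:C * z - t%:C * z) < rho / 4 by rewrite subrr rnorm0 divr_gt0.
  have z1 : 0 < rnorm z + 1 by rewrite ltr_wpDl ?rnorm_ge0.
  have x1 : rnorm (s%:C * z - t%:C * z) < rho / 4.
    rewrite E rnormM rnorm_real; rewrite ltr_pdivlMr // in sr.
    by apply: le_lt_trans sr; rewrite ler_wpM2l // lerDl.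
  have pst : rnorm (p s - p t) <=
      8192 * K / rho ^+ 2 * rnorm (s%:C * z - t%:C * z) * rnorm (1 : R[i]).
    have H := diff_lipschitz (1 : R[i]) rho0 (gBt _ t01) x0 x1.
    exact H.
  apply: le_lt_trans pst _; rewrite -C8E (rnorm_nat 1) mulr1 E rnormM rnorm_real mulrCA.
  rewrite ltr_pdivlMr // in se; apply: le_lt_trans se.
  by rewrite ler_wpM2l // /B lerDl.
pose q (t : R) := b t + t%:C * (z * p t).
have qc : vcontinuous_on q 0 1.
  apply: vcontinuousD => //; apply: vcontinuousM; first exact: vcontinuous_real.
  by apply: vcontinuousM => //; exact: vcontinuous_cst.
have gz : g z = cint q 0 1.
  rewrite (cint_ftc (H := fun t => t%:C * b t) ler01 qc).
    by rewrite /b mul0r subr0 !mul1r.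
  move=> t t01 e e0; have bt0 : 0 <= rnorm (b t) by exact: rnorm_ge0.
  have e2 : 0 < e / 2 by rewrite divr_gt0.
  have [d1 d10 H1] := bD t t01 (e / 2) e2.
  have zp : 0 < rnorm (z * p t) + 1 by rewrite ltr_wpDl ?rnorm_ge0.
  have [d2 d20 H2] := rderiv_local (bD t t01) (lexx _) ltr01.
  have zp2 : 0 < e / 2 / (rnorm (z * p t) + 1) by rewrite divr_gt0.
  exists (Num.min d1 (Num.min d2 (e / 2 / (rnorm (z * p t) + 1)))).
    by rewrite !lt_min d10 d20.
  move=> s; rewrite !lt_min => /and3P[/H1 s1 s2 s3].
  have {}H2 := H2 (t + s); rewrite [t + s]addrC addrK in H2.
  have {H2 s2} s2 := H2 s2; rewrite [s + t]addrC in s2.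
  have -> : (t + s)%:C * b (t + s) - t%:C * b t - s%:C *: q t =
     t%:C * (b (t + s) - b t - s%:C * (z * p t)) + s%:C * (b (t + s) - b t).
    by rewrite /q -[s%:C *: _]/(s%:C * _) rmorphD; ring.
  rewrite [e]splitr mulrDl (le_trans (ler_rnormD _ _)) // lerD //.
    rewrite rnormM rnorm_real; apply: le_trans s1.
    by case/andP: t01 => t0 t1; rewrite ger0_norm // ler_piMl // rnorm_ge0.
  rewrite rnormM rnorm_real mulrC ler_wpM2r //; apply: le_trans s2 _.
  by rewrite mulrC; rewrite ltr_pdivlMr // in s3; exact: ltW.
have I t : 0 <= t <= 1 -> rnorm ((z + h) * a t - z * b t - h * q t) <=
    (tau * C8 + 32 * K / rho) * rnorm h ^+ 2.
  move=> t01; have /andP[t0 t1] := t01.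
  have th : rnorm (t%:C * h) <= rnorm h by exact: ray.
  have x0 : rnorm (t%:C * z - t%:C * z) < rho / 8 by rewrite subrr rnorm0 divr_gt0.
  have := holo_taylor2 rho0 (gBt _ t01) x0 (le_lt_trans th hr).
  have dE : 'd g (t%:C * z) (t%:C * h) = t%:C * h * p t by exact: diff_scale.
  move=> /(rnorm_eq_le (congr1 (fun s => _ - s) dE)); rewrite -mulrDr -/(a t) -/(b t) -C8E => T.
  have pB : rnorm (p t) <= 32 * K / rho.
    by have := cauchy_estimate_ball rho0 (gBt _ t01) 1; rewrite (rnorm_nat 1) mulr1.
  have -> : (z + h) * a t - z * b t - h * q t =
    (z + h) * (a t - b t - t%:C * h * p t) + t%:C * (h * (h * p t)).
    by rewrite /q; ring.
  rewrite [leRHS]mulrDl; apply: le_trans (ler_rnormD _ _) _; apply: lerD.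
    rewrite rnormM -[leRHS]mulrA.
    apply: ler_pM; [exact: rnorm_ge0|exact: rnorm_ge0|exact: ltW|].
    apply: le_trans T _; rewrite ler_wpM2l // ler_pXn2r ?nnegrE ?rnorm_ge0 //.
  apply: le_trans (ray _ _ t01) _; rewrite !rnormM mulrA -expr2 mulrC.
  by rewrite ler_wpM2r // sqr_ge0.
have zhac := vcontinuousZ (z + h) ac; have zbc := vcontinuousZ z bc.
have hqc := vcontinuousZ h qc.
have -> : primitive g (z + h) - primitive g z - h * g z =
    cint (fun t => (z + h) * a t - z * b t - h * q t) 0 1.
  rewrite gz /primitive -/a -/b -(cintZ (z + h) ac) -(cintZ z bc) -(cintZ h qc).
  by rewrite cintB //; [rewrite cintB|exact: vcontinuousB].
have c1 := vcontinuousB (vcontinuousB zhac zbc) hqc.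
apply: le_trans (cint_bound ler01 c1 I) _.
by rewrite subr0 mulr1 [leLHS]mulrA C8E.
Qed.

End Primitive.

(** * Holomorphic differential equations *)

Section Picard.
Context {R : realType}.
Implicit Types V W : normedModType R[i].

Definition cder V (k : R[i] -> V) (z : R[i]) (D : V) : Prop :=
  frechet k z (rscale D).

Lemma rderiv_cder V (k : R[i] -> V) (y : R -> R[i]) t w D :
  rderiv y t w -> cder k (y t) D -> rderiv (k \o y) t (w *: D).
Proof.
move=> yw kD; apply: (rderiv_frechet (L := rscale D) (K := rnorm D)) => //.
by move=> h; rewrite /rscale rnormZ mulrC.
Qed.

Lemma cderB V (k k' : R[i] -> V) z D D' : cder k z D -> cder k' z D' ->
  cder (fun w => k w - k' w) z (D - D').
Proof.
move=> kD kD' e e0; have e2 : 0 < e / 2 by rewrite divr_gt0.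
have [d1 d10 H1] := kD _ e2; have [d2 d20 H2] := kD' _ e2.
exists (Num.min d1 d2); first by rewrite lt_min d10.
move=> h; rewrite lt_min => /andP[/H1 h1 /H2 h2].
rewrite /rscale scalerBr (subrACA (k (z + h))) (subrACA (k (z + h) - k z)).
rewrite [e]splitr mulrDl (le_trans (ler_rnormB _ _)) //.
exact: lerD h1 h2.
Qed.

Lemma cder_diff V W (f : V -> W) (y : R[i] -> V) w D :
  cder y w D -> differentiable f (y w) -> cder (fun z => f (y z)) w ('d f (y w) D).
Proof.
move=> /frechet_diff1[dy yE] df.
have dc : differentiable (f \o y) w by exact: differentiable_comp.
have E : 'd (f \o y) w 1 = 'd f (y w) D by rewrite diff_comp //= yE.
move=> e /(differentiable_frechet dc)[d d0 dP]; exists d => // h /dP.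
by rewrite (diff_scale (f \o y)) E.
Qed.

Lemma mean_value_cder V (y : R[i] -> V) (D : R[i] -> V) z z' B :
  (forall t, 0 <= t <= 1 -> cder y (seg z z' t) (D (seg z z' t)) /\
     rnorm (D (seg z z' t)) <= B) ->
  rnorm (y z' - y z) <= B * rnorm (z' - z).
Proof.
move=> H; rewrite -{1}(seg1 z z') -{2}(seg0 z z').
have := @mean_value_rderiv _ _ (y \o seg z z')
  (fun t => (z' - z) *: D (seg z z' t)) 0 1 (B * rnorm (z' - z)) ler01.
rewrite subr0 mulr1; apply=> t /H[yD DB]; split.
  by apply: rderiv_cder yD; exact: rderiv_line.
by rewrite rnormZ mulrC ler_wpM2r ?rnorm_ge0.
Qed.

Lemma rnorm_seg0 (z : R[i]) t : 0 <= t <= 1 -> rnorm (seg 0 z t) <= rnorm z.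
Proof.
move=> /andP[t0 t1]; rewrite /seg add0r subr0 rnormZ rnorm_real ger0_norm //.
by rewrite ler_piMl // rnorm_ge0.
Qed.

Definition vprimitive m (g : R[i] -> 'rV[R[i]]_m) (z : R[i]) : 'rV[R[i]]_m :=
  \row_k primitive (fun w => g w ord0 k) z.

Lemma vprimitive_cder m (g : R[i] -> 'rV[R[i]]_m) (tau K : R) z :
  (forall k, bounded_holo (fun w => g w ord0 k : R[i]) 0 tau K) ->
  rnorm z < tau -> cder (vprimitive g) z (g z).
Proof.
move=> gB zt e e0; pose B := `|primitive_const tau K (tau - rnorm z)| + 1.
have B0 : 0 < B by rewrite ltr_wpDl.
have t0 : 0 < (tau - rnorm z) / 8 by rewrite divr_gt0 // subr_gt0.
exists (Num.min ((tau - rnorm z) / 8) (e / B)); first by rewrite lt_min t0 divr_gt0.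
move=> h; rewrite lt_min => /andP[h1]; rewrite ltr_pdivlMr // => h2.
apply: rnorm_rV_le => [|k]; first by rewrite mulr_ge0 ?rnorm_ge0 // ltW.
have -> : (vprimitive g (z + h) - vprimitive g z - rscale (g z) h) ord0 k =
   primitive (fun w => g w ord0 k) (z + h) - primitive (fun w => g w ord0 k) z
   - h * g z ord0 k by rewrite !mxE.
apply: le_trans (primitive_taylor (gB k) zt h1) _.
rewrite expr2 mulrA ler_wpM2r ?rnorm_ge0 //; apply: le_trans (ltW h2).
rewrite mulrC ler_wpM2l ?rnorm_ge0 // (le_trans (ler_norm _)) //.
by rewrite lerDl.
Qed.

Lemma cder_shift V (k : R[i] -> V) z D c :
  cder k z D -> cder (fun w => c + k w) z D.
Proof.
move=> kD e /kD[d d0 dP]; exists d => // h /dP.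
by rewrite [c + k (z + h)]addrC opprD addrA addrK.
Qed.

(** Picard iteration in complex time: the iterates are holomorphic on a disc
    whose radius depends only on [r] and the bounds [K] and [L] of [W], and
    converge uniformly there.  The uniformity in the initial point [x] is what makes the
    local flow of a vector field defined for a uniform time. *)
Lemma picard m (W : 'rV[R[i]]_m -> 'rV[R[i]]_m) (x0 : 'rV[R[i]]_m) (r K L tau : R) :
  0 < r -> 0 < K -> 0 < L ->
  (forall y, rnorm (y - x0) < r ->
     (forall k, differentiable (fun y => W y ord0 k : R[i]) y) /\ rnorm (W y) <= K) ->
  (forall y y', rnorm (y - x0) < r -> rnorm (y' - x0) < r ->
     rnorm (W y' - W y) <= L * rnorm (y' - y)) ->
  0 < tau -> K * tau <= r / 4 -> L * tau <= 2^-1 ->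
  forall x, rnorm (x - x0) < r / 2 ->
  exists y : R[i] -> 'rV[R[i]]_m, y 0 = x /\ forall z, rnorm z < tau ->
    rnorm (y z - x0) < r /\ cder y z (W (y z)).
Proof.
move=> r0 K0 L0 WP WL tau0 Kt Lt x xx0.
(* The iterates and their derivatives [D n]. *)
pose Y := fix Y n : R[i] -> 'rV[R[i]]_m :=
  if n is n'.+1 then fun z => x + vprimitive (fun w => W (Y n' w)) z else fun=> x.
pose D n : R[i] -> 'rV[R[i]]_m :=
  if n is n'.+1 then fun z => W (Y n' z) else fun=> 0.
have Y0 n : Y n 0 = x.
  case: n => [//|n] /=; rewrite -[RHS]addr0; congr (_ + _).
  by apply/rowP => k; rewrite !mxE primitive0.
have stay n : (forall z, rnorm z < tau -> cder (Y n) z (D n z) /\ rnorm (D n z) <= K) ->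
    forall z, rnorm z < tau -> rnorm (Y n z - x) <= r / 4.
  move=> H z zt; rewrite -(Y0 n); apply: le_trans Kt.
  apply: (@le_trans _ _ (K * rnorm (z - 0))); last first.
    by rewrite subr0 ler_wpM2l // ltW.
  apply: (@mean_value_cder _ _ (D n)) => t /(rnorm_seg0 z) zs.
  by apply: H; exact: le_lt_trans zs zt.
have into y : rnorm (y - x) <= r / 4 -> rnorm (y - x0) < r.
  move=> yx; apply: le_lt_trans (ler_rdistD x _ _) _.
  by clear - yx xx0 r0; lra.
have inv n : forall z, rnorm z < tau -> cder (Y n) z (D n z) /\ rnorm (D n z) <= K.
  elim: n => [|n IHn] z zt.
    split; last by rewrite rnorm0 ltW.
    move=> e e0; exists 1 => // h _; rewrite /= /rscale scaler0 subrr subr0 rnorm0.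
    by rewrite mulr_ge0 ?rnorm_ge0 // ltW.
  have YnP w : rnorm w < tau -> rnorm (Y n w - x0) < r.
    by move=> wt; apply/into/(stay n IHn).
  split; last by have [_] := WP _ (YnP _ zt).
  apply: cder_shift; apply: (vprimitive_cder (tau := tau) (K := K)) zt => k w.
  rewrite subr0 => wt; have [dW WK] := WP _ (YnP _ wt); split.
    exact: (frechet_diff1 (cder_diff (IHn w wt).1 (dW k))).1.
  exact: le_trans (rnorm_coord _ _) WK.
have inr n z : rnorm z < tau -> rnorm (Y n z - x) <= r / 4.
  by move=> zt; exact: (stay n (inv n)).
have inr0 n z : rnorm z < tau -> rnorm (Y n z - x0) < r.
  by move=> zt; apply/into/inr.
have step n z : rnorm z < tau -> rnorm (Y n.+1 z - Y n z) <= r / 4 / 2 ^+ n.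
  elim: n z => [|n IHn] z zt.
    by rewrite expr0 divr1; apply: (inr 1%N).
  have cY : rnorm ((Y n.+2 z - Y n.+1 z) - (Y n.+2 0 - Y n.+1 0)) <=
      L * (r / 4 / 2 ^+ n) * rnorm (z - 0).
    apply: (@mean_value_cder _ (fun z => Y n.+2 z - Y n.+1 z)
      (fun z => D n.+2 z - D n.+1 z)) => t /(rnorm_seg0 z) zs.
    have {zs} st := le_lt_trans zs zt; split; last first.
      apply: le_trans (WL _ _ (inr0 _ _ st) (inr0 _ _ st)) _.
      by rewrite ler_wpM2l ?(ltW L0) // IHn.
    exact: cderB (inv n.+2 _ st).1 (inv n.+1 _ st).1.
  rewrite !Y0 subrr !subr0 in cY; apply: le_trans cY _.
  have -> : r / 4 / 2 ^+ n.+1 = r / 4 / 2 ^+ n / 2 by rewrite exprSr invfM mulrA.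
  have q0 : 0 <= r / 4 / 2 ^+ n by rewrite !divr_ge0 ?exprn_ge0 // ltW.
  rewrite mulrAC mulrC ler_wpM2l //; apply: le_trans Lt.
  by rewrite ler_wpM2l // ltW.
have cauchy n k z : rnorm z < tau -> (n <= k)%N ->
    rnorm (Y k z - Y n z) <= r / 2 / 2 ^+ n - r / 2 / 2 ^+ k.
  move=> zt /subnK <-; elim: (k - n)%N => [|j IHj].
    by rewrite add0n !subrr rnorm0.
  rewrite addSn (le_trans (ler_rdistD (Y (j + n)%N z) _ _)) //.
  have -> : r / 2 / 2 ^+ n - r / 2 / 2 ^+ (j + n).+1 =
     r / 4 / 2 ^+ (j + n) + (r / 2 / 2 ^+ n - r / 2 / 2 ^+ (j + n)).
    by rewrite exprSr; field; rewrite !expf_neq0.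
  by rewrite lerD // step.
have lim z : exists l, rnorm z < tau -> forall n, rnorm (Y n z - l) <= r / 2 ^+ n.
  have [zt|zt] := ltP (rnorm z) tau; last by exists 0.
  have [|l lP] := @rV_limit _ _ (fun n => Y n z) (fun n => r / 2 / 2 ^+ n).
    move=> n k nk; apply: le_trans (cauchy _ _ _ zt nk) _.
    by rewrite gerDl oppr_le0 !divr_ge0 ?exprn_ge0 // ltW.
  exists l => _ n; apply: le_trans (lP n) _.
  by rewrite mulrA [2 * _]mulrC divfK.
have [y yP] := choice lim.
have yx z : rnorm z < tau -> rnorm (y z - x) <= r / 4.
  move=> zt; apply: (@ler_expr2n _ _ _ r) => n.
  rewrite (le_trans (ler_rdistD (Y n z) _ _)) // addrC lerD ?inr //.
  by rewrite rnormB yP.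
exists y; split.
  have t00 : rnorm (0 : R[i]) < tau by rewrite rnorm0.
  apply/eqP; rewrite -subr_eq0; apply/eqP/rnorm0_eq0/eqP.
  rewrite eq_le rnorm_ge0 andbT; apply: (@ler_expr2n _ _ _ r) => n.
  by rewrite add0r rnormB -{1}(Y0 n) yP.
move=> z zt; split; first exact/into/yx.
have yx0 w : rnorm w < tau -> rnorm (y w - x0) < r by move=> /yx/into.
have Ylip n w w' : rnorm w < tau -> rnorm w' < tau ->
    rnorm (Y n w' - Y n w) <= K * rnorm (w' - w).
  move=> wt wt'; apply: (@mean_value_cder _ _ (D n)) => t t01.
  have := @rnorm_seg _ _ 0 w w' tau t t01; rewrite !subr0 => /(_ wt wt').
  exact: inv.
(* The equation for the limit, from a quadratic bound uniform in the iterates. *)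
have quad h : rnorm (z + h) < tau ->
    rnorm (y (z + h) - y z - h *: W (y z)) <= L * K * rnorm h * rnorm h.
  move=> zht; pose B := r + (r + rnorm h * (L * r)).
  apply: (@ler_expr2n _ _ _ B) => n.
  have -> : y (z + h) - y z - h *: W (y z) =
    (Y n.+1 (z + h) - Y n.+1 z - h *: W (Y n z)) +
    ((y (z + h) - Y n.+1 (z + h)) + ((Y n.+1 z - y z) + h *: (W (Y n z) - W (y z)))).
    apply/rowP => j; rewrite !mxE; ring.
  rewrite (le_trans (ler_rnormD _ _)) // lerD //.
    have := @mean_value_cder _ (fun w => Y n.+1 w - w *: W (Y n z))
      (fun w => W (Y n w) - W (Y n z)) z (z + h) (L * K * rnorm h).
    rewrite [z + h - z]addrAC subrr add0r.
    have -> : Y n.+1 (z + h) - (z + h) *: W (Y n z) - (Y n.+1 z - z *: W (Y n z)) =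
       Y n.+1 (z + h) - Y n.+1 z - h *: W (Y n z).
      by apply/rowP => j; rewrite !mxE; ring.
    apply=> t t01; have := @rnorm_seg _ _ 0 z (z + h) tau t t01.
    rewrite !subr0 => /(_ zt zht) st.
    split.
      move=> e e0; have [d d0 dP] := (inv n.+1 _ st).1 _ e0; exists d => // k /dP.
      apply: rnorm_eq_le; apply/rowP => j; rewrite !mxE; ring.
    apply: le_trans (WL _ _ (inr0 _ _ zt) (inr0 _ _ st)) _.
    rewrite -mulrA ler_wpM2l ?(ltW L0) //; apply: le_trans (Ylip _ _ _ zt st) _.
    rewrite ler_wpM2l ?(ltW K0) // /seg addrAC subrr add0r [z + h - z]addrAC subrr add0r.
    rewrite rnormZ rnorm_real; case/andP: t01 => t0 t1.
    by rewrite ger0_norm // ler_piMl // rnorm_ge0.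
  have h2n : r / 2 ^+ n.+1 <= r / 2 ^+ n.
    rewrite ler_wpM2l ?(ltW r0) // lef_pV2 ?posrE ?exprn_gt0 //.
    by rewrite ler_weXn2l // ler1n.
  have h1 : rnorm (y (z + h) - Y n.+1 (z + h)) <= r / 2 ^+ n.
    by rewrite rnormB (le_trans (yP _ zht n.+1)).
  have h2 : rnorm (Y n.+1 z - y z) <= r / 2 ^+ n by rewrite (le_trans (yP _ zt n.+1)).
  have h3 : rnorm (h *: (W (Y n z) - W (y z))) <= rnorm h * (L * (r / 2 ^+ n)).
    rewrite rnormZ ler_wpM2l ?rnorm_ge0 //.
    apply: le_trans (WL _ _ (yx0 _ zt) (inr0 _ _ zt)) _.
    by rewrite ler_wpM2l ?(ltW L0) // yP.
  have -> : B / 2 ^+ n = r / 2 ^+ n + (r / 2 ^+ n + rnorm h * (L * (r / 2 ^+ n))).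
    by rewrite /B; ring.
  rewrite (le_trans (ler_rnormD _ _)) // lerD //.
  by rewrite (le_trans (ler_rnormD _ _)) // lerD.
move=> e e0; have LK : 0 < L * K by rewrite mulr_gt0.
exists (Num.min (tau - rnorm z) (e / (L * K))).
  by rewrite lt_min subr_gt0 zt divr_gt0.
move=> h; rewrite lt_min => /andP[h1]; rewrite ltr_pdivlMr // => h2.
apply: le_trans (quad h _) _.
  by apply: le_lt_trans (ler_rnormD _ _) _; rewrite addrC -ltrBrDr.
by rewrite ler_wpM2r ?rnorm_ge0 // mulrC ltW.
Qed.

End Picard.

Section LocalData.
Context {R : realType}.
Implicit Types V W : normedModType R[i].

Lemma differentiable_entry V m (F : V -> 'rV[R[i]]_m) x k :
  differentiable F x -> differentiable (fun y => F y ord0 k : R[i]) x.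
Proof.
move=> dF; apply: (differentiable_comp (g := fun N : 'rV[R[i]]_m => N ord0 k : R[i])) => //.
exact: differentiable_coord.
Qed.

(** Boundedness comes from continuity at the centre, the Lipschitz bound from
    [holo_lipschitz] applied to the entries. *)
Lemma holo_local m (F : 'rV[R[i]]_m -> 'rV[R[i]]_m) x0 (r : R) : 0 < r ->
  (forall y, rnorm (y - x0) < r -> differentiable F y) ->
  exists rho K L : R, [/\ 0 < rho, rho <= r, 0 < K & 0 < L] /\
    (forall y, rnorm (y - x0) < rho -> rnorm (F y) <= K) /\
    (forall y y', rnorm (y - x0) < rho -> rnorm (y' - x0) < rho ->
       rnorm (F y' - F y) <= L * rnorm (y' - y)).
Proof.
move=> r0 dF; have [|d d0 dP] := differentiable_rcont (dF x0 _) ltr01.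
  by rewrite subrr rnorm0.
pose rho := Num.min r d; pose K := rnorm (F x0) + 1.
have rho0 : 0 < rho by rewrite lt_min r0.
have K0 : 0 < K by rewrite ltr_wpDl ?rnorm_ge0.
have FK y : rnorm (y - x0) < rho -> rnorm (F y) <= K.
  rewrite lt_min => /andP[_ /dP yd].
  by rewrite (le_trans (ler_rnorm_dist _ (F x0))) // lerD2l ltW.
have FB k : bounded_holo (fun y => F y ord0 k : R[i]) x0 rho K.
  move=> y yx; split; last exact: le_trans (rnorm_coord _ _) (FK _ yx).
  by apply/differentiable_entry/dF; move: yx; rewrite lt_min => /andP[].
have L0 : 0 < 64 * K / rho.
  by apply: divr_gt0 => //; apply: mulr_gt0 => //; rewrite ltr0n.
exists (rho / 2), K, (64 * K / rho).
have h2 : rho / 2 <= rho by rewrite ler_pdivrMr // ler_pMr // ler1n.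
split; last split.
- split => //; first by rewrite divr_gt0.
  by apply: le_trans h2 _; rewrite ge_min lexx.
- by move=> y /lt_le_trans /(_ h2) /FK.
- move=> y y' yx y'x; apply: rnorm_rV_le => [|k].
    by apply: mulr_ge0; [exact: ltW|exact: rnorm_ge0].
  by have := holo_lipschitz rho0 (FB k) yx y'x; rewrite !mxE.
Qed.

Lemma holo_flow m (F : 'rV[R[i]]_m -> 'rV[R[i]]_m) x0 (r : R) : 0 < r ->
  (forall y, rnorm (y - x0) < r -> differentiable F y) ->
  exists rho tau : R, [/\ 0 < rho, 0 < tau &
    forall x, rnorm (x - x0) < rho ->
    exists y : R[i] -> 'rV[R[i]]_m, y 0 = x /\ forall z, rnorm z < tau ->
      rnorm (y z - x0) < r /\ cder y z (F (y z))].
Proof.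
move=> r0 dF; have [rho [K [L [[rho0 rr K0 L0] [FK FL]]]]] := holo_local r0 dF.
pose tau := Num.min (rho / 4 / K) (2^-1 / L).
have tau0 : 0 < tau by rewrite lt_min !divr_gt0.
exists (rho / 2), tau; split=> //; first by rewrite divr_gt0.
have Kt : K * tau <= rho / 4 by rewrite mulrC -ler_pdivlMr // ge_min lexx.
have Lt : L * tau <= 2^-1 by rewrite mulrC -ler_pdivlMr // ge_min lexx orbT.
have FP y : rnorm (y - x0) < rho ->
    (forall k, differentiable (fun y => F y ord0 k : R[i]) y) /\ rnorm (F y) <= K.
  move=> yx; split; last exact: FK.
  by move=> k; exact/differentiable_entry/dF/(lt_le_trans yx).
move=> x xx; have [y [y0 yP]] := picard rho0 K0 L0 FP FL tau0 Kt Lt xx.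
exists y; split=> // z /yP[zx cz]; split=> //.
exact: lt_le_trans zx rr.
Qed.

Lemma cder_near V (k k' : R[i] -> V) z D (d : R) : 0 < d ->
  (forall w, rnorm (w - z) < d -> k w = k' w) -> cder k z D -> cder k' z D.
Proof.
move=> d0 kk kD e /kD[d' d'0 dP]; exists (Num.min d d'); first by rewrite lt_min d0.
move=> h; rewrite lt_min => /andP[hd /dP].
rewrite -!kk // ?subrr ?rnorm0 //.
by rewrite addrAC subrr add0r.
Qed.

Lemma cder_rcont V (k : R[i] -> V) z D : cder k z D -> rcont k z.
Proof. by move=> /frechet_diff1[/differentiable_rcont]. Qed.

End LocalData.

(** * Complex integral curves on a manifold *)

Section Flow.
Context {R : realType} {n : nat} {M : complexManifold R n}.
Implicit Types (X : localField M) (phi psi : R[i] -> M) (z w : R[i]).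

(** [phi] is at [z] a complex integral curve of [X].  Continuity is part of the
    notion because the second clause speaks of a single chart, which [phi] has to
    stay in near [z]. *)
Definition flow_at X phi z : Prop :=
  (forall A : set M, nbhs (phi z) A ->
     exists2 d : R, 0 < d & forall w, rnorm (w - z) < d -> A (phi w)) /\
  exists2 i : chart M, cdom M i (phi z) &
    cder (fun w => Defs.coord M i (phi w)) z (X i (Defs.coord M i (phi z))).

Lemma nbhs_cdom (i : chart M) (q : M) : cdom M i q -> nbhs q (cdom M i).
Proof. by move=> qi; apply: open_nbhs_nbhs; split=> //; exact: cdom_open. Qed.

(** The equation holds in every chart around the point, by the transformation law
    of vector fields. *)
Lemma flow_at_chart X phi z j : vector_field X -> flow_at X phi z ->
  cdom M j (phi z) ->
  cder (fun w => Defs.coord M j (phi w)) z (X j (Defs.coord M j (phi z))).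
Proof.
move=> VX [phic [i zi ci]] zj.
have xi := coord_img zi.
have px : param M i (Defs.coord M i (phi z)) = phi z by exact: coordK.
have ov : overlap i j (Defs.coord M i (phi z)) by split=> //; rewrite px.
have dt : differentiable (transition (M := M) i j) (Defs.coord M i (phi z)).
  by apply: transition_holomorphic => //; rewrite px.
have := cder_diff ci dt; rewrite -(VX _ _ _ ov).
have -> : transition i j (Defs.coord M i (phi z)) = Defs.coord M j (phi z).
  by rewrite /transition px.
have [d d0 dP] := phic _ (nbhs_cdom zi).
apply: (cder_near d0) => w /dP wi.
by rewrite /transition (coordK wi).
Qed.

Lemma chart_ball (i : chart M) (x : 'rV[R[i]]_n) : cimg M i x ->
  exists2 r : R, 0 < r & forall y, rnorm (y - x) < r -> cimg M i y.
Proof.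
move=> xi; have : nbhs x (cimg M i).
  by apply: open_nbhs_nbhs; split=> //; exact: cimg_open.
by move=> /nbhs_rnormP.
Qed.

Lemma coord_rcont (i : chart M) (q : M) (e : R) : cdom M i q -> 0 < e ->
  nbhs q [set m | cdom M i m /\ rnorm (Defs.coord M i m - Defs.coord M i q) < e].
Proof.
move=> qi e0; apply: filterI; first exact: nbhs_cdom.
have : nbhs (Defs.coord M i q) [set y | rnorm (y - Defs.coord M i q) < e].
  by apply/nbhs_rnormP; exists e.
by move=> /(Defs.coord_continuous qi).
Qed.

Lemma local_flow X (q : M) : holomorphic_vector_field X ->
  exists2 U : set M, nbhs q U & exists2 tau : R, 0 < tau & forall x, U x ->
    exists2 phi, phi 0 = x & forall z, rnorm z < tau -> flow_at X phi z.
Proof.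
move=> [VX dX]; pose i := chart_at M q; pose x0 := Defs.coord M i q.
have qi : cdom M i q by exact: chart_atP.
have [r r0 rP] := chart_ball (coord_img qi).
have [|rho [tau [rho0 tau0 flow]]] := @holo_flow _ _ (X i) x0 r r0.
  by move=> y /rP; exact: dX.
exists [set m | cdom M i m /\ rnorm (Defs.coord M i m - x0) < rho]; first exact: coord_rcont.
exists tau => // x [xi xr]; have [y [y0 yP]] := flow _ xr.
exists (fun z => param M i (y z)); first by rewrite y0 coordK.
move=> z zt; have [/rP yi cy] := yP z zt; split.
  move=> A /(param_continuous yi) /nbhs_rnormP[d d0 dA].
  have [d' d'0 dP] := cder_rcont cy d0.
  by exists d' => // w /dP /dA.
exists i; first exact: param_dom.
rewrite (paramK yi); have t0 : 0 < tau - rnorm z by rewrite subr_gt0.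
apply: (cder_near t0) cy => w wz.
rewrite paramK //; apply/rP; apply: (yP w _).1.
apply: le_lt_trans (ler_rnorm_dist _ z) _.
by rewrite addrC -ltrBrDr.
Qed.

Lemma hausdorff_separate (p q : M) : p <> q ->
  exists A B : set M, [/\ nbhs p A, nbhs q B & forall m, A m -> B m -> False].
Proof.
move=> pq; apply: contrapT => H; apply: pq; apply: (@hausdorffM R n M) => A B pA qB.
apply/set0P/eqP => AB; apply: H; exists A, B; split=> // m Am Bm.
by have : (A `&` B) m by []; rewrite AB.
Qed.

Lemma seg_sub (z0 z1 : R[i]) (t s u : R) :
  seg (seg z0 z1 t) (seg z0 z1 s) u = seg z0 z1 (t + u * (s - t)).
Proof.
rewrite /seg rmorphD rmorphM rmorphB.
rewrite -[t%:C *: _]/(t%:C * _) -[s%:C *: _]/(s%:C * _).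
rewrite -[u%:C *: _]/(u%:C * _) -[(_ + _) *: (z1 - z0)]/((_ + _) * (z1 - z0)).
by ring.
Qed.

Lemma seg_dist (z0 z1 : R[i]) (t s : R) :
  seg z0 z1 s - seg z0 z1 t = (s - t)%:C * (z1 - z0).
Proof.
rewrite /seg rmorphB -[t%:C *: _]/(t%:C * _) -[s%:C *: _]/(s%:C * _).
by ring.
Qed.

(** The parameters of the segment at which the two curves agree form a closed
    set, since [M] is Hausdorff, and an open one: in a chart the difference of
    the curves is halved again and again by the equation on a short interval.
    The two alternatives are combined by [cousin] applied to the equivalence of
    agreement at two parameters. *)
Lemma flow_unique X phi psi z0 z1 : holomorphic_vector_field X ->
  (forall t, 0 <= t <= 1 -> flow_at X phi (seg z0 z1 t)) ->
  (forall t, 0 <= t <= 1 -> flow_at X psi (seg z0 z1 t)) ->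
  phi z0 = psi z0 -> phi z1 = psi z1.
Proof.
move=> [VX dX] flphi flpsi.
pose P t := phi (seg z0 z1 t) = psi (seg z0 z1 t).
suff [PQ _] : P 0 <-> P 1 by move: PQ; rewrite /P !seg0 !seg1.
pose N := rnorm (z1 - z0) + 1.
have N0 : 0 < N by rewrite ltr_wpDl ?rnorm_ge0.
have nearseg (d t s : R) : `|s - t| < d / N -> 0 < d ->
    rnorm (seg z0 z1 s - seg z0 z1 t) < d.
  move=> st d0; rewrite seg_dist rnormM rnorm_real; rewrite ltr_pdivlMr // in st.
  by apply: le_lt_trans st; rewrite ler_wpM2l // lerDl.
apply: (@cousin _ (fun s t => P s <-> P t)) => //; first by move=> ? ? ? _ _ _ _ -> ->.
move=> t t01.
suff [d d0 dP] : exists2 d : R, 0 < d & forall s, 0 <= s <= 1 -> `|s - t| < d ->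
    (P s <-> P t).
  exists d => // a b a0 at' tb b1 da db.
  have -> : P a <-> P t by apply: dP; [lra|rewrite ltr_norml; lra].
  by have -> : P b <-> P t by apply: dP; [lra|rewrite ltr_norml; lra].
have [phic _] := flphi t t01; have [psic _] := flpsi t t01.
(* Disagreement at [t] persists nearby by separation. *)
have [Pt|nPt] := pselect (P t); last first.
  have [A [B [nA nB AB]]] := hausdorff_separate nPt.
  have [d1 d10 H1] := phic _ nA; have [d2 d20 H2] := psic _ nB.
  exists (Num.min d1 d2 / N); first by rewrite divr_gt0 // lt_min d10.
  move=> s s01 sd; split=> // Ps; exfalso.
  have := nearseg _ _ _ sd; rewrite lt_min d10 d20 => /(_ isT).
  rewrite lt_min => /andP[/H1 sA /H2 sB]; apply: AB sA _.
  by move: Ps; rewrite /P => ->.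
pose q := phi (seg z0 z1 t); pose i := chart_at M q.
have qi : cdom M i q by exact: chart_atP.
have [r r0 rP] := chart_ball (coord_img qi).
have [|rho [K [L [[rho0 rr K0 L0] [_ XL]]]]] := @holo_local _ _ (X i) (Defs.coord M i q) r r0.
  by move=> y /rP; exact: dX.
have nU := coord_rcont qi rho0.
have [d1 d10 H1] := phic _ nU.
have nU' : nbhs (psi (seg z0 z1 t))
    [set m | cdom M i m /\ rnorm (Defs.coord M i m - Defs.coord M i q) < rho].
  by rewrite -Pt.
have [d2 d20 H2] := psic _ nU'.
pose d := Num.min (Num.min d1 d2) (2^-1 / L) / N.
have d0 : 0 < d by rewrite divr_gt0 // !lt_min d10 d20 divr_gt0.
exists d => // s s01 sd; split=> // _.
have inU s' : 0 <= s' <= 1 -> `|s' - t| < d ->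
    [/\ cdom M i (phi (seg z0 z1 s')) /\
        rnorm (Defs.coord M i (phi (seg z0 z1 s')) - Defs.coord M i q) < rho,
        cdom M i (psi (seg z0 z1 s')) /\
        rnorm (Defs.coord M i (psi (seg z0 z1 s')) - Defs.coord M i q) < rho &
        L * rnorm (seg z0 z1 s' - seg z0 z1 t) <= 2^-1].
  move=> s'01 /nearseg; rewrite !lt_min d10 d20 divr_gt0 // => /(_ isT).
  case/andP => /andP[/H1 ? /H2 ?]; rewrite ltr_pdivlMr // => h; split=> //.
  by rewrite mulrC ltW.
pose u w := Defs.coord M i (phi w) - Defs.coord M i (psi w).
pose D w := X i (Defs.coord M i (phi w)) - X i (Defs.coord M i (psi w)).
have uD s' : 0 <= s' <= 1 -> `|s' - t| < d ->
   cder u (seg z0 z1 s') (D (seg z0 z1 s')).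
  move=> s'01 /(inU _ s'01)[[i1 _] [i2 _] _].
  apply: cderB; apply: flow_at_chart => //; [exact: flphi|exact: flpsi].
(* Each use of the equation halves the bound on the difference. *)
have bound k : forall s', 0 <= s' <= 1 -> `|s' - t| < d ->
    rnorm (u (seg z0 z1 s')) <= 2 * rho / 2 ^+ k.
  elim: k => [|k IHk] s' s'01 s'd.
    have [[_ h1] [_ h2] _] := inU _ s'01 s'd.
    rewrite expr0 divr1 /u (le_trans (ler_rdistD (Defs.coord M i q) _ _)) //.
    by rewrite mulrDl mul1r lerD // ltW // rnormB.
  have ut : u (seg z0 z1 t) = 0 by rewrite /u Pt subrr.
  have -> : u (seg z0 z1 s') = u (seg z0 z1 s') - u (seg z0 z1 t) by rewrite ut subr0.
  have := @mean_value_cder _ _ u D (seg z0 z1 t) (seg z0 z1 s')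
    (L * (2 * rho / 2 ^+ k)).
  have [_ _ h3] := inU _ s'01 s'd; move=> H.
  apply: (@le_trans _ _ (L * (2 * rho / 2 ^+ k) * rnorm (seg z0 z1 s' - seg z0 z1 t))).
    apply: H => v v01; rewrite seg_sub.
    have v1 : 0 <= t + v * (s' - t) <= 1.
      case/andP: v01 t01 s'01 => v0 v1 /andP[t0 t1] /andP[s0 s1].
      by apply/andP; split; nra.
    have v2 : `|t + v * (s' - t) - t| < d.
      rewrite addrAC subrr add0r normrM; case/andP: v01 => v0 v1'.
      by rewrite ger0_norm //; apply: le_lt_trans s'd; rewrite ler_piMl.
    split; first exact: uD.
    have [[_ h1] [_ h2] _] := inU _ v1 v2.
    by apply: le_trans (XL _ _ h2 h1) _; rewrite ler_wpM2l ?(ltW L0) // IHk.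
  have -> : 2 * rho / 2 ^+ k.+1 = 2 * rho / 2 ^+ k * 2^-1 by rewrite exprSr invfM mulrA.
  rewrite mulrAC mulrC ler_wpM2l //.
  by rewrite divr_ge0 ?exprn_ge0 // mulr_ge0 // ltW.
have [[i1 _] [i2 _] _] := inU _ s01 sd.
rewrite /P -(coordK i1) -(coordK i2); congr (param M i _).
apply/eqP; rewrite -subr_eq0; apply/eqP/rnorm0_eq0/eqP.
rewrite eq_le rnorm_ge0 andbT; apply: (@ler_expr2n _ _ _ (2 * rho)) => k.
by rewrite add0r; exact: bound.
Qed.

End Flow.

(** * Velocity of curves *)

Section Curves.
Context {R : realType}.

Lemma fin_radius (I : finType) T (N : T -> R) (Q : I -> T -> Prop) :
  (forall i, exists2 d : R, 0 < d & forall s, N s < d -> Q i s) ->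
  exists2 d : R, 0 < d & forall s, N s < d -> forall i, Q i s.
Proof.
move=> H; suff [d d0 dP] : exists2 d : R, 0 < d &
    forall s, N s < d -> forall i, i \in enum I -> Q i s.
  by exists d => // s sd i; apply: dP sd _ _; rewrite mem_enum.
elim: (enum I) => [|i l [d d0 dP]]; first by exists 1.
have [d' d'0 dP'] := H i; exists (Num.min d d'); first by rewrite lt_min d0.
move=> s; rewrite lt_min => /andP[sd sd'] j; rewrite inE => /orP[/eqP ->|].
  exact: dP'.
exact: dP sd j.
Qed.

Lemma derivable_real (f : R -> R) (t : R) : derivable f t 1 ->
  forall e : R, 0 < e -> exists2 d : R, 0 < d &
    forall s, `|s| < d -> `|f (t + s) - f t - s * derive1 f t| <= e * `|s|.
Proof.
move=> df e e0; have /derivable1_diffP/diff_locallyP[_ H] := df.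
have /eqaddoP := H => /(_ e e0) /nbhs_ballP[d /= d0 dP].
exists d => // s sd; have : ball (0 : R) d s by rewrite /ball /= sub0r normrN.
move=> /dP /=; apply: le_trans; rewrite le_eqVlt; apply/orP; left; apply/eqP.
rewrite !fctE /= deriv1E // opprD addrA [s + t]addrC.
by [].
Qed.

Lemma real_is_derive (f : R -> R) (t D : R) :
  (forall e : R, 0 < e -> exists2 d : R, 0 < d &
    forall s, `|s| < d -> `|f (t + s) - f t - s * D| <= e * `|s|) ->
  is_derive t 1 f D.
Proof.
move=> H.
have cv : h^-1 *: (f (h *: 1 + t) - f t) @[h --> (0 : R)^'] --> D.
  apply/cvgrPdist_le => e e0; have [d d0 dP] := H e e0.
  rewrite near_withinE; apply/nbhs_ballP; exists d => // h.
  rewrite /ball /= sub0r normrN => /dP hP h0.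
  have -> : h *: 1 = h :> R by rewrite -[h *: 1]/(h * 1) mulr1.
  rewrite -[_ *: (_ - _)]/(h^-1 * _) [h + t]addrC.
  have -> : D - h^-1 * (f (t + h) - f t) = - (h^-1 * (f (t + h) - f t - h * D)).
    by field.
  rewrite normrN normrM normfV mulrC ler_pdivrMr ?normr_gt0 //.
apply: DeriveDef; first by apply/cvg_ex; exists D.
exact: cvg_lim cv.
Qed.

Context {n : nat}.
Implicit Types c : R -> 'rV[R[i]]_n.

Lemma curve_rderiv c t : curve_derivable c t -> rderiv c t (curve_derive c t).
Proof.
move=> dc e e0; have e2 : 0 < e / 2 by rewrite divr_gt0.
have H (k : 'I_n) : exists2 d : R, 0 < d & forall s, `|s| < d ->
    rnorm ((c (t + s) - c t - s%:C *: curve_derive c t) ord0 k) <= e * `|s|.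
  have [dr di] := dc k.
  have [d1 d10 H1] := derivable_real dr e2; have [d2 d20 H2] := derivable_real di e2.
  exists (Num.min d1 d2); first by rewrite lt_min d10.
  move=> s; rewrite lt_min => /andP[/H1 h1 /H2 h2].
  rewrite (le_trans (ler_rnorm_ReIm _)) // [e]splitr mulrDl lerD //.
    apply: le_trans h1; rewrite !mxE !ReB; case: (c (t + s) ord0 k) => a b /=.
    by rewrite mul0r subr0.
  apply: le_trans h2; rewrite !mxE !ImB; case: (c (t + s) ord0 k) => a b /=.
  by rewrite mul0r addr0.
have [d d0 dP] := fin_radius H; exists d => // s sd.
by apply: rnorm_rV_le => [|k]; [rewrite mulr_ge0 // ltW|exact: dP].
Qed.

Lemma rderiv_is_derive c t D : rderiv c t D -> forall k,
  is_derive t 1 (fun s => complex.Re (c s ord0 k) : R) (complex.Re (D ord0 k)) /\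
  is_derive t 1 (fun s => complex.Im (c s ord0 k) : R) (complex.Im (D ord0 k)).
Proof.
move=> cD k; split; apply: real_is_derive => e /cD[d d0 dP]; exists d => // s /dP H.
  apply: le_trans H; apply: le_trans (rnorm_coord _ k).
  apply: le_trans (ler_Re_rnorm _); rewrite !mxE !ReB.
  by case: (D ord0 k) => a b /=; rewrite mul0r subr0.
apply: le_trans H; apply: le_trans (rnorm_coord _ k).
apply: le_trans (ler_Im_rnorm _); rewrite !mxE !ImB.
by case: (D ord0 k) => a b /=; rewrite mul0r addr0.
Qed.

Lemma rderiv_curve_derivable c t D : rderiv c t D ->
  curve_derivable c t /\ curve_derive c t = D.
Proof.
move=> /rderiv_is_derive H; split; first by move=> k; have [[? _] [? _]] := H k.
apply/rowP => k; rewrite mxE; have [[_ h1] [_ h2]] := H k.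
by rewrite !derive1E h1 h2; case: (D ord0 k).
Qed.

Lemma curve_C1_continuous c : curve_C1 c -> forall t (e : R), 0 < e ->
  exists2 d : R, 0 < d & forall s, `|s - t| < d -> rnorm (c s - c t) < e.
Proof. by move=> [dc _] t; exact: rderiv_continuous (curve_rderiv (dc t)). Qed.

Lemma continuous_eps (f : R -> R) t :
  (forall e : R, 0 < e -> exists2 d : R, 0 < d & forall s, `|s - t| < d ->
     `|f s - f t| < e) <-> {for t, continuous f}.
Proof.
split=> [H|H e e0].
  apply/cvgrPdist_lt => e /H[d d0 dP]; apply/nbhs_ballP; exists d => // s.
  by rewrite /ball /= distrC => /dP; rewrite distrC.
move/cvgrPdist_lt : H => /(_ e e0) /nbhs_ballP[d d0 dP]; exists d => // s st.
by rewrite distrC; apply: dP; rewrite /ball /= distrC.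
Qed.

Lemma vcontinuous_continuous (h : R -> R[i]) t :
  (forall a b, vcontinuous_on h a b) ->
  {for t, continuous (fun s => complex.Re (h s) : R)} /\
  {for t, continuous (fun s => complex.Im (h s) : R)}.
Proof.
move=> hc; have ht (e : R) : 0 < e -> exists2 d : R, 0 < d &
    forall s, `|s - t| < d -> rnorm (h s - h t) < e.
  move=> e0; have [|d d0 dP] := hc (t - 1) (t + 1) t _ e e0; first by lra.
  exists (Num.min d 1); first by rewrite lt_min d0 ltr01.
  move=> s; rewrite lt_min => /andP[sd]; rewrite ltr_norml => /andP[? ?].
  by apply: dP => //; lra.
split; apply/continuous_eps => e /ht[d d0 dP]; exists d => // s /dP.
  by apply: le_lt_trans; rewrite -ReB ler_Re_rnorm.
by apply: le_lt_trans; rewrite -ImB ler_Im_rnorm.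
Qed.

(** The two requirements of [curve_C1], existence of the coordinate derivatives
    and their continuity, are read off from [D]. *)
Lemma curve_C1_intro c (D : R -> 'rV[R[i]]_n) : (forall t, rderiv c t (D t)) ->
  (forall k a b, vcontinuous_on (fun t => D t ord0 k : R[i]) a b) -> curve_C1 c.
Proof.
move=> cD Dc; split; first by move=> t; exact: (rderiv_curve_derivable (cD t)).1.
move=> k; have [E1 E2] :
   derive1 (fun s => complex.Re (c s ord0 k)) = (fun t => complex.Re (D t ord0 k)) /\
   derive1 (fun s => complex.Im (c s ord0 k)) = (fun t => complex.Im (D t ord0 k)).
  by split; apply/funext => t; have [[_ h1] [_ h2]] := rderiv_is_derive (cD t) k;
     rewrite derive1E.
by rewrite E1 E2; split=> t; have [] := vcontinuous_continuous t (Dc k).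
Qed.

End Curves.

(** * Hermitian metrics and unitary frames *)

Section Metric.
Context {R : realType} {n : nat} {M : complexManifold R n}.
Variables (g : hermitianMetric M) (i : chart M) (x : 'rV[R[i]]_n).
Hypothesis xi : cimg M i x.
Local Notation G := (g i x).

Lemma J_scale (u : 'rV[R[i]]_n) : J u = 'i *: u. Proof. by []. Qed.

Lemma complex_scale (a : R[i]) (u : 'rV[R[i]]_n) :
  a *: u = (complex.Re a)%:C *: u + (complex.Im a)%:C *: J u.
Proof. by rewrite J_scale scalerA -scalerDl {1}(complexE a) ['i * _]mulrC. Qed.

Lemma metricD u v w : G (u + v) w = G u w + G v w.
Proof. by have := metric_linear g 1 u v w xi; rewrite scale1r mul1r. Qed.

Lemma metric0 w : G 0 w = 0.
Proof. by have /eqP := metricD 0 0 w; rewrite addr0 -subr_eq subrr eq_sym => /eqP. Qed.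

Lemma metricZ (t : R) u w : G (t%:C *: u) w = t * G u w.
Proof. by have := metric_linear g t u 0 w xi; rewrite metric0 !addr0. Qed.

Lemma metricDr u v w : G w (u + v) = G w u + G w v.
Proof. by rewrite !(Defs.metric_sym g w _ xi) metricD. Qed.

Lemma metricZr (t : R) u w : G w (t%:C *: u) = t * G w u.
Proof. by rewrite !(Defs.metric_sym g w _ xi) metricZ. Qed.

Lemma metricJ u v : G (J u) v = - G u (J v).
Proof.
rewrite -(metric_J g _ v xi).
have -> : J (J u) = (-1)%:C *: u.
  by rewrite !J_scale scalerA -expr2 sqr_i rmorphN1.
by rewrite metricZ mulN1r.
Qed.

Lemma hermD u v w : herm g i x (u + v) w = herm g i x u w + herm g i x v w.
Proof. by rewrite /herm !metricD !mulrDl; simpc. Qed.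

Lemma hermZ (a : R[i]) u w : herm g i x (a *: u) w = a * herm g i x u w.
Proof.
rewrite /herm complex_scale !metricD !metricZ !metricJ.
have -> : G u (J (J w)) = - G u w.
  by rewrite (Defs.metric_sym g u _ xi) metricJ (metric_J g w u xi) (Defs.metric_sym g w _ xi).
by case: a => p q; simpc => /=; congr (_ +i* _); field.
Qed.

Lemma herm0 w : herm g i x 0 w = 0.
Proof. by rewrite -[0](scale0r (0 : 'rV[R[i]]_n)) hermZ mul0r. Qed.

Lemma herm_sum (I : finType) (F : I -> 'rV[R[i]]_n) w :
  herm g i x (\sum_k F k) w = \sum_k herm g i x (F k) w.
Proof.
apply: (big_morph (fun u => herm g i x u w)) => [u v|]; first exact: hermD.
exact: herm0.
Qed.

Lemma herm_conj u v : herm g i x u v = ((herm g i x v u)^*)%C.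
Proof.
rewrite /herm; simpc; congr (_ +i* _); first by rewrite (Defs.metric_sym g u v xi).
by rewrite (Defs.metric_sym g u (J v) xi) metricJ mulNr.
Qed.

Lemma Re_herm u : complex.Re (herm g i x u u) = G u u / 2.
Proof. by []. Qed.

Section Unitary.
Variable (E : 'I_n -> 'rV[R[i]]_n).
Hypothesis EU : forall k l, herm g i x (E k) (E l) = (k == l)%:R.

Lemma herm_frame (b : 'I_n -> R[i]) l : herm g i x (\sum_k b k *: E k) (E l) = b l.
Proof.
rewrite herm_sum (bigD1 l) //= hermZ EU eqxx mulr1 big1 ?addr0 // => k kl.
by rewrite hermZ EU (negbTE kl) mulr0.
Qed.

(** The factor [2] comes from [herm], whose real part is half the metric. *)
Lemma metric_frame (b : 'I_n -> R[i]) :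
  G (\sum_k b k *: E k) (\sum_k b k *: E k) = 2 * \sum_k rnorm (b k) ^+ 2.
Proof.
set u := \sum_k _; have -> : G u u = 2 * complex.Re (herm g i x u u).
  by rewrite Re_herm mulrC divfK.
congr (_ * _); rewrite {1}/u herm_sum.
rewrite (big_morph (@complex.Re R) (id1 := 0) (op1 := +%R)) //; last by case=> ? ? [].
apply: eq_bigr => k _; rewrite hermZ herm_conj herm_frame -rnorm_normc.
by case: (b k) => p q /=; rewrite sqr_sqrtr ?addr_ge0 ?sqr_ge0 //; ring.
Qed.

(** A unitary family of [n] vectors is independent, hence a basis. *)
Lemma frame_span u : exists b : 'I_n -> R[i], u = \sum_k b k *: E k.
Proof.
pose A := \matrix_k E k : 'M[R[i]]_n.
have mulA (v : 'rV[R[i]]_n) : v *m A = \sum_k v ord0 k *: E k.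
  rewrite mulmx_sum_row; apply: eq_bigr => k _; congr (_ *: _).
  by apply/rowP => j; rewrite !mxE.
have Af : row_free A.
  apply: inj_row_free => v; rewrite mulA => v0; apply/rowP => l.
  by have := herm_frame (fun k => v ord0 k) l; rewrite v0 herm0 mxE => <-.
rewrite row_free_unit in Af.
by exists (fun k => (u *m invmx A) ord0 k); rewrite -mulA mulmxKV.
Qed.

Lemma rnorm_le_metric u : rnorm u <= (\sum_k rnorm (E k)) * Num.sqrt (G u u).
Proof.
have [b ub] := frame_span u; rewrite {1}ub (le_trans (rnorm_sum _)) //.
rewrite mulr_suml; apply: ler_sum => k _; rewrite rnormZ mulrC.
rewrite ler_wpM2l ?rnorm_ge0 // -(ler_pXn2r (ltn0Sn 1)) ?nnegrE ?sqrtr_ge0 ?rnorm_ge0 //.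
have gE : G u u = 2 * \sum_k rnorm (b k) ^+ 2 by rewrite ub metric_frame.
have s0 (j : 'I_n) : 0 <= rnorm (b j) ^+ 2 by rewrite sqr_ge0.
rewrite sqr_sqrtr; last by rewrite gE mulr_ge0 // sumr_ge0.
have : rnorm (b k) ^+ 2 <= \sum_k rnorm (b k) ^+ 2.
  by rewrite [leRHS](bigD1 k) //= lerDl sumr_ge0.
rewrite gE; have := s0 k; set p := rnorm _ ^+ 2; set q := \sum_(k < n) _; lra.
Qed.

End Unitary.

(** [e_k] and [J e_k], a basis of [C^n] over the reals. *)
Definition rbasis (a : 'I_n * bool) : 'rV[R[i]]_n :=
  if a.2 then J (delta_mx ord0 a.1) else delta_mx ord0 a.1.

Definition rcoord (u : 'rV[R[i]]_n) (a : 'I_n * bool) : R :=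
  if a.2 then complex.Im (u ord0 a.1) else complex.Re (u ord0 a.1).

Lemma rbasis_sum u : u = \sum_a (rcoord u a)%:C *: rbasis a.
Proof.
rewrite -(pair_bigA _ (fun k b => (rcoord u (k, b))%:C *: rbasis (k, b))) /=.
rewrite [LHS]row_sum_delta; apply: eq_bigr => k _.
by rewrite big_bool /= complex_scale addrC.
Qed.

(** Reduces the continuity of the metric on moving vectors to that of its
    coefficients on fixed vectors, which is what smoothness provides. *)
Lemma metric_rbasis u :
  G u u = \sum_a \sum_b rcoord u a * (rcoord u b * G (rbasis a) (rbasis b)).
Proof.
rewrite {1}(rbasis_sum u).
rewrite (big_morph (fun v => G v u) (id1 := 0) (op1 := +%R)); last 2 first.
- by move=> v w; exact: metricD.
- exact: metric0.
apply: eq_bigr => a _; rewrite metricZ -mulr_sumr; congr (_ * _).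
rewrite {1}(rbasis_sum u).
rewrite (big_morph (fun v => G (rbasis a) v) (id1 := 0) (op1 := +%R)); last 2 first.
- by move=> v w; exact: metricDr.
- by rewrite (Defs.metric_sym g _ _ xi) metric0.
by apply: eq_bigr => b _; rewrite metricZr.
Qed.

End Metric.

(** * Length of curves *)

Section Speed.
Context {R : realType} {n : nat} {M : complexManifold R n}.
Variable g : hermitianMetric M.
Implicit Types (i : chart M) (c : R -> 'rV[R[i]]_n) (p q : M) (l : R).

Definition speed i c t : R :=
  Num.sqrt (g i (c t) (curve_derive c t) (curve_derive c t)).

Lemma arc_lengthE i c : arc_length g i c = rint (speed i c) 0 1.
Proof. by []. Qed.

Lemma continuous_sum (I : finType) (F : I -> R -> R) t :
  (forall k, {for t, continuous (F k)}) ->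
  {for t, continuous (fun s => \sum_k F k s)}.
Proof.
move=> Fc; elim: (index_enum I) => [|k r IH].
  have -> : (fun s => \sum_(k <- [::]) F k s) = cst 0.
    by apply/funext => s; rewrite big_nil.
  exact: cst_continuous.
have -> : (fun s => \sum_(k <- k :: r) F k s) =
    (fun s => F k s + \sum_(k <- r) F k s).
  by apply/funext => s; rewrite big_cons.
exact: cvgD (Fc k) IH.
Qed.

Lemma speed_continuous i c : curve_C1 c ->
  (forall t, 0 <= t <= 1 -> cimg M i (c t)) -> continuous_on (speed i c) 0 1.
Proof.
move=> cC ci t t01 e e0; have [dc Dc] := cC.
pose S s := \sum_a \sum_b rcoord (curve_derive c s) a *
  (rcoord (curve_derive c s) b * g i (c s) (rbasis a) (rbasis b)).
have rc a : {for t, continuous (fun s => rcoord (curve_derive c s) a)}.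
  case: a => k b; have [h1 h2] := Dc k.
  have -> : (fun s => rcoord (curve_derive c s) (k, b)) =
     if b then derive1 (fun s => complex.Im (c s ord0 k))
     else derive1 (fun s => complex.Re (c s ord0 k)).
    by apply/funext => s; case: b; rewrite /rcoord /= mxE.
  by case: b; [exact: h2|exact: h1].
have gc a b : {for t, continuous (fun s => g i (c s) (rbasis a) (rbasis b) : R)}.
  apply/continuous_eps => e' e'0.
  have := metric_smooth g i (rbasis a) (rbasis b) 0%N (c t) (ci _ t01).
  move=> /cvgrPdist_lt /(_ e' e'0) /nbhs_rnormP[d d0 dP].
  have [d' d'0 dP'] := curve_C1_continuous cC t d0.
  by exists d' => // s /dP' /dP; rewrite distrC.
have Sc : {for t, continuous S}.
  apply: continuous_sum => a; apply: continuous_sum => b.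
  by apply: cvgM; [exact: rc|apply: cvgM; [exact: rc|exact: gc]].
have sSc : {for t, continuous (fun s => Num.sqrt (S s))}.
  exact: (continuous_comp Sc (@sqrt_continuous _ _)).
have [d d0 dP] := (continuous_eps _ _).2 sSc e e0.
exists d => // s s01 /dP.
by rewrite /speed !(metric_rbasis _ (ci _ _)).
Qed.

Lemma joined_ge0 p q l : joined g p q l -> 0 <= l.
Proof.
elim=> // i c q' l' _ _ _ l0; rewrite addr_ge0 // arc_lengthE.
by apply: Rintegral_ge0 => t _; rewrite sqrtr_ge0.
Qed.

Lemma joined_trans p q r l l' : joined g p q l -> joined g q r l' ->
  joined g p r (l + l').
Proof.
move=> pq qr; elim: pq qr => [p'|i c q' l1 cC ci _ IH] qr; first by rewrite add0r.
by rewrite -addrA; apply: joined_arc => //; exact: IH.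
Qed.

Lemma joined_arc1 i c : curve_C1 c -> (forall t, 0 <= t <= 1 -> cimg M i (c t)) ->
  joined g (param M i (c 0)) (param M i (c 1)) (arc_length g i c).
Proof.
move=> cC ci; rewrite -[arc_length _ _ _]addr0; apply: joined_arc => //.
exact: joined_refl.
Qed.

(** On short intervals the increment of [rho] is compared with the integral of the
    speed, and the comparison is summed up along each arc with [cousin]. *)
Lemma joined_lipschitz (rho : M -> R) (L : R) : 0 <= L ->
  (forall i c, curve_C1 c -> (forall t, 0 <= t <= 1 -> cimg M i (c t)) ->
     forall t, 0 <= t <= 1 -> forall e : R, 0 < e -> exists2 d : R, 0 < d &
     forall s, 0 <= s <= 1 -> `|s - t| < d ->
       `|rho (param M i (c s)) - rho (param M i (c t))| <= (L * speed i c t + e) * `|s - t|) ->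
  forall p q l, joined g p q l -> `|rho q - rho p| <= L * l.
Proof.
move=> L0 H p q l; elim=> [p'|i c q' l' cC ci _ IH]; first by rewrite subrr normr0 mulr0.
rewrite mulrDr [leRHS]addrC; have -> : rho q' - rho (param M i (c 0)) =
  (rho q' - rho (param M i (c 1))) + (rho (param M i (c 1)) - rho (param M i (c 0))) by ring.
rewrite (le_trans (ler_normD _ _)) // lerD // arc_lengthE.
have vc := speed_continuous cC ci; set v := speed i c in vc *.
pose u t := rho (param M i (c t)); rewrite -/(u 1) -/(u 0).
apply/ler_addgt0Pl => /= e e0; rewrite [leRHS]addrC.
pose Q x y := `|u y - u x| <= L * rint v x y + e * (y - x).
suff : Q 0 1 by rewrite /Q subr0 mulr1.
have vsub x y : 0 <= x -> y <= 1 -> continuous_on v x y.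
  move=> x0 y1 t txy e' e'0; have [|d d0 dP] := vc t _ e' e'0; first by lra.
  by exists d => // s sxy; apply: dP; lra.
apply: (@cousin _ Q) => // [x y z x0 xy yz z1 Qxy Qyz|t t01].
  rewrite /Q (rint_split xy yz); last exact: vsub.
  have -> : u z - u x = (u y - u x) + (u z - u y) by ring.
  rewrite (le_trans (ler_normD _ _)) //.
  have -> : L * (rint v x y + rint v y z) + e * (z - x) =
    (L * rint v x y + e * (y - x)) + (L * rint v y z + e * (z - y)) by ring.
  exact: lerD.
have L1 : 0 < L + 1 by rewrite ltr_wpDl.
have e2 : 0 < e / 2 by rewrite divr_gt0.
have eL : 0 < e / 2 / (L + 1) by rewrite divr_gt0.
have [d1 d10 H1] := vc t t01 _ eL.
have [d2 d20 H2] := H i c cC ci t t01 _ e2.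
exists (Num.min d1 d2); first by rewrite lt_min d10.
move=> x y x0 xt ty y1; rewrite ltrBlDr -ltrBlDl -ltrBlDl !lt_min.
move=> /andP[x1 x2] /andP[y2 y3]; rewrite /Q.
have xy : x <= y by exact: le_trans ty.
have ux : `|u t - u x| <= (L * v t + e / 2) * (t - x).
  rewrite distrC -(@ger0_norm _ (t - x)) ?subr_ge0 // (distrC t x).
  apply: H2; first by clear - x0 xt t01; lra.
  by rewrite distrC ger0_norm ?subr_ge0.
have uy : `|u y - u t| <= (L * v t + e / 2) * (y - t).
  rewrite -(@ger0_norm _ (y - t)) ?subr_ge0 //.
  apply: H2; first by clear - y1 ty t01; lra.
  by rewrite ger0_norm ?subr_ge0.
have vi : (v t - e / 2 / (L + 1)) * (y - x) <= rint v x y.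
  apply: rint_ge => //; first exact: vsub.
  move=> s /andP[sx sy].
  have : `|v s - v t| < e / 2 / (L + 1).
    apply: H1; first by clear - sx sy x0 y1; lra.
    by rewrite ltr_norml; clear - sx sy x1 y2; lra.
  by rewrite ltr_norml => /andP[hh _]; clear - hh; lra.
have -> : u y - u x = (u t - u x) + (u y - u t) by ring.
rewrite (le_trans (ler_normD _ _)) //; apply: le_trans (lerD ux uy) _.
rewrite -mulrDr; have -> : t - x + (y - t) = y - x by ring.
apply: (@le_trans _ _ (L * ((v t - e / 2 / (L + 1)) * (y - x)) + e * (y - x))); last first.
  by rewrite lerD2r ler_wpM2l.
have -> : L * ((v t - e / 2 / (L + 1)) * (y - x)) + e * (y - x) =
   (L * v t + (e - L * (e / 2 / (L + 1)))) * (y - x) by ring.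
rewrite ler_wpM2r ?subr_ge0 // lerD2l lerBrDr -lerBrDl.
have -> : e - e / 2 = e / 2 by field.
by rewrite mulrCA ler_piMr ?(ltW e2) // ler_pdivrMr // mul1r lerDl.
Qed.

End Speed.

Lemma min_lipschitz (R : realType) (r a b d : R) : a <= b + d -> b <= a + d ->
  `|Num.min r a - Num.min r b| <= d.
Proof.
move=> ab ba; have d0 : 0 <= d by lra.
by rewrite ler_norml /Num.min; case: ltP => ha; case: ltP => hb; lra.
Qed.

(** * Distance and topology *)

Section CompactBox.
Context {R : realType}.

Definition square (a : R[i]) (r : R) : set R[i] :=
  [set z | `|complex.Re (z - a)| <= r /\ `|complex.Im (z - a)| <= r].

Lemma square_compact a r : compact (square a r).
Proof.
pose f (p : R * R) : R[i] := a + (p.1 +i* p.2).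
have fc : continuous f.
  move=> p A /nbhs_rnormP[e e0 eA]; have e2 : 0 < e / 2 by rewrite divr_gt0.
  exists (ball p.1 (e / 2), ball p.2 (e / 2)); first by split; exact: nbhsx_ballx.
  move=> [s t] [/= ps pt]; apply: eA.
  have -> : f (s, t) - f p = ((s - p.1) +i* (t - p.2)).
    by rewrite /f /= opprD addrACA subrr add0r; simpc.
  rewrite (le_lt_trans (ler_rnorm_ReIm _)) //= [e]splitr.
  by rewrite distrC (distrC t) ltrD.
have -> : square a r = f @` (`[- r, r]%classic `*` `[- r, r]%classic).
  apply/seteqP; split=> [z [zr zi]|_ [[s t] [/= sr tr] <-]].
    exists (complex.Re (z - a), complex.Im (z - a)).
      by split=> /=; rewrite in_itv /= -ler_norml.
    by rewrite /f /=; case: (z - a) (subrK a z) => p q /= <-; rewrite addrC.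
  rewrite /square /= /f addrAC subrr add0r /=.
  by move: sr tr; rewrite !in_itv /= -!ler_norml.
apply: continuous_compact; first exact: continuous_subspaceT.
by apply: compact_setX; exact: segment_compact.
Qed.

Lemma box_compact n (a : 'rV[R[i]]_n) r :
  compact [set v : 'rV[R[i]]_n | forall k, square (a ord0 k) r (v ord0 k)].
Proof.
apply: (@rV_compact _ _ (fun k => square (a ord0 k) r)) => k.
exact: square_compact.
Qed.

End CompactBox.

Section Distance.
Context {R : realType} {n : nat} {M : complexManifold R n}.
Variable g : hermitianMetric M.
Variable E : 'I_n -> localField M.
Hypothesis E_holo : forall k, holomorphic_vector_field (E k).
Hypothesis E_unitary : forall k l i x, cimg M i x ->
  herm g i x (E k i x) (E l i x) = (k == l)%:R.
Implicit Types (i j : chart M) (p q : M) (l : R).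

(** The frame is continuous, hence bounded near [x0], and [rnorm_le_metric] turns
    a bound on a unitary frame into a lower bound of the metric. *)
Lemma metric_lower i (x0 : 'rV[R[i]]_n) : cimg M i x0 ->
  exists r L : R, [/\ 0 < r, 0 < L & forall y, rnorm (y - x0) < r ->
    cimg M i y /\ forall u, rnorm u <= L * Num.sqrt (g i y u u)].
Proof.
move=> xi; have [r0 r00 rP] := chart_ball xi.
have H k : exists2 d : R, 0 < d & forall y, rnorm (y - x0) < d ->
    rnorm (E k i y) <= rnorm (E k i x0) + 1.
  have [d d0 dP] := differentiable_rcont ((E_holo k).2 i x0 xi) ltr01.
  exists d => // y /dP yd; rewrite (le_trans (ler_rnorm_dist _ (E k i x0))) //.
  by rewrite lerD2l ltW.
have [d d0 dP] := fin_radius H.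
have S0 : 0 <= \sum_k (rnorm (E k i x0) + 1).
  by rewrite sumr_ge0 // => k _; rewrite addr_ge0 ?rnorm_ge0.
exists (Num.min r0 d), (\sum_k (rnorm (E k i x0) + 1) + 1); split.
- by rewrite lt_min r00.
- by rewrite ltr_wpDl.
move=> y; rewrite lt_min => /andP[/rP yi /dP yd]; split=> // u.
have := rnorm_le_metric (E := fun k => E k i y) yi (fun k k' => E_unitary k k' yi) u.
move=> /le_trans; apply.
by rewrite ler_wpM2r ?sqrtr_ge0 // ler_wpDr // ler_sum.
Qed.

Lemma param_curve i (c : R -> 'rV[R[i]]_n) t (A : set M) : curve_C1 c ->
  cimg M i (c t) -> nbhs (param M i (c t)) A ->
  exists2 d : R, 0 < d & forall s, `|s - t| < d -> A (param M i (c s)).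
Proof.
move=> cC ci /(param_continuous ci) /nbhs_rnormP[e e0 eA].
have [d d0 dP] := curve_C1_continuous cC t e0.
by exists d => // s /dP /eA.
Qed.

(** A short chain of arcs cannot leave a neighbourhood of [q].  The coordinate
    distance to [q], cut off at a small radius [r], extends by the constant [r]
    to a function [rho] on all of [M]; by [metric_lower] it varies along curves
    at most [L] times as fast as the length, so a chain shorter than [r / L]
    ends where [rho] is less than [r].  Continuity of [rho] at the edge of the
    chart is ensured by a compact neighbourhood [K] of [q] in the chart outside
    of which [rho] is constant. *)
Lemma short_joined_near q (U : set M) : nbhs q U ->
  exists2 e : R, 0 < e & forall x l, joined g x q l \/ joined g q x l ->
    l < e -> U x.
Proof.
move=> qU; pose j := chart_at M q; have qj : cdom M j q by exact: chart_atP.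
pose y0 := Defs.coord M j q; have y0j : cimg M j y0 by exact: coord_img.
have [r1 [L [r10 L0 rP]]] := metric_lower y0j.
have : nbhs (param M j y0) U by rewrite /y0 (coordK qj).
move=> /(param_continuous y0j) /nbhs_rnormP[r2 r20 rU].
pose r := Num.min (r1 / 3) r2.
have r0 : 0 < r by rewrite lt_min r20 divr_gt0.
have r13 : 3 * r <= r1 by rewrite mulrC -ler_pdivlMr // ge_min lexx.
have r2r : r <= r2 by rewrite ge_min lexx orbT.
pose rho m : R := if `[< cdom M j m >] then Num.min r (rnorm (Defs.coord M j m - y0))
                  else r.
have rhoE m : cdom M j m -> rho m = Num.min r (rnorm (Defs.coord M j m - y0)).
  by move=> mj; rewrite /rho asboolT.
pose K := param M j @` [set v : 'rV[R[i]]_n | forall k, square (y0 ord0 k) r (v ord0 k)].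
have boxP (v : 'rV[R[i]]_n) : (forall k, square (y0 ord0 k) r (v ord0 k)) -> rnorm (v - y0) < 3 * r.
  move=> vb; apply: (@le_lt_trans _ _ (2 * r)); last by rewrite ltr_pM2r // ltr_nat.
  apply: rnorm_rV_le => [|k]; first by rewrite mulr_ge0 // ltW.
  have [h1 h2] := vb k; rewrite (le_trans (ler_rnorm_ReIm _)) // !mxE.
  by rewrite mulrDl mul1r lerD.
have Kcl : closed K.
  apply: compact_closed; first exact: hausdorffM.
  apply: continuous_compact; last exact: box_compact.
  apply: continuous_in_subspaceT => v; rewrite inE => /boxP vb.
  by apply: param_continuous; apply: (rP _ _).1; exact: lt_le_trans vb r13.
have inK m : cdom M j m -> rnorm (Defs.coord M j m - y0) <= r -> K m.
  move=> mj mr; exists (Defs.coord M j m); last exact: coordK.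
  move=> k; have := rnorm_coord (Defs.coord M j m - y0) k; rewrite !mxE => h.
  have {}h := le_trans h mr.
  by split; apply: le_trans h; [exact: ler_Re_rnorm|exact: ler_Im_rnorm].
have outK m : ~ K m -> rho m = r.
  move=> mK; rewrite /rho; case: asboolP => // mj.
  by apply/min_idPl; rewrite leNgt; apply/negP => /ltW /(inK _ mj).
have rhoL : forall p' q' l, joined g p' q' l -> `|rho q' - rho p'| <= L * l.
  apply: joined_lipschitz; first exact: ltW.
  move=> i c cC ci t t01 e e0; set m := param M i (c t).
  have [[mj m3]|nm] := pselect (cdom M j m /\ rnorm (Defs.coord M j m - y0) < 3 * r);
      last first.
    have mK : ~ K m.
      move=> [v vb vm]; apply: nm; have vr := boxP _ vb.
      have vj : cimg M j v by apply: (rP _ _).1; exact: lt_le_trans vr r13.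
      by rewrite -vm; split; [exact: param_dom|rewrite paramK].
    have nK : nbhs m (~` K).
      by apply: open_nbhs_nbhs; split=> //; exact: closed_openC.
    have [d d0 dP] := param_curve cC (ci _ t01) nK; exists d => // s _ /dP sK.
    rewrite !outK // subrr normr0 mulr_ge0 // addr_ge0 ?(ltW e0) //.
    by rewrite mulr_ge0 ?(ltW L0) // sqrtr_ge0.
  have cit := ci _ t01.
  have ov : overlap i j (c t) by [].
  have dt : differentiable (transition (M := M) i j) (c t).
    exact: transition_holomorphic.
  have [B _ LB] := diff_rnorm dt.
  have cD := curve_rderiv (cC.1 t).
  have gD := rderiv_frechet LB cD (differentiable_frechet dt).
  have speedB : rnorm ('d (transition (M := M) i j) (c t) (curve_derive c t)) <=
      L * speed g i c t.
    have := (rP _ (lt_le_trans m3 r13)).2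
      ('d (transition (M := M) i j) (c t) (curve_derive c t)).
    by rewrite /speed -(metric_transition g _ _ ov).
  have [d1 d10 H1] := rderiv_local gD speedB e0.
  have [d2 d20 H2] := param_curve cC cit (nbhs_cdom mj).
  exists (Num.min d1 d2); first by rewrite lt_min d10.
  move=> s _; rewrite lt_min => /andP[/H1 h1 /H2 sj].
  rewrite (rhoE _ sj) (rhoE _ mj); apply: le_trans h1.
  set a := Defs.coord M j _ - y0; set b := Defs.coord M j _ - y0.
  have -> : (transition (M := M) i j \o c) s - (transition (M := M) i j \o c) t = a - b.
    by rewrite /a /b subrACA subrr subr0.
  have ab1 := ler_rnorm_dist a b; have ab2 := ler_rnorm_dist b a.
  rewrite (rnormB b) in ab2.
  exact: min_lipschitz ab1 ab2.
have rhoq : rho q = 0.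
  by rewrite (rhoE _ qj) subrr rnorm0; apply/min_idPr/ltW.
exists (r / L); first by rewrite divr_gt0.
move=> x l xql; rewrite ltr_pdivlMr // mulrC => lr.
have : rho x <= L * l.
  case: xql => /rhoL; rewrite rhoq.
    by rewrite sub0r normrN; apply: le_trans; exact: ler_norm.
  by rewrite subr0; apply: le_trans; exact: ler_norm.
move=> /le_lt_trans /(_ lr); rewrite /rho; case: asboolP => [xj|_]; last by rewrite ltxx.
rewrite gt_min ltxx /= => xr.
rewrite -(coordK xj); apply: rU.
exact: lt_le_trans xr r2r.
Qed.

Lemma segment_C1 (x y : 'rV[R[i]]_n) : curve_C1 (seg x y).
Proof.
apply: (curve_C1_intro (D := fun=> y - x)); first by move=> t; exact: rderiv_line.
by move=> k a b; exact: vcontinuous_cst.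
Qed.

Lemma chart_joined q : exists2 U : set M, nbhs q U & forall x, U x ->
  (exists l, joined g q x l) /\ (exists l, joined g x q l).
Proof.
pose j := chart_at M q; have qj : cdom M j q by exact: chart_atP.
have [r r0 rP] := chart_ball (coord_img qj).
exists [set m | cdom M j m /\ rnorm (Defs.coord M j m - Defs.coord M j q) < r].
  exact: coord_rcont.
have H (x y : M) : cdom M j x -> cdom M j y ->
    rnorm (Defs.coord M j x - Defs.coord M j q) < r ->
    rnorm (Defs.coord M j y - Defs.coord M j q) < r -> exists l, joined g x y l.
  move=> xj yj xr yr.
  have := joined_arc1 g (segment_C1 (Defs.coord M j x) (Defs.coord M j y)) (i := j).
  rewrite seg0 seg1 (coordK xj) (coordK yj) => jo; eexists; apply: jo.
  by move=> t t01; apply: rP; exact: rnorm_seg.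
have q0 : rnorm (Defs.coord M j q - Defs.coord M j q) < r by rewrite subrr rnorm0.
by move=> x [xj xr]; split; exact: H.
Qed.

(** An application of [cousin] along a path, for two relations on [M]: being
    joined by a chain of arcs, and having the same value of a locally constant
    function. *)
Lemma path_connected_trans (T : topologicalType) (Q : T -> T -> Prop) :
  path_connected R T -> (forall x y z, Q x y -> Q y z -> Q x z) ->
  (forall q : T, exists2 U : set T, nbhs q U & forall x, U x -> Q q x /\ Q x q) ->
  forall x y, Q x y.
Proof.
move=> pc Qt Ql x y; have [gamma [gc <- <-]] := pc x y.
apply: (@cousin _ (fun s t => Q (gamma s) (gamma t))) => //.
  by move=> a b c _ _ _ _; exact: Qt.
move=> t t01; have [U tU UQ] := Ql (gamma t).
have tin : `[0, 1]%classic t by rewrite /= in_itv.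
have /subspace_continuousP /(_ t tin U tU) := gc.
rewrite /= /within /= => /nbhs_ballP[d /= d0 dP]; exists d => // a b a0 at' tb b1 ta bt.
have inU s : 0 <= s <= 1 -> `|s - t| < d -> U (gamma s).
  by move=> s01 st; apply: dP; rewrite /ball /= ?in_itv // distrC.
apply: (Qt _ (gamma t)).
  apply: (UQ _ _).2; apply: inU; first by clear - a0 at' t01; lra.
  by rewrite ltr_norml; clear - at' ta d0; lra.
apply: (UQ _ _).1; apply: inU; first by clear - b1 tb t01; lra.
by rewrite ltr_norml; clear - tb bt d0; lra.
Qed.

Lemma joined_all p q : path_connected R M -> exists l, joined g p q l.
Proof.
move=> pc; apply: (path_connected_trans (Q := fun x y => exists l, joined g x y l)) pc _ _ p q.
  by move=> x y z [l xy] [l' yz]; exists (l + l'); exact: joined_trans xy yz.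
exact: chart_joined.
Qed.

Section DistLemmas.
Hypothesis pc : path_connected R M.

Lemma joined_has_inf p q : has_inf [set l | joined g p q l].
Proof.
split; first exact: joined_all.
by exists 0 => l /joined_ge0.
Qed.

Lemma dist_le p q l : joined g p q l -> dist g p q <= l.
Proof. by move=> pq; apply: ge_inf => //; case: (joined_has_inf p q). Qed.

Lemma dist_ge0 p q : 0 <= dist g p q.
Proof. by apply: lb_le_inf; [exact: joined_all|move=> l /joined_ge0]. Qed.

Lemma dist_joined p q (e : R) : 0 < e -> exists2 l, joined g p q l & l < dist g p q + e.
Proof. by move=> e0; have [l] := inf_adherent e0 (joined_has_inf p q); exists l. Qed.

Lemma dist_triangle_l p q x l : joined g x p l -> dist g x q <= l + dist g p q.
Proof.
move=> xp; apply/ler_addgt0Pl => /= e e0; have [l' pq l'e] := dist_joined p q e0.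
apply: le_trans (dist_le (joined_trans xp pq)) _.
by clear - l'e; lra.
Qed.

Lemma dist_triangle_r p q x l : joined g p x l -> dist g q x <= dist g q p + l.
Proof.
move=> px; apply/ler_addgt0Pl => /= e e0; have [l' qp l'e] := dist_joined q p e0.
apply: le_trans (dist_le (joined_trans qp px)) _.
by clear - l'e; lra.
Qed.

Lemma dist_near q (U : set M) : nbhs q U ->
  exists2 e : R, 0 < e & forall x, dist g x q < e \/ dist g q x < e -> U x.
Proof.
move=> /short_joined_near[e e0 eP]; exists e => // x [xq|qx].
  have [|l jl le] := @dist_joined x q (e - dist g x q); first by rewrite subr_gt0.
  by apply: (eP x l); [left|clear - le; lra].
have [|l jl le] := @dist_joined q x (e - dist g q x); first by rewrite subr_gt0.
by apply: (eP x l); [right|clear - le; lra].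
Qed.

End DistLemmas.

End Distance.

(** * Integral curves of frame fields *)

Section TimeChange.
Context {R : realType}.

(** A time change of the line into [[0, 1]] fixing [0] and [1].  An integral curve
    is known on a segment only; composed with [ramp] it becomes a [C^1] curve on
    the whole line, at the price of a factor [pi / 2] in the speed. *)
Definition ramp (t : R) : R := (1 - cos (pi * t)) / 2.
Definition dramp (t : R) : R := pi / 2 * sin (pi * t).

Lemma ramp0 : ramp 0 = 0.
Proof. by rewrite /ramp mulr0 cos0 subrr mul0r. Qed.

Lemma ramp1 : ramp 1 = 1.
Proof. by rewrite /ramp mulr1 cospi; field. Qed.

Lemma ramp01 t : 0 <= ramp t <= 1.
Proof.
have := cos_max (pi * t); rewrite ler_norml => /andP[h1 h2].
by rewrite /ramp; apply/andP; split; lra.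
Qed.

Lemma dramp_bound t : `|dramp t| <= pi / 2.
Proof.
have p0 : 0 <= pi / 2 :> R by rewrite divr_ge0 // pi_ge0.
by rewrite /dramp normrM ger0_norm // ler_piMr // sin_max.
Qed.

Lemma ramp_deriv (t : R) : is_derive t (1 : R) ramp (dramp t).
Proof.
have h1 : is_derive t (1 : R) (fun s : R => pi * s) pi.
  by apply: is_derive_eq; rewrite -[_ *: _]/(pi * 1) mulr1 ?scaler0 ?addr0.
have h2 : is_derive t (1 : R) (fun s : R => cos (pi * s)) (- sin (pi * t) * pi).
  exact: (is_derive1_comp (f := cos) (g := fun s : R => pi * s)).
rewrite /ramp /dramp.
have -> : pi / 2 * sin (pi * t) = (0 - (- sin (pi * t) * pi)) / 2 :> R by field.
have h3 : is_derive t (1 : R) (fun s : R => 1 - cos (pi * s)) (0 - (- sin (pi * t) * pi)).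
  by apply: is_deriveB.
have -> : (fun s => (1 - cos (pi * s)) / 2) = (2^-1 : R) \*: (fun s : R => 1 - cos (pi * s)).
  by apply/funext => s; rewrite mulrC.
by rewrite mulrC; exact: is_deriveZ.
Qed.

Lemma dramp_continuous t (e : R) : 0 < e -> exists2 d : R, 0 < d &
  forall s, `|s - t| < d -> `|dramp s - dramp t| < e.
Proof.
move: e; apply/continuous_eps; apply: cvgM; first exact: cvg_cst.
apply: (continuous_comp (f := fun s : R => pi * s)); last exact: continuous_sin.
by apply: cvgM; [exact: cvg_cst|exact: cvg_id].
Qed.

End TimeChange.

Section FrameFlow.
Context {R : realType} {n : nat} {M : complexManifold R n}.
Variable g : hermitianMetric M.
Variable E : 'I_n -> localField M.
Hypothesis E_holo : forall k, holomorphic_vector_field (E k).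
Hypothesis E_unitary : forall k l i x, cimg M i x ->
  herm g i x (E k i x) (E l i x) = (k == l)%:R.
Variable a : 'I_n -> R[i].
Implicit Types (i : chart M) (phi : R[i] -> M) (p q : M).

Definition frame_field : localField M := fun i x => \sum_(k < n) a k *: E k i x.
Local Notation X := frame_field.

Lemma frame_field_holo : holomorphic_vector_field X.
Proof.
split=> [i j x ov|i x xi].
  rewrite /frame_field linear_sum; apply: eq_bigr => k _.
  by rewrite linearZ /= ((E_holo k).1 _ _ _ ov).
have -> : X i = \sum_(k < n) (fun y => a k *: E k i y).
  by apply/funext => y; rewrite fct_sumE.
by apply: differentiable_sum => k; apply: differentiableZ; exact: (E_holo k).2.
Qed.

Definition frame_speed : R := Num.sqrt (2 * \sum_k rnorm (a k) ^+ 2).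

(** The length of the field is constant because the frame is unitary and the
    coefficients are constant. *)
Lemma metric_frame_field i x (w : R[i]) : cimg M i x ->
  Num.sqrt (g i x (w *: X i x) (w *: X i x)) = rnorm w * frame_speed.
Proof.
move=> xi; have -> : w *: X i x = \sum_k (w * a k) *: E k i x.
  by rewrite scaler_sumr; apply: eq_bigr => k _; rewrite scalerA.
rewrite (metric_frame xi (fun k k' => E_unitary k k' xi)).
have -> : \sum_k rnorm (w * a k) ^+ 2 = rnorm w ^+ 2 * \sum_k rnorm (a k) ^+ 2.
  by rewrite mulr_sumr; apply: eq_bigr => k _; rewrite rnormM exprMn.
rewrite mulrCA sqrtrM ?sqr_ge0 // sqrtr_sqr ger0_norm ?rnorm_ge0 //.
Qed.

Definition flow_speed : R := pi / 2 * frame_speed.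

Lemma flow_speed_ge0 : 0 <= flow_speed.
Proof. by rewrite mulr_ge0 ?sqrtr_ge0 // divr_ge0 // pi_ge0. Qed.

(** Followed with the time change [ramp] inside a single chart, the curve has a
    speed that is constant up to the factor [|dramp t|]. *)
Lemma flow_arc i phi z0 z1 :
  (forall t, 0 <= t <= 1 -> flow_at X phi (seg z0 z1 t) /\
     cdom M i (phi (seg z0 z1 t))) ->
  exists2 l, joined g (phi z0) (phi z1) l & l <= flow_speed * rnorm (z1 - z0).
Proof.
move=> H; have [VX dX] := frame_field_holo.
pose y (t : R) : R[i] := seg z0 z1 (ramp t).
pose c t := Defs.coord M i (phi (y t)).
pose w (t : R) : R[i] := (dramp t)%:C * (z1 - z0).
pose D t := w t *: X i (c t).
have yD t : rderiv y t (w t).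
  have [dr dE] := ramp_deriv t.
  move=> e e0; have z10 : 0 < rnorm (z1 - z0) + 1 by rewrite ltr_wpDl ?rnorm_ge0.
  have [d d0 dP] := derivable_real dr (divr_gt0 e0 z10).
  exists d => // s /dP; rewrite derive1E dE => h.
  have -> : y (t + s) - y t - s%:C *: w t =
      (ramp (t + s) - ramp t - s * dramp t)%:C * (z1 - z0).
    rewrite /y seg_dist /w -[s%:C *: _]/(s%:C * _) mulrA -rmorphM -mulrBl.
    by rewrite -rmorphB.
  rewrite rnormM rnorm_real; apply: le_trans (ler_wpM2r (rnorm_ge0 _) h) _.
  rewrite mulrAC ler_wpM2r // mulrAC ler_pdivrMr // ler_wpM2l ?(ltW e0) //.
  by rewrite lerDl.
have cD t : rderiv c t (D t).
  have [fl di] := H _ (ramp01 t).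
  exact: (rderiv_cder (k := fun z => Defs.coord M i (phi z)) (yD t)
           (flow_at_chart VX fl di)).
have ci t : cimg M i (c t) by apply: coord_img; exact: (H _ (ramp01 t)).2.
have wc (p q : R) : vcontinuous_on w p q.
  apply: vcontinuousM; last exact: vcontinuous_cst.
  move=> t _ e /(dramp_continuous t)[d d0 dP]; exists d => // s _ /dP.
  by rewrite -rmorphB rnorm_real.
have cC : curve_C1 c.
  apply: (curve_C1_intro cD) => k p q.
  have -> : (fun t => D t ord0 k) = (fun t => w t * X i (c t) ord0 k).
    by apply/funext => t; rewrite mxE.
  apply: vcontinuousM; first exact: wc.
  move=> t _ e e0.
  have [d d0 dP] := differentiable_rcont (differentiable_entry k (dX i _ (ci t))) e0.
  have [d' d'0 dP'] := rderiv_continuous (cD t) d0.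
  by exists d' => // s _ /dP' /dP.
exists (arc_length g i c).
  have := joined_arc1 g cC (fun t _ => ci t).
  rewrite /c /y ramp0 ramp1 seg0 seg1.
  have t0 : 0 <= (0 : R) <= 1 by rewrite lexx ler01.
  have t1 : 0 <= (1 : R) <= 1 by rewrite lexx ler01.
  have [_] := H _ t0; rewrite seg0 => d0; have [_] := H _ t1; rewrite seg1 => d1.
  by rewrite (coordK d0) (coordK d1).
have sE t : speed g i c t = rnorm (w t) * frame_speed.
  rewrite /speed (rderiv_curve_derivable (cD t)).2.
  exact: metric_frame_field.
rewrite arc_lengthE; have -> : flow_speed * rnorm (z1 - z0) =
    (pi / 2 * rnorm (z1 - z0)) * frame_speed * (1 - 0).
  by rewrite /flow_speed; ring.
apply: rint_le => //; first apply: speed_continuous => //.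
move=> t _; rewrite sE ler_wpM2r ?sqrtr_ge0 // /w rnormM rnorm_real.
by rewrite ler_wpM2r ?rnorm_ge0 // dramp_bound.
Qed.

Lemma flow_joined phi z0 z1 :
  (forall t, 0 <= t <= 1 -> flow_at X phi (seg z0 z1 t)) ->
  exists2 l, joined g (phi z0) (phi z1) l & l <= flow_speed * rnorm (z1 - z0).
Proof.
move=> H; pose N := rnorm (z1 - z0) + 1.
have N0 : 0 < N by rewrite ltr_wpDl ?rnorm_ge0.
pose Q s t := exists2 l, joined g (phi (seg z0 z1 s)) (phi (seg z0 z1 t)) l &
  l <= flow_speed * rnorm (z1 - z0) * (t - s).
suff : Q 0 1 by rewrite /Q seg0 seg1 subr0 mulr1.
apply: (@cousin _ Q) => // [x y z _ _ _ _ [l xy ll] [l' yz ll']|t t01].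
  exists (l + l'); first exact: joined_trans xy yz.
  have -> : z - x = (y - x) + (z - y) by ring.
  by rewrite mulrDr lerD.
have [phic _] := H t t01.
have [d d0 dP] := phic _ (nbhs_cdom (chart_atP (phi (seg z0 z1 t)))).
exists (d / N); first by rewrite divr_gt0.
move=> x y x0 xt ty y1 dx dy.
have [|l xy ll] := @flow_arc (chart_at M (phi (seg z0 z1 t))) phi
    (seg z0 z1 x) (seg z0 z1 y).
  move=> u /andP[u0 u1]; rewrite seg_sub.
  have s1 : x <= x + u * (y - x) by rewrite lerDl mulr_ge0 // subr_ge0 (le_trans xt).
  have s2 : x + u * (y - x) <= y.
    by rewrite -lerBrDl ler_piMl // subr_ge0 (le_trans xt).
  split; first by apply: H; clear - x0 y1 s1 s2; lra.
  apply: dP; rewrite seg_dist rnormM rnorm_real.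
  have : `|x + u * (y - x) - t| < d / N.
    by rewrite ltr_norml; clear - s1 s2 xt ty dx dy; lra.
  rewrite ltr_pdivlMr //; apply: le_lt_trans.
  by rewrite ler_wpM2l // lerDl.
exists l => //; apply: le_trans ll _.
rewrite seg_dist rnormM rnorm_real ger0_norm ?subr_ge0 ?(le_trans xt) //.
by rewrite mulrCA mulrC.
Qed.

End FrameFlow.

(** * Continuation of integral curves *)

Section GlueFlow.
Context {R : realType} {n : nat} {M : complexManifold R n}.
Variable X : localField M.
Hypothesis X_holo : holomorphic_vector_field X.
Implicit Types (phi psi : R[i] -> M) (z w c : R[i]) (A B : set R[i]).

Lemma flow_at_near phi psi z (d : R) : 0 < d ->
  (forall w, rnorm (w - z) < d -> phi w = psi w) ->
  flow_at X phi z -> flow_at X psi z.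
Proof.
move=> d0 pp [phic [i zi ci]].
have ppz : phi z = psi z by apply: pp; rewrite subrr rnorm0.
split.
  rewrite -ppz => U /phic[d' d'0 dP]; exists (Num.min d d'); first by rewrite lt_min d0.
  by move=> w; rewrite lt_min => /andP[/pp <- /dP].
exists i; first by rewrite -ppz.
rewrite -ppz; apply: cder_near d0 _ ci => w /pp wE.
by rewrite wE.
Qed.

Lemma flow_at_shift phi z c :
  flow_at X phi (z - c) -> flow_at X (fun w => phi (w - c)) z.
Proof.
move=> [phic [i zi ci]]; split.
  move=> U /phic[d d0 dP]; exists d => // w wz; apply: dP.
  by rewrite opprB addrA subrK.
exists i; first exact: zi.
move=> e e0; have [d d0 dP] := ci e e0; exists d; first exact: d0.
move=> h hd; have := dP h hd.
have -> : z - c + h = z + h - c by rewrite addrAC.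
exact.
Qed.

Definition segment_closed A :=
  forall z w (t : R), A z -> A w -> 0 <= t <= 1 -> A (seg z w t).

Definition metric_open A :=
  forall z, A z -> exists2 d : R, 0 < d & forall w, rnorm (w - z) < d -> A w.

(** On the convex set where both are defined the two curves agree, by
    [flow_unique] along segments from [c]. *)
Lemma flow_glue phi psi A B c :
  segment_closed A -> metric_open A -> segment_closed B -> metric_open B ->
  (forall z, A z -> flow_at X phi z) -> (forall z, B z -> flow_at X psi z) ->
  A c -> B c -> phi c = psi c ->
  exists2 chi : R[i] -> M, (forall z, A z -> chi z = phi z) &
    forall z, A z \/ B z -> flow_at X chi z.
Proof.
move=> Ac Ao Bc Bo Aphi Bpsi cA cB pc.
pose chi z := if `[< A z >] then phi z else psi z.
have chiA z : A z -> chi z = phi z by move=> Az; rewrite /chi asboolT.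
have chiB z : B z -> chi z = psi z.
  move=> Bz; rewrite /chi; case: asboolP => // Az.
  apply: (flow_unique X_holo (z0 := c)) pc => t t01.
    by apply: Aphi; exact: Ac.
  by apply: Bpsi; exact: Bc.
exists chi => // z [Az|Bz].
  have [d d0 dP] := Ao z Az; apply: (flow_at_near d0 _ (Aphi z Az)) => w /dP.
  by move=> /chiA.
have [d d0 dP] := Bo z Bz; apply: (flow_at_near d0 _ (Bpsi z Bz)) => w /dP.
by move=> /chiB.
Qed.

(** A convex neighbourhood of the segment from [0] to [t z0]. *)
Definition tube z0 (t e : R) : set R[i] :=
  [set z | exists2 s : R, 0 <= s <= t & rnorm (z - s%:C * z0) < e].

Lemma tube_segment z0 t e : segment_closed (tube z0 t e).
Proof.
move=> z w u [s s01 zs] [s' s'01 ws] u01; exists (s + u * (s' - s)).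
  move: u01 s01 s'01 => /andP[u0 u1] /andP[s0 st] /andP[s'0 s't].
  have -> : s + u * (s' - s) = (1 - u) * s + u * s' by ring.
  have h : 0 <= 1 - u by rewrite subr_ge0.
  apply/andP; split; first by rewrite addr_ge0 // mulr_ge0.
  have -> : t = (1 - u) * t + u * t by ring.
  by rewrite lerD // ler_wpM2l.
have -> : seg z w u - (s + u * (s' - s))%:C * z0 =
    seg (z - s%:C * z0) (w - s'%:C * z0) u - 0.
  rewrite /seg rmorphD rmorphM rmorphB.
  rewrite -[u%:C *: (w - z)]/(u%:C * _).
  rewrite -[u%:C *: (w - _ - _)]/(u%:C * _).
  by ring.
by apply: rnorm_seg => //; rewrite subr0.
Qed.

Lemma tube_open z0 t e : metric_open (tube z0 t e).
Proof.
move=> z [s s01 zs]; exists (e - rnorm (z - s%:C * z0)); first by rewrite subr_gt0.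
move=> w wz; exists s => //; have := ler_rdistD z w (s%:C * z0).
by clear - wz; lra.
Qed.

Lemma tube_point z0 t e s : 0 < e -> 0 <= s <= t -> tube z0 t e (s%:C * z0).
Proof. by move=> e0 st; exists s => //; rewrite subrr rnorm0. Qed.

Lemma ball_segment c (r : R) : segment_closed [set z | rnorm (z - c) < r].
Proof. by move=> z w t /= hz hw t01; exact: rnorm_seg. Qed.

Lemma ball_metric_open c (r : R) : metric_open [set z | rnorm (z - c) < r].
Proof.
move=> z /= zr; exists (r - rnorm (z - c)); first by rewrite subr_gt0.
by move=> w wz; have := ler_rdistD z w c; clear - wz; lra.
Qed.

Definition tube_flow q z0 (t : R) := exists2 e : R, 0 < e &
  exists2 phi : R[i] -> M, phi 0 = q & forall z, tube z0 t e z -> flow_at X phi z.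

(** The tube and the disc of radius [tau] around its end point together contain a
    longer and thinner tube. *)
Lemma tube_flow_step q z0 (t e tau : R) phi psi : 0 <= t -> 0 < e -> 0 < tau ->
  phi 0 = q -> (forall z, tube z0 t e z -> flow_at X phi z) ->
  psi 0 = phi (t%:C * z0) -> (forall z, rnorm z < tau -> flow_at X psi z) ->
  tube_flow q z0 (t + tau / (2 * (rnorm z0 + 1))).
Proof.
move=> t0 e0 tau0 phi0 Aphi psi0 Bpsi.
pose c := t%:C * z0; pose B : set R[i] := [set z | rnorm (z - c) < tau].
have Bpsi' z : B z -> flow_at X (fun w => psi (w - c)) z.
  by move=> Bz; apply: flow_at_shift; exact: Bpsi.
have cA : tube z0 t e c by apply: tube_point => //; rewrite t0 lexx.
have cB : B c by rewrite /B /= subrr rnorm0.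
have pc : phi c = psi (c - c) by rewrite subrr psi0.
have [chi chiA fl] := flow_glue (@tube_segment z0 t e) (@tube_open z0 t e)
  (@ball_segment c tau) (@ball_metric_open c tau) Aphi Bpsi' cA cB pc.
have tau2 : 0 < tau / 2 by rewrite divr_gt0.
exists (Num.min e (tau / 2)); first by rewrite lt_min e0.
exists chi.
  rewrite chiA //; have := @tube_point z0 t e 0 e0; rewrite mul0r; apply.
  by rewrite lexx.
move=> z [s /andP[s0 st]]; rewrite lt_min => /andP[ze zt]; apply: fl.
have [sle|slt] := leP s t; first by left; exists s => //; rewrite s0.
right; rewrite /B /=; apply: le_lt_trans (ler_rdistD (s%:C * z0) z c) _.
have -> : s%:C * z0 - c = (s - t)%:C * z0 by rewrite /c rmorphB; ring.
rewrite rnormM rnorm_real gtr0_norm ?subr_gt0 //.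
have z1 : 0 < rnorm z0 + 1 by rewrite ltr_wpDl ?rnorm_ge0.
have : (s - t) * rnorm z0 <= tau / 2.
  apply: (@le_trans _ _ ((s - t) * (rnorm z0 + 1))).
    by rewrite ler_wpM2l ?lerDl // subr_ge0 ltW.
  rewrite -ler_pdivlMr // lerBlDl; apply: le_trans st _.
  by rewrite invfM mulrA.
by clear - zt; lra.
Qed.

Lemma tube_flow_sub q z0 (t t' : R) : t <= t' -> tube_flow q z0 t' -> tube_flow q z0 t.
Proof.
move=> tt' [e e0 [phi phi0 fl]]; exists e => //; exists phi => // z [s /andP[s0 st] zs].
by apply: fl; exists s => //; rewrite s0 (le_trans st).
Qed.

Lemma tube_flow0 q z0 : tube_flow q z0 0.
Proof.
have [U qU [tau tau0 H]] := local_flow q X_holo.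
have [phi phi0 fl] := H q (nbhs_singleton qU).
exists tau => //; exists phi => // z [s /andP[s0 s1]].
have -> : s = 0 by apply/eqP; rewrite eq_le s0 s1.
by rewrite mul0r subr0; exact: fl.
Qed.

End GlueFlow.

Section GlobalFlow.
Context {R : realType} {n : nat} {M : complexManifold R n}.
Variable g : hermitianMetric M.
Variable E : 'I_n -> localField M.
Hypothesis E_holo : forall k, holomorphic_vector_field (E k).
Hypothesis E_unitary : forall k l i x, cimg M i x ->
  herm g i x (E k i x) (E l i x) = (k == l)%:R.
Hypothesis pc : path_connected R M.
Hypothesis g_complete : complete_metric g.
Variable a : 'I_n -> R[i].
Local Notation X := (frame_field E a).
Local Notation X_holo := (frame_field_holo E_holo a).
Implicit Types (q : M) (z : R[i]).

(** The values at the end points of the shorter segments form a Cauchy sequence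
    by [flow_joined].  Near its limit, which exists by completeness, integral
    curves are defined for a uniform time [tau], so those started at a late term
    of the sequence extend past [T]. *)
Lemma tube_flow_limit q z0 (T : R) : 0 <= T ->
  (forall k : nat, tube_flow X q z0 (T - T / k.+1%:R)) ->
  exists2 t, T < t & tube_flow X q z0 t.
Proof.
move=> T0 H; pose t (k : nat) : R := T - T / k.+1%:R.
have t_ge0 k : 0 <= t k.
  by rewrite subr_ge0 ler_pdivrMr ?ltr0Sn // ler_peMr // ler1n.
have t_mono k l : (k <= l)%N -> t k <= t l.
  move=> kl; rewrite lerD2l lerN2 ler_wpM2l // lef_pV2 ?posrE ?ltr0Sn //.
  by rewrite ler_nat.
have H' k : exists phi : R[i] -> M, exists2 e : R, 0 < e &
    phi 0 = q /\ forall z, tube z0 (t k) e z -> flow_at X phi z.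
  by have [e e0 [phi phi0 fl]] := H k; exists phi, e.
have [phi phiP] := choice H'.
pose u k := phi k ((t k)%:C * z0).
have fl m s : 0 <= s <= t m -> flow_at X (phi m) (s%:C * z0).
  by move=> st; have [e e0 [_ h]] := phiP m; apply: h; exact: tube_point.
(* The curves on the tubes continue one another, so all terms lie on one curve. *)
have uE k m : (k <= m)%N -> phi m ((t k)%:C * z0) = u k.
  move=> km; have segE s : seg 0 ((t k)%:C * z0) s = (s * t k)%:C * z0.
    by rewrite /seg add0r subr0 rmorphM -mulrA.
  have bnd s m' : (k <= m')%N -> 0 <= s <= 1 -> 0 <= s * t k <= t m'.
    move=> km' /andP[s0 s1]; rewrite mulr_ge0 //=.
    by apply: le_trans (t_mono _ _ km'); rewrite ler_piMl.
  apply: (flow_unique X_holo (z0 := 0)).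
  - by move=> s s01; rewrite segE; apply: fl; exact: bnd.
  - by move=> s s01; rewrite segE; apply: fl; exact: bnd.
  - by have [e _ [-> _]] := phiP m; have [e' _ [-> _]] := phiP k.
have uu k l : exists2 d, joined g (u k) (u l) d &
    d <= flow_speed a * (`|t l - t k| * rnorm z0).
  pose m := maxn k l; have km : (k <= m)%N by exact: leq_maxl.
  have lm : (l <= m)%N by exact: leq_maxr.
  have [s s01|d dj dle] := flow_joined E_holo E_unitary (a := a)
      (phi := phi m) (z0 := (t k)%:C * z0) (z1 := (t l)%:C * z0).
    have -> : seg ((t k)%:C * z0) ((t l)%:C * z0) s =
        ((1 - s) * t k + s * t l)%:C * z0.
      have -> : ((1 - s) * t k + s * t l)%:C =
          (1 - s%:C) * (t k)%:C + s%:C * (t l)%:C.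
        by rewrite rmorphD !rmorphM rmorphB.
      by rewrite /seg -[s%:C *: _]/(s%:C * _); ring.
    apply: fl; move: s01 => /andP[s0 s1]; have s1' : 0 <= 1 - s by rewrite subr_ge0.
    rewrite addr_ge0 ?mulr_ge0 //=.
    have -> : t m = (1 - s) * t m + s * t m by ring.
    by rewrite lerD // ler_wpM2l // t_mono.
  exists d; first by rewrite -(uE k m km) -(uE l m lm).
  move: dle; rewrite -mulrBl rnormM -rmorphB rnorm_real.
  exact.
have v0 := flow_speed_ge0 a.
have tN k l N : (N <= k)%N -> (N <= l)%N -> `|t l - t k| <= T / N.+1%:R.
  have tb m : (N <= m)%N -> T - T / N.+1%:R <= t m <= T.
    move=> Nm; rewrite (t_mono N m Nm) /= /t lerBlDr lerDl.
    by rewrite divr_ge0 // ler0n.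
  move=> /tb /andP[h1 h2] /tb /andP[h3 h4].
  rewrite ler_norml; move: (t k) (t l) (T / _) h1 h2 h3 h4; clear => x y b h1 h2 h3 h4.
  by apply/andP; split; lra.
have arch (b e : R) : 0 <= b -> 0 < e -> exists N : nat, b / N.+1%:R < e.
  move=> b0 e0; exists (Num.truncn (b / e)).
  rewrite ltr_pdivrMr ?ltr0Sn // mulrC -ltr_pdivrMr //.
  exact: truncnS_gt.
have [q' q'P] : exists q' : M, forall e : R, 0 < e -> exists N : nat, forall k : nat,
    (N <= k)%N -> dist g (u k) q' < e.
  apply: g_complete => e e0.
  have [|N NP] := arch (T * (flow_speed a * rnorm z0)) e _ e0.
    exact: mulr_ge0 T0 (mulr_ge0 v0 (rnorm_ge0 _)).
  exists N => k l Nk Nl; have [d dj dle] := uu k l.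
  apply: le_lt_trans (dist_le pc dj) _; apply: le_lt_trans dle _.
  apply: le_lt_trans NP.
  have -> : T * (flow_speed a * rnorm z0) / N.+1%:R =
      flow_speed a * (T / N.+1%:R * rnorm z0) by ring.
  by rewrite ler_wpM2l // ler_wpM2r ?rnorm_ge0 // tN.
have [U qU [tau tau0 UP]] := local_flow q' X_holo.
have [e e0 eU] := dist_near E_holo E_unitary pc qU.
have [N NP] := q'P e e0.
have z1 : 0 < rnorm z0 + 1 by rewrite ltr_wpDl ?rnorm_ge0.
have c0 : 0 < tau / (2 * (rnorm z0 + 1)) by rewrite divr_gt0 // mulr_gt0.
have [N' N'P] := arch T _ T0 c0.
pose k := maxn N N'.
have Uk : U (u k) by apply: eU; left; apply: NP; exact: leq_maxl.
have [psi psi0 psiP] := UP _ Uk.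
have [ek ek0 [phi0 phifl]] := phiP k.
exists (t k + tau / (2 * (rnorm z0 + 1))).
  have : t N' <= t k by apply: t_mono; exact: leq_maxr.
  rewrite {1}/t lerBlDr => h; apply: le_lt_trans h _.
  by rewrite ltrD2l.
exact: (tube_flow_step X_holo (t_ge0 k) ek0 tau0 phi0 phifl psi0 psiP).
Qed.

Lemma tube_flow_all q z0 (t1 : R) : 0 <= t1 -> tube_flow X q z0 t1.
Proof.
move=> t10; apply: contrapT => nt1.
pose S : set R := [set t | 0 <= t /\ tube_flow X q z0 t].
have S0 : S 0 by split; [exact: lexx|exact: (tube_flow0 X_holo)].
have Sub t : S t -> t <= t1.
  move=> [t0 tf]; rewrite leNgt; apply/negP => t1t; apply: nt1.
  by apply: tube_flow_sub tf; exact: ltW.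
have supS : has_sup S by split; [exists 0|exists t1 => t /Sub].
pose T := sup S.
have T0 : 0 <= T by exact: ub_le_sup supS.2 _ S0.
have [|t Tt tf] := @tube_flow_limit q z0 T T0.
  move=> k; have [T00|Tp] := eqVneq T 0.
    by rewrite T00 mul0r subr0; exact: (tube_flow0 X_holo).
  have Tp' : 0 < T / k.+1%:R by rewrite divr_gt0 ?ltr0Sn // lt_def Tp.
  have [s [s0 sf] sT] := sup_adherent Tp' supS.
  by apply: tube_flow_sub sf; exact: ltW.
have : t <= T by apply: ub_le_sup supS.2 _ _; split=> //; exact: le_trans (ltW Tt).
by rewrite leNgt Tt.
Qed.

(** The curves on the tubes around the segments from [0] fit together, because a
    tube around one segment contains the neighbouring segments. *)
Lemma global_flow q : exists2 Phi : R[i] -> M, Phi 0 = q &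
  forall z, flow_at X Phi z.
Proof.
have H z0 : exists phi : R[i] -> M, exists2 e : R, 0 < e &
    phi 0 = q /\ forall z, tube z0 1 e z -> flow_at X phi z.
  by have [e e0 [phi phi0 fl]] := tube_flow_all q z0 ler01; exists phi, e.
have [phi phiP] := choice H.
exists (fun z => phi z z); first by have [e _ []] := phiP 0.
move=> z0; have [e e0 [phi0 fl]] := phiP z0.
have z0z0 : tube z0 1 e z0.
  by exists 1; rewrite ?lexx ?ler01 // mul1r subrr rnorm0.
apply: (flow_at_near e0 _ (fl _ z0z0)) => z ze.
have [e' e'0 [phi0' fl']] := phiP z.
have segE s : seg 0 z s = s%:C * z by rewrite /seg add0r subr0.
apply: (flow_unique X_holo (z0 := 0)); last by rewrite phi0 phi0'.
  move=> s s01; apply: fl; exists s => //; rewrite segE -mulrBr rnormM rnorm_real.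
  move: s01 => /andP[s0 s1]; rewrite ger0_norm //.
  by apply: le_lt_trans ze; rewrite ler_piMl ?rnorm_ge0.
by move=> s s01; rewrite segE; apply: fl'; exact: tube_point.
Qed.

End GlobalFlow.

(** * Holomorphic functions and vector fields *)

Section ApplyField.
Context {R : realType} {n : nat} {M : complexManifold R n}.
Implicit Types (X : localField M) (f : M -> R[i]) (i : chart M) (q : M).

Lemma differentiable_near (V W : normedModType R[i]) (f h : V -> W) x (d : R) : 0 < d ->
  (forall y, rnorm (y - x) < d -> f y = h y) -> differentiable f x ->
  differentiable h x.
Proof.
move=> d0 fh df; have fx : f x = h x by apply: fh; rewrite subrr rnorm0.
have H : frechet h x ('d f x).
  move=> e e0; have [d' d'0 dP] := differentiable_frechet df e0.
  exists (Num.min d d'); first by rewrite lt_min d0.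
  move=> k; rewrite lt_min => /andP[kd /dP]; rewrite fx fh //.
  by rewrite addrAC subrr add0r.
by have [] := frechet_differentiable (diff_continuous df) H.
Qed.

Lemma param_near i (x : 'rV[R[i]]_n) (U : set M) : cimg M i x ->
  nbhs (param M i x) U ->
  exists2 d : R, 0 < d & forall y, rnorm (y - x) < d -> U (param M i y).
Proof. by move=> xi /(param_continuous xi) /nbhs_rnormP. Qed.

(** The definition of [apply_field] uses the chart chosen at the point; the
    transformation law of [X] and the chain rule give the same value in any
    chart. *)
Lemma apply_field_param X f i (x : 'rV[R[i]]_n) :
  vector_field X -> holomorphic f -> cimg M i x ->
  apply_field X f (param M i x) = 'd (fun y => f (param M i y)) x (X i x).
Proof.
move=> VX hf xi; pose j := chart_at M (param M i x).
have qj : cdom M j (param M i x) by exact: chart_atP.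
have xj : cimg M j (transition i j x) by exact: coord_img.
have ov : overlap i j x by [].
pose v := X i x; pose l := cline x v.
have l0 : l 0 = x by rewrite /l /cline scale0r addr0.
have cl : cder l 0 v by exact: frechet_cline.
have dt : differentiable (transition (M := M) i j) (l 0).
  by rewrite l0; exact: transition_holomorphic.
have di : differentiable (fun y => f (param M i y)) (l 0) by rewrite l0; exact: hf.
have dj : differentiable (fun y => f (param M j y)) (transition i j (l 0)).
  by rewrite l0; exact: hf.
have h1 := cder_diff cl di.
have h2 := cder_diff (cder_diff cl dt) dj.
have [d d0 dP] : exists2 d : R, 0 < d & forall w, rnorm (w - 0) < d ->
    cdom M j (param M i (l w)).
  have [d d0 dP] := param_near xi (nbhs_cdom qj).
  have [d' d'0 dP'] := cder_rcont cl d0.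
  by exists d' => // w /dP'; rewrite l0 => /dP.
have h3 : cder (fun w => f (param M i (l w))) 0
    ('d (fun y => f (param M j y)) (transition i j (l 0))
       ('d (transition (M := M) i j) (l 0) v)).
  apply: (cder_near d0) h2 => w /dP wj.
  by rewrite /transition (coordK wj).
have E := etrans (esym (frechet_diff1 h3).2) (frechet_diff1 h1).2.
move: E; rewrite l0 => E; apply: etrans E.
by rewrite /v -(VX _ _ _ ov).
Qed.

Lemma flow_cder X f phi z : vector_field X -> holomorphic f -> flow_at X phi z ->
  cder (fun w => f (phi w)) z (apply_field X f (phi z)).
Proof.
move=> VX hf fl; pose i := chart_at M (phi z).
have qi : cdom M i (phi z) by exact: chart_atP.
have xi := coord_img qi.
have h := cder_diff (flow_at_chart VX fl qi) (hf i _ xi).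
have [d d0 dP] := fl.1 _ (nbhs_cdom qi).
by apply: (cder_near d0) h => w /dP wi; rewrite (coordK wi).
Qed.

Lemma apply_field_holomorphic X f :
  holomorphic_vector_field X -> holomorphic f -> holomorphic (apply_field X f).
Proof.
move=> [VX dX] hf i x xi; have [r r0 rP] := chart_ball xi.
apply: (differentiable_near (f := fun y => 'd (fun y => f (param M i y)) y (X i y)) r0).
  by move=> y /rP yi; rewrite apply_field_param.
apply: differentiable_diff_field r0 _ _; first by move=> y /rP; exact: hf.
by move=> k; apply: differentiable_entry; exact: dX.
Qed.

Lemma holomorphic_near f q (e : R) : holomorphic f -> 0 < e ->
  nbhs q [set m | rnorm (f m - f q) < e].
Proof.
move=> hf e0; pose i := chart_at M q; have qi : cdom M i q by exact: chart_atP.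
have [d d0 dP] := differentiable_rcont (hf i _ (coord_img qi)) e0.
apply: filterS (coord_rcont qi d0) => m [mi /dP].
by rewrite (coordK mi) (coordK qi).
Qed.

Lemma holomorphic_compact_bounded f (K : set M) : holomorphic f -> compact K ->
  exists2 B : R, 0 <= B & forall m, K m -> rnorm (f m) <= B.
Proof.
move=> hf cK; have fc : continuous (fun m : M => rnorm (f m) : R^o).
  move=> q; apply/cvgrPdist_lt => e e0.
  apply: filterS (holomorphic_near q hf e0) => m /=; apply: le_lt_trans.
  rewrite ler_norml; have := ler_rnorm_dist (f m) (f q).
  have := ler_rnorm_dist (f q) (f m); rewrite -(rnormN (f q - f m)) opprB.
  by move: (rnorm _) (rnorm _) (rnorm _) => x y w h1 h2; apply/andP; split; lra.
have : compact ((fun m : M => rnorm (f m) : R^o) @` K).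
  apply: continuous_compact cK; exact: continuous_subspaceT.
move=> /compact_bounded[B [_ BP]]; exists (`|B| + 1); first by rewrite addr_ge0.
move=> m Km; have B1 : B < `|B| + 1 by rewrite (le_lt_trans (ler_norm _)) // ltrDl.
have /= := BP _ B1 (rnorm (f m)); rewrite ger0_norm ?rnorm_ge0 //; apply.
by exists m.
Qed.

Lemma diff0_constant f : path_connected R M -> holomorphic f ->
  (forall i (x u : 'rV[R[i]]_n), cimg M i x -> 'd (fun y => f (param M i y)) x u = 0) ->
  forall x y, f x = f y.
Proof.
move=> pc hf df0; apply: (path_connected_trans (Q := fun x y => f x = f y)) pc _ _.
  by move=> x y z ->.
move=> q; pose i := chart_at M q; have qi : cdom M i q by exact: chart_atP.
have [r r0 rP] := chart_ball (coord_img qi).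
exists [set m | cdom M i m /\ rnorm (Defs.coord M i m - Defs.coord M i q) < r].
  exact: coord_rcont.
move=> m [mi mr]; suff -> : f m = f q by [].
apply/eqP; rewrite -subr_eq0; apply/eqP/rnorm0_eq0/eqP; rewrite eq_le rnorm_ge0 andbT.
rewrite -{1}(coordK mi) -{1}(coordK qi).
apply: (mean_value_diff (f := fun y => f (param M i y))) => t t01.
have ti : cimg M i (seg (Defs.coord M i q) (Defs.coord M i m) t).
  by apply: rP; apply: rnorm_seg => //; rewrite subrr rnorm0.
by split; [exact: hf|rewrite df0 // rnorm0].
Qed.

End ApplyField.

(** * Growth estimates *)

Section Growth.
Context {R : realType} {n : nat} {M : complexManifold R n}.
Variable g : hermitianMetric M.
Variable E : 'I_n -> localField M.
Hypothesis E_holo : forall k, holomorphic_vector_field (E k).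
Hypothesis E_unitary : forall k l i x, cimg M i x ->
  herm g i x (E k i x) (E l i x) = (k == l)%:R.
Hypothesis pc : path_connected R M.
Hypothesis g_complete : complete_metric g.
Implicit Types (q p : M) (f : M -> R[i]) (a : 'I_n -> R[i]).

(** Cauchy's estimate for [f] along the entire integral curve through [q], whose
    values at times of modulus less than [r] are joined to [q], in both
    directions, by curves of length at most [v r]. *)
Lemma field_estimate a f q (r K : R) : holomorphic f -> 0 < r ->
  (forall x, (forall p, dist g x p <= dist g q p + flow_speed a * r) ->
     (forall p, dist g p x <= dist g p q + flow_speed a * r) -> rnorm (f x) <= K) ->
  rnorm (apply_field (frame_field E a) f q) <= 32 * K / r.
Proof.
move=> hf r0 fK; have [VX dX] := frame_field_holo E_holo a.
have [Phi Phi0 fl] := global_flow E_holo E_unitary pc g_complete a q.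
have cf z := flow_cder VX hf (fl z).
have <- : 'd (fun z => f (Phi z)) 0 1 = apply_field (frame_field E a) f q.
  by apply: etrans (frechet_diff1 (cf 0)).2 _; rewrite Phi0.
apply: cauchy_estimate => // z zr; split; first exact: (frechet_diff1 (cf z)).1.
have v0 := flow_speed_ge0 a.
have zv : flow_speed a * rnorm z <= flow_speed a * r by rewrite ler_wpM2l // ltW.
have [//|l lj ll] := flow_joined E_holo E_unitary (a := a) (phi := Phi) (z0 := 0) (z1 := z).
have [//|l' lj' ll'] := flow_joined E_holo E_unitary (a := a) (phi := Phi) (z0 := z) (z1 := 0).
move: ll ll' lj lj'; rewrite Phi0 subr0 sub0r rnormN => ll ll' lj lj'.
apply: fK => p.
  apply: le_trans (dist_triangle_l pc p lj') _; rewrite addrC lerD2l.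
  exact: le_trans ll' zv.
apply: le_trans (dist_triangle_r pc p lj) _; rewrite lerD2l.
exact: le_trans ll zv.
Qed.

(** With the radius [r = 1 + dist g q p], the points [x] of [field_estimate]
    satisfy [1 + dist g x p <= (1 + v) r], where [|f x|] is at most a constant
    multiple of [r ^ d]. *)
Lemma growth_space_field p a (d : R) f : 0 <= d -> growth_space g p d f ->
  growth_space g p (d - 1) (apply_field (frame_field E a) f).
Proof.
move=> d0 [hf [C fC]]; split.
  by apply: apply_field_holomorphic => //; exact: frame_field_holo.
pose v := flow_speed a; have v0 : 0 <= v := flow_speed_ge0 a.
have C0 : 0 <= C.
  have := fC p; rewrite rnorm_normc => /(le_trans (rnorm_ge0 _)).
  by rewrite pmulr_lge0 // powR_gt0 // ltr_wpDr // dist_ge0.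
exists (32 * (C * (1 + v) `^ d)) => q; rewrite rnorm_normc.
pose r := 1 + dist g q p; have r0 : 0 < r by rewrite ltr_wpDr // dist_ge0.
have -> : 32 * (C * (1 + v) `^ d) * (1 + dist g q p) `^ (d - 1) =
    32 * (C * ((1 + v) * r) `^ d) / r.
  rewrite -/r powRB ?(gt_eqF r0) ?implybT // powRr1 ?(ltW r0) //.
  by rewrite powRM ?(ltW r0) ?addr_ge0 //; field; rewrite gt_eqF.
apply: field_estimate => // x xq _.
rewrite -rnorm_normc; apply: le_trans (fC x) _; rewrite ler_wpM2l //.
apply: ge0_ler_powR => //; rewrite ?nnegrE ?mulr_ge0 ?addr_ge0 ?dist_ge0 ?(ltW r0) //.
by rewrite mulrDl mul1r /r -addrA lerD2l; exact: xq.
Qed.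

Lemma dist_gt0 p x : x <> p -> 0 < dist g p x.
Proof.
move=> xp; have [A [B [xA pB AB]]] := hausdorff_separate xp.
have [e e0 eB] := dist_near E_holo E_unitary pc pB.
rewrite lt_def dist_ge0 // andbT; apply/eqP => d0.
apply: (AB x); first exact: nbhs_singleton.
by apply: eB; right; rewrite d0.
Qed.

(** Outside a compact set the quotient of [|f x|] by the distance is less than
    [e], and on the compact set [f] is bounded.  The quotient says nothing at [p],
    where the distance vanishes, so [|f p|] is added to the bound. *)
Lemma limf_esup_bound p f (e : R) : holomorphic f ->
  limf_esup (fun x : M => (Normc.normc (f x) / dist g p x)%:E) (at_infinity M) = 0%E ->
  0 < e -> exists2 C : R, 0 <= C & forall x, rnorm (f x) <= C + e * dist g p x.
Proof.
move=> hf f0 e0; have : (limf_esup (fun x : M => (Normc.normc (f x) / dist g p x)%:E)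
    (at_infinity M) < e%:E)%E by rewrite f0 lte_fin.
move=> /ereal_inf_lt[_ [V [K cK KV] <-]] Ve.
have [B B0 BK] := holomorphic_compact_bounded hf cK.
have C0 : 0 <= B + rnorm (f p) by rewrite addr_ge0 ?rnorm_ge0.
exists (B + rnorm (f p)) => // x.
have ed : 0 <= e * dist g p x by rewrite mulr_ge0 ?dist_ge0 // ltW.
have fp := rnorm_ge0 (f p).
have [xE|/eqP /dist_gt0 xp] := eqVneq x p.
  by move: ed; rewrite xE; clear - B0; lra.
have [/BK xB|nKx] := pselect (K x); first by clear - xB ed fp; lra.
have : ((Normc.normc (f x) / dist g p x)%:E < e%:E)%E.
  apply: le_lt_trans Ve; apply: ereal_sup_ubound; exists x => //; exact: KV.
rewrite lte_fin ltr_pdivrMr // rnorm_normc => /ltW h.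
by rewrite (le_trans h) // lerDr.
Qed.

(** With [|f x| <= C + e * dist g p x], the estimate at radius [r] is a
    constant over [r] plus a multiple of [e * v]; choosing [e] small and then [r]
    large contradicts a nonzero value. *)
Lemma sublinear_field0 p a f q : holomorphic f ->
  limf_esup (fun x : M => (Normc.normc (f x) / dist g p x)%:E) (at_infinity M) = 0%E ->
  apply_field (frame_field E a) f q = 0.
Proof.
move=> hf f0; apply: rnorm0_eq0; apply/eqP; rewrite eq_le rnorm_ge0 andbT leNgt.
apply/negP; set c := rnorm _ => c0.
pose v := flow_speed a; have v0 : 0 <= v := flow_speed_ge0 a.
have v1 : 0 < v + 1 by rewrite ltr_wpDl.
(* With this [e] the term [32 * e * v] is at most [c / 2]. *)
pose e := c / (64 * (v + 1)); have e0 : 0 < e by rewrite divr_gt0 // mulr_gt0.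
have [C C0 fC] := limf_esup_bound hf f0 e0.
pose b := C + e * dist g p q.
have b0 : 0 <= b by rewrite addr_ge0 // mulr_ge0 ?dist_ge0 // ltW.
pose r := 64 * b / c + 1.
have r0 : 0 < r by rewrite ltr_wpDl // divr_ge0 ?(ltW c0) // mulr_ge0.
have : c <= 32 * (b + e * v * r) / r.
  apply: field_estimate => // x _ /(_ p) px; apply: le_trans (fC x) _.
  by rewrite /b -addrA lerD2l -mulrA -mulrDr ler_wpM2l ?(ltW e0).
rewrite ler_pdivlMr //; apply/negP; rewrite -ltNge.
have ev : 64 * (e * v) <= c.
  have -> : 64 * (e * v) = c * (v / (v + 1)).
    by rewrite /e; field; rewrite gt_eqF.
  by rewrite ler_piMr ?(ltW c0) // ler_pdivrMr // mul1r lerDl.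
have evr : 64 * (e * v) * r <= c * r by rewrite ler_wpM2r // ltW.
have cr : c * r = 64 * b + c by rewrite /r; field; rewrite gt_eqF.
have -> : 32 * (b + e * v * r) = 32 * b + (64 * (e * v) * r) / 2 by field.
by move: (64 * _ * r) evr => y evr; clear - evr cr c0; lra.
Qed.

Lemma sublinear_constant p f : holomorphic f ->
  limf_esup (fun x : M => (Normc.normc (f x) / dist g p x)%:E) (at_infinity M) = 0%E ->
  exists c : R[i], forall x, f x = c.
Proof.
move=> hf f0; exists (f p) => x; apply: diff0_constant => // i y u yi.
have [b ->] := frame_span yi (fun k l => E_unitary k l yi) u.
have [VX _] := frame_field_holo E_holo b.
have := apply_field_param VX hf yi.
by rewrite (sublinear_field0 b (param M i y) hf f0) => <-.
Qed.

End Growth.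

Theorem proposition2p4 (R : realType) (n : nat) (M : complexManifold R n)
    (g : hermitianMetric M) (D : connection M)
    (M_simply_connected : simply_connected R M)
    (g_complete : complete_metric g)
    (D_chern : chern_connection g D)
    (D_flat : flat D)
    (E : 'I_n -> localField M)
    (E_frame : parallel_unitary_holomorphic_frame g D E)
    (p : M) :
  (forall (a : 'I_n -> R[i]) (d : R) (f : M -> R[i]),
      0 <= d ->
      growth_space g p d f ->
      growth_space g p (d - 1)
        (apply_field (fun i x => \sum_(j < n) a j *: E j i x) f)) /\
  (forall f : M -> R[i],
      holomorphic f ->
      limf_esup (fun x : M => (Normc.normc (f x) / dist g p x)%:E)
                (at_infinity M) = 0%E ->
      exists c : R[i], forall x : M, f x = c).
Proof.
have [pc _] := M_simply_connected; have [E_holo _ E_unitary] := E_frame.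
split=> [a d f|f]; first exact: growth_space_field.
exact: (sublinear_constant E_holo E_unitary pc g_complete).
Qed.
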